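(* Let $\mathcal{L}=\bigoplus_{i\in\mathbb{Z}}\mathcal{L}_i$ be a graded simple $\mathbb{Z}$-graded Lie conformal algebra over $\mathbb{C}$ such that (C1) $\operatorname{rank}\mathcal{L}_i\le 1$ for every $i\in\mathbb{Z}$; (C2) $\mathcal{L}_0$ is (isomorphic to) the Virasoro Lie conformal algebra $Vir$. Then $\mathcal{L}$ is isomorphic to one of the following Lie conformal algebras: (a) $Vir$. (b) $\mathcal{V}(s)=\bigoplus_{i\in\mathbb{Z}}\mathbb{C}[\partial]L_i$ for some $s\in\mathbb{C}$, where for all $i,j\in\mathbb{Z}$ $$[{L_i}_\lambda L_j]=(\partial+2\lambda+s(i-j))L_{i+j}.$$ (c) $CL_1(s)=\bigoplus_{i\in\mathbb{Z}_{\ge -1}}\mathbb{C}[\partial]L_i$ for some $s\in\mathbb{C}$, where for all $i,j\ge -1$ $$[{L_i}_\lambda L_j]=((i+1)\partial+(i+j+2)\lambda+s(j-i))L_{i+j}.$$ (d) $CL_2(b,s)=\bigoplus_{i\in\mathbb{Z}}\mathbb{C}[\partial]L_i$ for some $b,s\in\mathbb{C}$ with $2b\notin\mathbb{Z}$, where for all $i,j\in\mathbb{Z}$ $$[{L_i}_\lambda L_j]=((i+b)\partial+(i+j+2b)\lambda+s(i-j))L_{i+j}.$$ (e) $SCL_2(b,s)=\bigoplus_{i\in\mathbb{Z}}\mathbb{C}[\partial]L_i$ for some $b,s\in\mathbb{C}$ with $0\ne 2b\in\mathbb{Z}$, whose $\lambda$-brackets are determined (together with skew-symmetry) by $$[{L_0}_\lambda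 L_{-2b}]=b(\partial+\lambda+2s)L_{-2b},$$ $$[{L_{-2b}}_\lambda L_{-2b}]=-b(-\lambda+2s)(\partial+\lambda+2s)(\partial+2\lambda)L_{-4b},$$ $$[{L_i}_\lambda L_{-2b}]=(\partial+\lambda+2s)\big((i+b)\partial+i\lambda+s(i+2b)\big)L_{i-2b}\quad\text{for } i\ne 0,-2b,$$ $$[{L_i}_\lambda L_j]=((i+b)\partial+(i+j+2b)\lambda+s(i-j))L_{i+j}\quad\text{if } i,j\neq -2b \text{ and } i+j\ne -2b,$$ $$[{L_i}_\lambda L_j]=\frac{i-j}{2}L_{i+j}\quad\text{if } i+j=-2b\text{ and } i,j\ne 0.$$
   Context: All vector spaces are over $\mathbb{C}$. A Lie conformal algebra is a $\mathbb{C}[\partial]$-module $\mathcal{A}$ with a $\mathbb{C}$-linear map ($\lambda$-bracket) $\mathcal{A}\otimes\mathcal{A}\to\mathcal{A}[\lambda]$, $a\otimes b\mapsto[a_\lambda b]$, satisfying $[\partial a_\lambda b]=-\lambda[a_\lambda b]$, $[a_\lambda\partial b]=(\partial+\lambda)[a_\lambda b]$, skew-symmetry $[a_\lambda b]=-[b_{-\lambda-\partial}a]$, and the Jacobi identity $[a_\lambda[b_\mu c]]=[[a_\lambda b]_{\lambda+\mu}c]+[b_\mu[a_\lambda c]]$. An ideal is a $\mathbb{C}[\partial]$-submodule $I$ with $[\mathcal{A}_\lambda I]\subset I[\lambda]$. The rank of a $\mathbb{C}[\partial]$-module $M$ is $\dim_{\mathbb{C}(\partial)}(\mathbb{C}(\partial)\otimes_{\mathbb{C}[\partial]}M)$.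 A Lie conformal algebra $\mathcal{G}$ is $\mathbb{Z}$-graded if $\mathcal{G}=\bigoplus_{i\in\mathbb{Z}}\mathcal{G}_i$ with each $\mathcal{G}_i$ a $\mathbb{C}[\partial]$-submodule and $[{\mathcal{G}_i}_\lambda\mathcal{G}_j]\subset\mathcal{G}_{i+j}[\lambda]$; it is graded simple if it has no proper nonzero graded ideals. $Vir=\mathbb{C}[\partial]L$ is free of rank one with $[L_\lambda L]=(\partial+2\lambda)L$. $\mathbb{Z}_{\ge -1}$ is the set of integers $\ge -1$. Isomorphisms are isomorphisms of Lie conformal algebras. *)

(* Defs.v *)
From HB Require Import structures.
From mathcomp Require Import all_boot all_order all_algebra.
From mathcomp Require Export reals.
From mathcomp.real_closed Require Export complex.
From mathcomp Require Import finmap.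
From mathcomp.multinomials Require Import monalg.

Set Implicit Arguments.
Unset Strict Implicit.
Unset Printing Implicit Defensive.

Import GRing.Theory.
Local Open Scope ring_scope.

(* In comments d, l, m stand for the partial derivative and the two formal
   variables lambda and mu.
   An F[d]-module is an lmodType over {poly F}: d acts as 'X and a scalar c : F
   as c%:P.  For such a module A, the space A[l] of polynomials in l with
   coefficients in A is {malg A[nat]}: f@_n is the coefficient of l^n. *)

Section FormalPolynomials.
Variables (F : fieldType) (A : lmodType {poly F}).

(* F[d][l] *)
Definition dl : {poly {poly F}} := 'X%:P.
Definition lam : {poly {poly F}} := 'X.
Definition cst (c : F) : {poly {poly F}} := c%:P%:P.

(* F[d][l][m] *)
Definition lam2 : {poly {poly {poly F}}} := 'X%:P.
Definition mu2 : {poly {poly {poly F}}} := 'X.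

(* q(d, l) a in A[l] *)
Definition pscale (q : {poly {poly F}}) (a : A) : {malg A[nat]} :=
  \sum_(k < size q) << q`_k *: a *g (k : nat) >>.

(* q(d, l) f in A[l] *)
Definition pact (q : {poly {poly F}}) (f : {malg A[nat]}) : {malg A[nat]} :=
  \sum_(n <- msupp f) pscale (q * lam ^+ n) f@_n.

(* f(q(d, l)): each power l^n is replaced by q(d, l)^n, acting on the
   coefficient of l^n *)
Definition psubst (q : {poly {poly F}}) (f : {malg A[nat]}) : {malg A[nat]} :=
  \sum_(n <- msupp f) pscale (q ^+ n) f@_n.

(* q(d, l, m) a in A[l, m]; the exponents of l and m are the first and the
   second component of the index *)
Definition pscale2 (q : {poly {poly {poly F}}}) (a : A) :
    {malg A[(nat * nat)%type]} :=
  \sum_(n < size q) \sum_(m < size q`_n)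
    << q`_n`_m *: a *g ((m : nat), (n : nat)) >>.

(* For f = \sum_k f_k x^k and maps g : A -> A[y], the polynomial
   \sum_k x^k g(f_k)(y) evaluated at x := p(d, l, m) and y := q(d, l, m). *)
Definition pnest (p q : {poly {poly {poly F}}}) (g : A -> {malg A[nat]})
    (f : {malg A[nat]}) : {malg A[(nat * nat)%type]} :=
  \sum_(k <- msupp f) \sum_(l <- msupp (g f@_k))
    pscale2 (p ^+ k * q ^+ l) (g f@_k)@_l.

End FormalPolynomials.

Arguments dl {F}.
Arguments lam {F}.
Arguments lam2 {F}.
Arguments mu2 {F}.

(* Being a Lie conformal algebra is a property of a module with a bracket, and
   it is invariant under the isomorphisms below. *)
Record conformal (F : fieldType) := Conformal {
  carrier :> lmodType {poly F};
  bracket : carrier -> carrier -> {malg carrier[nat]}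
}.

Section LieConformal.
Variables (F : fieldType) (A : conformal F).
Implicit Types a b c : A.

Local Notation "[[ a , b ]]" := (@bracket F A a b).

Record lie_conformal : Prop := LieConformal {
  bracket_linearl : forall (x : F) a a' b,
    [[x%:P *: a + a', b]] = pact (cst x) [[a, b]] + [[a', b]];
  bracket_linearr : forall (x : F) a b b',
    [[a, x%:P *: b + b']] = pact (cst x) [[a, b]] + [[a, b']];
  bracket_sesquil : forall a b,
    [['X *: a, b]] = pact (- lam) [[a, b]];
  bracket_sesquir : forall a b,
    [[a, 'X *: b]] = pact (dl + lam) [[a, b]];
  bracket_skew : forall a b,
    [[a, b]] = - psubst (- lam - dl) [[b, a]];
  bracket_jacobi : forall a b c,
    pnest mu2 lam2 (fun x => [[a, x]]) [[b, c]] =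
      pnest lam2 (lam2 + mu2) (fun x => [[x, c]]) [[a, b]] +
      pnest lam2 mu2 (fun x => [[b, x]]) [[a, c]]
}.

Definition ideal (I : submodClosed A) : Prop :=
  forall a x, x \in I -> forall n, [[a, x]]@_n \in I.

Definition direct_sum (G : int -> submodClosed A) : Prop :=
  (forall a, exists (s : seq int) (x : int -> A),
     (forall i, x i \in G i) /\ a = \sum_(i <- s) x i) /\
  (forall (s : seq int) (x : int -> A),
     uniq s -> (forall i, x i \in G i) -> \sum_(i <- s) x i = 0 ->
     forall i, i \in s -> x i = 0).

Definition graded (G : int -> submodClosed A) : Prop :=
  direct_sum G /\
  forall i j a b, a \in G i -> b \in G j ->
    forall n, [[a, b]]@_n \in G (i + j).

(* the homogeneous components of an element of I are in I *)
Definition graded_submod (G : int -> submodClosed A) (I : submodClosed A) :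
    Prop :=
  forall (s : seq int) (x : int -> A),
    uniq s -> (forall i, x i \in G i) -> \sum_(i <- s) x i \in I ->
    forall i, i \in s -> x i \in I.

Definition graded_simple (G : int -> submodClosed A) : Prop :=
  forall I : submodClosed A, ideal I -> graded_submod G I ->
    (forall a, a \in I -> a = 0) \/ (forall a, a \in I).

End LieConformal.

Section Isomorphism.
Variables (F : fieldType) (A B : conformal F).

Definition bracket_morphism (f : A -> B) : Prop :=
  forall a b n, f (bracket a b)@_n = (bracket (f a) (f b))@_n.

Definition isomorphic : Prop :=
  exists f : {linear A -> B}, bijective f /\ bracket_morphism f.

(* A is isomorphic to the subalgebra U of B *)
Definition isomorphic_sub (U : submodClosed B) : Prop :=
  exists f : {linear A -> B},
    [/\ injective f, forall y, y \in U <-> exists x, f x = y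
      & bracket_morphism f].

End Isomorphism.

Section Rank.
Variable F : fieldType.
Local Notation K := {fraction {poly F}}.

Definition semilinear (M : lmodType {poly F}) (V : lmodType K) (f : M -> V) :
    Prop :=
  forall (p : {poly F}) (x y : M), f (p *: x + y) = tofrac p *: f x + f y.

(* V, with f : M -> V, is the tensor product of K and M over {poly F} *)
Definition scalar_extension (M : lmodType {poly F}) (V : lmodType K)
    (f : M -> V) : Prop :=
  semilinear f /\
  forall (W : lmodType K) (g : M -> W), semilinear g ->
    exists h : {linear V -> W}, (forall x, h (f x) = g x) /\
      forall h' : {linear V -> W}, (forall x, h' (f x) = g x) -> h' =1 h.

Definition has_dim (V : lmodType K) (n : nat) : Prop :=
  exists v : 'I_n -> V, forall w,
    exists! c : {ffun 'I_n -> K}, w = \sum_i c i *: v i.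

Definition has_rank (M : lmodType {poly F}) (n : nat) : Prop :=
  exists (V : lmodType K) (f : M -> V), scalar_extension f /\ has_dim V n.

End Rank.

Section Submodule.
Variables (F : fieldType) (M : lmodType {poly F}) (S : submodClosed M).

Definition submod := {x : M | x \in S}.
HB.instance Definition _ := SubChoice.on submod.
HB.instance Definition _ := [SubChoice_isSubLmodule of submod by <:].

End Submodule.

(* Free F[d]-modules with basis indexed by I, and the sesquilinear extension of
   a bracket t i j of the basis elements i and j. *)
Section Free.
Variables (F : fieldType) (I : choiceType).
Local Notation A := {malg {poly F}[I]}.

Definition gen (i : I) : A := << 1 *g i >>.

(* p(q(d, l)) *)
Definition peval (p : {poly F}) (q : {poly {poly F}}) : {poly {poly F}} :=
  (map_poly (@cst F) p).[q].

Definition free_conformal (t : I -> I -> {malg A[nat]}) : conformal F :=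
  @Conformal F A (fun a b =>
    \sum_(i <- msupp a) \sum_(j <- msupp b)
      pact (peval a@_i (- lam) * peval b@_j (dl + lam)) (t i j)).

End Free.

Section Examples.
Variable F : fieldType.
Local Notation e := (@gen F int).
Local Notation d := (@dl F).
Local Notation l := (@lam F).

Definition Vir : conformal F :=
  free_conformal (fun _ _ : unit => pscale (d + 2%:R * l) (gen F tt)).

Definition V (s : F) : conformal F :=
  free_conformal (fun i j : int =>
    pscale (d + 2%:R * l + cst s * (i - j)%:~R) (e (i + j))).

(* Indices i + j < -1 only occur for i = j = -1, where the coefficient is 0. *)
Definition CL1_index := {i : int | -1 <= i}.

Definition CL1_gen (k : int) : {malg {poly F}[CL1_index]} :=
  if insub k is Some i then gen F (i : CL1_index) else 0.

Definition CL1 (s : F) : conformal F :=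
  free_conformal (fun u v : CL1_index =>
    let i := val u in let j := val v in
    pscale ((i + 1)%:~R * d + (i + j + 2)%:~R * l + cst s * (j - i)%:~R)
      (CL1_gen (i + j))).

Definition CL2_table (b s : F) (i j : int) : {malg {malg {poly F}[int]}[nat]} :=
  pscale ((i%:~R + cst b) * d + ((i + j)%:~R + 2%:R * cst b) * l +
          cst s * (i - j)%:~R)
    (e (i + j)).

Definition CL2 (b s : F) : conformal F := free_conformal (CL2_table b s).

(* m is the integer -2b, and SCL2_right b s m i is the bracket of L_i with L_m;
   the bracket of L_m with L_j, for j <> m, is obtained by skew-symmetry. *)
Definition SCL2_right (b s : F) (m i : int) : {malg {malg {poly F}[int]}[nat]} :=
  let r := d + l + 2%:R * cst s in
  if i == 0 then pscale (cst b * r) (e m)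
  else if i == m then
    pscale (- cst b * (- l + 2%:R * cst s) * r * (d + 2%:R * l)) (e (2 * m))
  else
    pscale (r * ((i%:~R + cst b) * d + i%:~R * l + cst s * (i - m)%:~R))
      (e (i + m)).

Definition SCL2_table (b s : F) (m i j : int) :
    {malg {malg {poly F}[int]}[nat]} :=
  if j == m then SCL2_right b s m i
  else if i == m then - psubst (- l - d) (SCL2_right b s m j)
  else if i + j == m then pscale (cst ((i - j)%:~R / 2%:R)) (e m)
  else CL2_table b s i j.

Definition SCL2 (b s : F) (m : int) : conformal F :=
  free_conformal (SCL2_table b s m).

End Examples.

Arguments Vir : clear implicits.

(* Main.v *)
From HB Require Import structures.
Require Import Defs.
From mathcomp Require Import all_boot all_order all_algebra.
From mathcomp Require Import generic_quotient finmap boolp ring zify.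
From mathcomp.multinomials Require Import monalg.

Set Implicit Arguments.
Unset Strict Implicit.
Unset Printing Implicit Defensive.

Import Order.TTheory GRing.Theory Num.Theory.
Local Open Scope ring_scope.

(* Torsion elements are central and form a graded ideal, hence vanish; so do the
   elements annihilated by L_0.  Therefore each nonzero component is free of rank
   one on a generator e_i with [L_0 _l e_i] = (d + al_i + (1 - w_i) l) e_i.  The
   numbers al_i are additive along nonzero brackets, and a translation of the
   formal variables removes them.  The brackets [e_i _l e_j] then become symbols
   P_ij of bilinear differential operators F_{w_i} x F_{w_j} -> F_{w_{i+j}} between
   densities on the line, commuting with all vector fields.  Such a symbol is
   homogeneous of degree w_{i+j} - w_i - w_j, and a degree at least 2 imposes a
   quadratic relation on the weights.

   Comparing degrees in the Jacobi identity, especially for the operators P_{i,-i},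
   whose degree is at most 2, leaves two shapes for a nontrivial support: either
   the support is gZ and w_{ng} = n th - 1, except that the weight 1 is replaced
   by 0 (the derivative F_0 -> F_1 is covariant, and weight 1 would leave a graded
   ideal, the multiples of d + al_i in degree i); or the support is
   {n x : n >= -1} with w_{nx} = -1 - n.  After normalizing one structure constant
   per degree, the first shape is V(s) for th = 0 and otherwise, with b = -1/th,
   CL2(b, s) if 2b is not an integer and SCL2(b, s) if it is; the second is CL1(s). *)

(** * Covariant symbols *)

(** Formal variables are replaced by elements of the field, which is infinite: every identity
    becomes one between polynomial functions, and consequences of Jacobi identities become linear
    combinations checked by [ring]. Covariance of the symbols is the Jacobi identity with L_0 as an
    entry. The other tool is that polynomials have no zero divisors. The Jacobi identity relates
    three products of two symbols; if one product is killed at a root of a factor, the two others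
    vanish together or not at all. The obstacle is that a symbol may vanish for no visible reason:
    graded simplicity only says that the support is connected under brackets and that a degree i of
    weight 1 is reached modulo d + al_i. The pairs (i, - i) are the way out, because brackets with
    L_0 never vanish on the support, so that the effect of i followed by - i is known. The weights 0
    and 1 stand apart throughout: exactly for them the symbol b + w a of L_0 has no root (a, b) with
    a, b and a + b all nonzero. *)

Section PolynomialFunctions.
Variable F : numFieldType.
Implicit Types (f g : F -> F -> F) (h : F -> F) (a b c t u v x y : F).

(** This family serves as a linear-combination tactic: the coefficients of the hypotheses are
    supplied by hand, and [ring] or [field] checks the certificate. *)
Lemma eq_comb (x y z s : F) : z = s -> x - y = z - s -> x = y.
Proof. by move=> -> /eqP; rewrite subrr subr_eq0 => /eqP. Qed.

Lemma eq_lin1 k1 x y z1 s1 : z1 = s1 -> x - y = k1 * (z1 - s1) -> x = y :> F.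
Proof. by move=> ->; rewrite subrr mulr0 => /eqP; rewrite subr_eq0 => /eqP. Qed.

Lemma eq_lin2 k1 k2 x y z1 s1 z2 s2 : z1 = s1 -> z2 = s2 ->
  x - y = k1 * (z1 - s1) + k2 * (z2 - s2) -> x = y :> F.
Proof. by move=> -> E H; apply: (eq_lin1 E); rewrite H subrr mulr0 add0r. Qed.

Lemma eq_lin3 k1 k2 k3 x y z1 s1 z2 s2 z3 s3 : z1 = s1 -> z2 = s2 -> z3 = s3 ->
  x - y = k1 * (z1 - s1) + k2 * (z2 - s2) + k3 * (z3 - s3) -> x = y :> F.
Proof. by move=> -> E2 E3 H; apply: (eq_lin2 E2 E3); rewrite H subrr mulr0 add0r. Qed.

Lemma eq_lin4 k1 k2 k3 k4 x y z1 s1 z2 s2 z3 s3 z4 s4 :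
  z1 = s1 -> z2 = s2 -> z3 = s3 -> z4 = s4 ->
  x - y = k1 * (z1 - s1) + k2 * (z2 - s2) + k3 * (z3 - s3) + k4 * (z4 - s4) ->
  x = y :> F.
Proof. by move=> -> E2 E3 E4 H; apply: (eq_lin3 E2 E3 E4); rewrite H subrr mulr0 add0r. Qed.

Definition ispoly h := exists q : {poly F}, forall t, h t = q.[t].

Lemma ispoly_cst c : ispoly (fun=> c).
Proof. by exists c%:P => t; rewrite hornerC. Qed.

Lemma ispoly_id : ispoly (fun t => t).
Proof. by exists 'X => t; rewrite hornerX. Qed.

Lemma ispolyD h1 h2 : ispoly h1 -> ispoly h2 -> ispoly (fun t => h1 t + h2 t).
Proof. by move=> [p Hp] [q Hq]; exists (p + q) => t; rewrite hornerD Hp Hq. Qed.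

Lemma ispolyM h1 h2 : ispoly h1 -> ispoly h2 -> ispoly (fun t => h1 t * h2 t).
Proof. by move=> [p Hp] [q Hq]; exists (p * q) => t; rewrite hornerM Hp Hq. Qed.

Lemma ispolyN h : ispoly h -> ispoly (fun t => - h t).
Proof. by move=> [p Hp]; exists (- p) => t; rewrite hornerN Hp. Qed.

Lemma ispolyX h n : ispoly h -> ispoly (fun t => h t ^+ n).
Proof. by move=> [p Hp]; exists (p ^+ n) => t; rewrite horner_exp Hp. Qed.

Lemma ispoly_sum n (h : 'I_n -> F -> F) :
  (forall i, ispoly (h i)) -> ispoly (fun t => \sum_i h i t).
Proof.
move=> /choice[q Hq]; exists (\sum_i q i) => t.
by rewrite horner_sum; apply: eq_bigr => i _.
Qed.

(** The test points 1, 2, 3, ... omit 0, so that a factor t may be cancelled before the evaluation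
    at t. *)
Lemma poly_fun0 (q : {poly F}) : (forall t, t != 0 -> q.[t] = 0) -> q = 0.
Proof.
move=> Hq; apply/eqP; apply: contraT => q0.
pose rs := [seq (i.+1)%:R : F | i <- iota 0 (size q)].
have := @max_poly_roots _ q rs q0.
rewrite size_map size_iota ltnn; apply.
  apply/allP => x /mapP[i _ ->]; rewrite /root Hq //.
  by rewrite pnatr_eq0.
rewrite map_inj_uniq ?iota_uniq // => i j /eqP; rewrite eqr_nat => /eqP.
by case.
Qed.

Lemma ispoly_eq h1 h2 : ispoly h1 -> ispoly h2 ->
  (forall t, t != 0 -> h1 t = h2 t) -> h1 =1 h2.
Proof.
move=> [p Hp] [q Hq] E t.
have /eqP : p - q = 0.
  by apply: poly_fun0 => s s0; rewrite hornerD hornerN -Hp -Hq E ?subrr.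
by rewrite subr_eq0 Hp Hq => /eqP ->.
Qed.

Lemma ispoly_dom h1 h2 : ispoly h1 -> ispoly h2 ->
  (forall t, h1 t * h2 t = 0) -> (forall t, h1 t = 0) \/ (forall t, h2 t = 0).
Proof.
move=> [p Hp] [q Hq] E.
have /eqP : p * q = 0.
  by apply: poly_fun0 => s s0; rewrite hornerM -Hp -Hq E.
rewrite mulf_eq0 => /orP[] /eqP e0; [left|right] => t.
  by rewrite Hp e0 horner0.
by rewrite Hq e0 horner0.
Qed.

(** The zero function is a form of every degree; nonvanishing is carried separately by [nz]. *)
Definition hform (k : nat) f := exists c : nat -> F,
  forall a b, f a b = \sum_(r < k.+1) c r * a ^+ r * b ^+ (k - r).

Definition nz f := exists a b, f a b != 0.

Lemma nzPn f : ~ nz f -> forall a b, f a b = 0.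
Proof.
by move=> H a b; apply/eqP; apply: contraT => fab; case: H; exists a, b.
Qed.

Lemma ispoly_hform k f h1 h2 : hform k f -> ispoly h1 -> ispoly h2 ->
  ispoly (fun t => f (h1 t) (h2 t)).
Proof.
move=> [c Hc] H1 H2.
have [q Hq] : ispoly (fun t => \sum_(r < k.+1) c r * h1 t ^+ r * h2 t ^+ (k - r)).
  apply: ispoly_sum => r; apply: ispolyM; last exact: ispolyX.
  by apply: ispolyM; [exact: ispoly_cst | exact: ispolyX].
by exists q => t; rewrite Hc Hq.
Qed.

Lemma hformZ k f t a b : hform k f -> f (t * a) (t * b) = t ^+ k * f a b.
Proof.
move=> [c Hc]; rewrite !Hc mulr_sumr; apply: eq_bigr => r _.
have rk : (r <= k)%N by rewrite -ltnS.
have -> : t ^+ k = t ^+ r * t ^+ (k - r) by rewrite -exprD subnKC.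
rewrite !exprMn; ring.
Qed.

(** Every point off the axis b = 0 is a multiple of a point of the line b = y, and a polynomial in b
    is determined by its values at b != 0. *)
Lemma hform_eq0r k f y : hform k f -> y != 0 -> (forall a, f a y = 0) ->
  forall a b, f a b = 0.
Proof.
move=> Hf y0 H a.
apply: (@ispoly_eq (f a) (fun=> 0)).
- exact: (ispoly_hform Hf (ispoly_cst a) ispoly_id).
- exact: ispoly_cst.
- move=> b b0.
  have -> : f a b = f ((b / y) * (a * y / b)) ((b / y) * y).
    by congr f; field; rewrite ?y0 ?b0.
  by rewrite (hformZ _ _ _ Hf) H mulr0.
Qed.

Lemma hform_swap k f : hform k f -> hform k (fun a b => f b a).
Proof.
move=> [c Hc]; exists (fun r => c (k - r)%N) => a b.
rewrite Hc (reindex_inj rev_ord_inj) /=; apply: eq_bigr => r _.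
have rk : (r <= k)%N by rewrite -ltnS.
by rewrite subSS subKn // mulrAC.
Qed.

Lemma hform_eq0l k f x : hform k f -> x != 0 -> (forall b, f x b = 0) ->
  forall a b, f a b = 0.
Proof.
by move=> /hform_swap Hf x0 H a b; exact: (hform_eq0r Hf x0 H).
Qed.

Lemma hform_eq0s k f s : hform k f -> s != 0 -> (forall t, f t (s - t) = 0) ->
  forall a b, f a b = 0.
Proof.
move=> Hf s0 H a b.
have := @ispoly_eq (fun t => f a (t - a)) (fun=> 0).
move=> /(_ _ _ _ (a + b)); rewrite addrC addKr; apply.
- apply: (ispoly_hform Hf (ispoly_cst a)); apply: ispolyD; first exact: ispoly_id.
  exact: ispoly_cst.
- exact: ispoly_cst.
- move=> t t0.
  have -> : f a (t - a) = f ((t / s) * (a * s / t)) ((t / s) * (s - a * s / t)).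
    by congr f; field; rewrite ?s0 ?t0.
  by rewrite (hformZ _ _ _ Hf) H mulr0.
Qed.

Lemma hform0 f : hform 0 f -> forall a b a' b', f a b = f a' b'.
Proof. by move=> [c Hc] a b a' b'; rewrite !Hc !big_ord1 /= !expr0. Qed.

Lemma hform1 f : hform 1 f -> forall a b, f a b = f 1 0 * a + f 0 1 * b.
Proof.
move=> [c Hc] a b; rewrite !Hc !big_ord_recr !big_ord0 /=.
by ring.
Qed.

Lemma hform_axes k f : hform k.+2 f -> (forall a, f a 0 = 0) ->
  (forall b, f 0 b = 0) -> exists2 g, hform k g & forall a b, f a b = a * b * g a b.
Proof.
move=> [c Hc] Ha Hb.
have c0 : c 0 = 0.
  have := Hb 1; rewrite Hc big_ord_recl /= big1 => [|i _].
    by rewrite expr0 expr1n !mulr1 addr0.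
  by rewrite /bump /= exprS; ring.
have ck : c k.+2 = 0.
  have := Ha 1; rewrite Hc big_ord_recr /= big1 => [|i _].
    by rewrite subnn expr0 expr1n !mulr1 add0r.
  by rewrite -(subnSK (ltn_ord i)) exprS; ring.
exists (fun a b => \sum_(r < k.+1) c r.+1 * a ^+ r * b ^+ (k - r)).
  by exists (fun r => c r.+1).
move=> a b; rewrite Hc big_ord_recl big_ord_recr /= c0 ck !mul0r add0r addr0.
rewrite mulr_sumr; apply: eq_bigr => i _; rewrite /bump /= add1n subSS.
by rewrite subSn -1?ltnS // !exprS; ring.
Qed.

Lemma hform00 k f : hform k.+1 f -> f 0 0 = 0.
Proof.
move=> [c Hc]; rewrite Hc big1 // => r _.
case: (val r) => [|m]; last by rewrite exprS; ring.
by rewrite subn0 exprS; ring.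
Qed.

(* [cov u v t f] : the bilinear differential operator F_u x F_v -> F_t with
   symbol f commutes with vector fields, F_u being the densities of weight u. *)
Definition cov u v t f := forall a b c,
  (b + c + t * a) * f b c = (b + u * a) * f (a + b) c + (c + v * a) * f b (a + c).

Lemma cov_swap u v t f : cov u v t f -> cov v u t (fun a b => f b a).
Proof. by move=> H a b c; apply: (eq_comb (H a c b)); ring. Qed.

Lemma cov_lead k u v t f : hform k.+1 f -> cov u v t f ->
  u * f 1 0 + v * f 0 1 = 0.
Proof.
move=> Hf /(_ 1 0 0); rewrite (hform00 Hf) mulr0 !addr0 !add0r !mulr1.
by move=> <-.
Qed.

(** This is the symbol of the Poisson bracket v f' g - u f g' of densities. For u = v = 0 both f' g
    and f g' are covariant, whence the last hypothesis. *)
Lemma cov1 u v t f : hform 1 f -> cov u v t f -> (u != 0) || (v != 0) ->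
  exists c, forall a b, f a b = c * (v * a - u * b).
Proof.
move=> Hf Hc; have E := cov_lead Hf Hc.
have Ef := hform1 Hf.
have [v0|v0] := eqVneq v 0; rewrite ?orbF => u0.
  exists (- f 0 1 / u) => a b; rewrite Ef.
  have -> : f 1 0 = 0.
    by apply/eqP; move/eqP: E; rewrite v0 mul0r addr0 mulf_eq0 (negPf u0).
  by rewrite v0; field.
exists (f 1 0 / v) => a b; rewrite Ef.
have -> : f 0 1 = - u * f 1 0 / v.
  by apply: (mulfI v0); apply: (eq_comb E); field.
by field.
Qed.

(** An operator on F_0 that kills the constants factors through the covariant map d : F_0 -> F_1;
    [g] is the symbol of the other factor. *)
Lemma cov_div k v t f : hform k.+1 f -> cov 0 v t f -> (forall b, f 0 b = 0) ->
  exists g, [/\ hform k g, forall a b, f a b = a * g a b & cov 1 v t g].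
Proof.
move=> [c Hc] Hcov H0.
have c0 : c 0 = 0.
  have := H0 1; rewrite Hc big_ord_recl /= big1 => [|i _].
    by rewrite expr0 expr1n !mulr1 addr0.
  by rewrite /bump /= exprS; ring.
pose g a b := \sum_(r < k.+1) c r.+1 * a ^+ r * b ^+ (k - r).
have Hg : hform k g by exists (fun r => c r.+1).
have fg a b : f a b = a * g a b.
  rewrite Hc big_ord_recl /= c0 !mul0r add0r /g mulr_sumr.
  by apply: eq_bigr => i _; rewrite /bump /= add1n subSS exprS; ring.
exists g; split => // a b d.
(* The relation is known after multiplication by b, hence for b != 0, hence everywhere by
   polynomiality. *)
move: b; apply: ispoly_eq.
- apply: ispolyM; first by apply: ispolyD;
    [apply: ispolyD; [exact: ispoly_id|exact: ispoly_cst]|exact: ispoly_cst].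
  exact: (ispoly_hform Hg ispoly_id (ispoly_cst d)).
- apply: ispolyD; apply: ispolyM.
  + by apply: ispolyD; [exact: ispoly_id|exact: ispoly_cst].
  + apply: (ispoly_hform Hg _ (ispoly_cst d)).
    by apply: ispolyD; [exact: ispoly_cst|exact: ispoly_id].
  + exact: ispoly_cst.
  + exact: (ispoly_hform Hg ispoly_id (ispoly_cst _)).
- move=> b b0; apply: (mulfI b0).
  by have := Hcov a b d; rewrite !fg => E; apply: (eq_comb E); ring.
Qed.

(** Covariance at (1, b, 0) involves, besides the dehomogenized form f(b, 1), only the values f(b,
    0) and f(b + 1, 0), that is the coefficient [c k]. The relations are read off from the powers
    b^r; the weight t enters only at r = k. *)
Lemma cov_coef k u v t f (c : nat -> F) :
  (forall a b, f a b = \sum_(r < k.+1) c r * a ^+ r * b ^+ (k - r)) ->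
  cov u v t f -> forall r, (r < k)%N ->
  v * c r = - c k * ((if r is s.+1 then 'C(k, s)%:R else 0) + u * 'C(k, r)%:R).
Proof.
move=> Hc Hcov r rk.
have fX b : f b 0 = c k * b ^+ k.
  rewrite Hc big_ord_recr /= subnn expr0 mulr1 big1 ?add0r // => i _.
  by rewrite -(subnSK (ltn_ord i)) exprS mul0r mulr0.
pose p : {poly F} := \poly_(i < k.+1) c i.
have Hp b : p.[b] = f b 1.
  by rewrite Hc horner_poly; apply: eq_bigr => i _; rewrite expr1n mulr1.
have Ep : v *: p = c k *: (('X + t%:P) * 'X^k - ('X + u%:P) * ('X + 1) ^+ k).
  apply/eqP; rewrite -subr_eq0; apply/eqP; apply: poly_fun0 => b _.
  rewrite !(hornerE, horner_exp) Hp.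
  have := Hcov 1 b 0; rewrite !fX !mulr1 !addr0 add0r [1 + b]addrC => E.
  by apply: (eq_comb (esym E)); ring.
have Q j : (('X + 1) ^+ k : {poly F})`_j = 'C(k, j)%:R.
  have -> : ('X + 1) ^+ k = \poly_(i < k.+1) 'C(k, i)%:R :> {poly F}.
    by rewrite exprD1n poly_def; apply: eq_bigr => i _; rewrite scaler_nat.
  by rewrite coef_poly ltnS; case: leqP => // jk; rewrite bin_small.
have := congr1 (fun q : {poly F} => q`_r) Ep.
rewrite /= !(coefZ, coefB, mulrDl, coefD, coefXM, coefCM) coef_poly coefXn !Q.
rewrite ltnS (ltnW rk) => ->; case: r rk => [|s] sk /=.
  by rewrite coefXn (ltn_eqF sk) mulr0n; ring.
by rewrite coefXn (ltn_eqF sk) (ltn_eqF (ltnW sk)) !mulr0n; ring.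
Qed.

(* The coefficients of f are determined by each of the two extreme ones;
   comparing the two expressions of one coefficient gives the relation. *)
Lemma cov_sum k u v t f : hform k f -> cov u v t f -> nz f ->
  (2 <= k)%N -> u != 0 -> v != 0 ->
  (k * k.-1)%:R + 2%:R * k%:R * (u + v) + 2%:R = 0.
Proof.
move=> [c Hc] Hcov [x [y fxy]] k2 u0 v0.
have E1 := cov_coef Hc Hcov.
have E2 : forall r, (r < k)%N -> u * c (k - r)%N =
    - c 0 * ((if r is s.+1 then 'C(k, s)%:R else 0) + v * 'C(k, r)%:R).
  have Hc' a b : f b a = \sum_(r < k.+1) c (k - r)%N * a ^+ r * b ^+ (k - r).
    rewrite Hc (reindex_inj rev_ord_inj) /=; apply: eq_bigr => r _.
    have rk : (r <= k)%N by rewrite -ltnS.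
    by rewrite subSS subKn // mulrAC.
  have H := cov_swap Hcov.
  move=> r rk; have := cov_coef (c := fun r => c (k - r)%N) Hc' H rk.
  by rewrite subnn.
have ck : c k != 0.
  apply/eqP => ck; case/eqP: fxy; rewrite Hc big1 // => r _.
  suff -> : c r = 0 by rewrite !mul0r.
  have := ltn_ord r; rewrite ltnS leq_eqVlt => /orP[/eqP-> //|/E1].
  rewrite ck oppr0 mul0r => /eqP; rewrite mulf_eq0 (negPf v0) /=.
  by move/eqP.
have A0 : v * c 0 = - c k * u.
  by rewrite (E1 0 (ltnW k2)) bin0 /=; ring.
have A1 := E1 _ k2; rewrite bin0 bin1 /= in A1.
have k1 : (k.-1 < k)%N by case: (k) k2.
have := E2 _ k1; have -> : (k - k.-1 = 1)%N by lia.
have -> : (if k.-1 is s.+1 then 'C(k, s)%:R else 0) = 'C(k, 2)%:R :> F.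
  case: k k2 {E1 E2 Hc Hcov ck A0 A1 k1} => [|[|k]] // _.
  by rewrite -bin_sub //= !subSS subn0.
have -> : 'C(k, k.-1) = k by rewrite -bin_sub ?leq_pred // (_ : k - k.-1 = 1)%N ?bin1
  //; lia.
move=> A2.
have B : 'C(k, 2)%:R *+ 2 = (k * k.-1)%:R :> F.
  by rewrite -mulr_natr -natrM muln2 bin2 halfK oddM; case: (k) k2 => //= n _;
    case: odd; rewrite subn0.
apply: (mulfI ck); apply: (mulfI u0).
rewrite -B.
(* [c 1] is the coefficient reached from both ends: from [c k] with r = 1, and from [c 0] with r = k
   - 1 after the swap. *)
pose G := u * (v * c 1%N).
have G1 : G = - u * c k * (1 + u * k%:R) by rewrite /G A1; ring.
have G2 : G = u * c k * ('C(k, 2)%:R + v * k%:R).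
  rewrite /G mulrCA A2.
  transitivity (- (v * c 0) * ('C(k, 2)%:R + v * k%:R)); first by ring.
  by rewrite A0; ring.
have E : u * c k * ('C(k, 2)%:R + v * k%:R) + u * c k * (1 + u * k%:R) = 0.
  by rewrite -G2 G1; ring.
by transitivity (2%:R * (u * c k * ('C(k, 2)%:R + v * k%:R) + u * c k * (1 + u * k%:R)));
   [ring | rewrite E; ring].
Qed.

Lemma bipoly0 (p : {poly {poly F}}) :
  (forall a b, p.[b%:P].[a] = 0) -> p = 0.
Proof.
move=> H; have {}H b : p.[b%:P] = 0 by apply: poly_fun0 => a _.
apply/eqP; apply: contraT => p0.
pose rs := [seq (i%:R : F)%:P | i <- iota 0 (size p)].
have := @max_poly_roots _ p rs p0.
rewrite size_map size_iota ltnn; apply.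
  by apply/allP => x /mapP[i _ ->]; rewrite /root H.
rewrite map_inj_uniq ?iota_uniq // => i j /polyC_inj /eqP.
by rewrite eqr_nat => /eqP.
Qed.

(** The part of covariance that is linear in a, commutation with the scaling field, is Euler's
    identity for homogeneous functions. *)
Lemma cov_euler (p : {poly {poly F}}) u v t :
  cov u v t (fun a b => p.[b%:P].[a]) ->
  forall s r, (t - u - v) * p`_s`_r = (s + r)%:R * p`_s`_r.
Proof.
move=> Hcov.
pose q2 b := map_poly (fun q : {poly F} => q.[b]) p.
have q2E b c : (q2 b).[c] = p.[c%:P].[b].
  rewrite /q2 -[c in LHS](hornerC c b).
  by rewrite (horner_map (horner_eval b)).
have E b c : (t - u - v) * p.[c%:P].[b] = b * (p.[c%:P])^`().[b] + c * (q2 b)^`().[c].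
  pose G := (b%:P + u *: 'X) * (p.[c%:P] \Po ('X + b%:P)) +
    (c%:P + v *: 'X) * (q2 b \Po ('X + c%:P)) - ((b + c)%:P + t *: 'X) * (p.[c%:P].[b])%:P.
  have G0 : G = 0.
    apply: poly_fun0 => a _; rewrite /G !(hornerE, horner_comp) q2E.
    by have /= E := Hcov a b c; apply: (eq_comb (esym E)); ring.
  have := congr1 (fun q : {poly F} => q^`().[0]) G0.
  rewrite /G /= deriv0 horner0 !(derivB, derivD, derivM, derivC, derivZ, derivX,
    deriv_comp) !(hornerD, hornerN, hornerM, hornerZ, hornerX, hornerC,
    horner_comp) q2E !add0r => H.
  by apply: (eq_comb (esym H)); ring.
pose D : {poly {poly F}} := (t - u - v)%:P *: p - \poly_(i < size p) ('X * (p`_i)^`())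
  - 'X * p^`().
have D0 : D = 0.
  apply: bipoly0 => b c; rewrite /D !hornerE E.
  have -> : (\poly_(i < size p) ('X * (p`_i)^`())).[c%:P] = 'X * (p.[c%:P])^`().
    rewrite horner_poly [in RHS]horner_coef linear_sum mulr_sumr.
    by apply: eq_bigr => i _; rewrite /= -polyC_exp derivM derivC mulr0 addr0 mulrA.
  have -> : (q2 b)^`() = map_poly (fun q : {poly F} => q.[b]) p^`().
    by rewrite -(deriv_map (horner_eval b)).
  rewrite -[c in X in c * X](hornerC c b) (horner_map (horner_eval b)) /= /horner_eval.
  by rewrite !hornerE; ring.
move=> s r; have := congr1 (fun q : {poly {poly F}} => q`_s`_r) D0.
rewrite /D !coef0 !coefB !coefZ coefCM coef_poly coefXM.
have -> : (if s == 0%N then 0 else (p^`())`_s.-1)`_r = s%:R * p`_s`_r.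
  case: s => [|s] /=; first by rewrite coef0 mul0r.
  by rewrite coef_deriv coefMn mulr_natl.
have -> : (if (s < size p)%N then 'X * (p`_s)^`() else 0)`_r = r%:R * p`_s`_r.
  case: ltnP => [_|/leq_sizeP/(_ s (leqnn s)) ->]; last by rewrite !coef0 mulr0.
  rewrite coefXM; case: r => [|r] /=; first by rewrite mul0r.
  by rewrite coef_deriv mulr_natl.
by move=> E'; apply: (eq_comb E'); rewrite natrD; ring.
Qed.

(** By Euler's identity every monomial of p has degree t - u - v, which is therefore a natural
    number as soon as p is nonzero. *)
Lemma cov_hform (p : {poly {poly F}}) u v t f :
  (forall a b, f a b = p.[b%:P].[a]) -> cov u v t f -> nz f ->
  exists2 k : nat, hform k f & t = u + v + k%:R.
Proof.
move=> Hp Hcov [x [y fxy]].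
have Hcov' : cov u v t (fun a b => p.[b%:P].[a]) by move=> a b c; rewrite -!Hp.
have E := cov_euler Hcov'.
have [s [r psr]] : exists s r, p`_s`_r != 0.
  apply: contrapT => H; case/eqP: fxy; rewrite Hp.
  suff -> : p = 0 by rewrite !horner0.
  apply/polyP => s; apply/polyP => r; rewrite !coef0; apply/eqP.
  by apply: contraT => psr; case: H; exists s, r.
have tE : t - u - v = (s + r)%:R.
  by apply: (mulIf psr); rewrite E.
exists (s + r)%N; last by rewrite -tE; ring.
have Z s' r' : (s' + r' != s + r)%N -> p`_s'`_r' = 0.
  move=> ne; apply/eqP; apply: contraT => psr'.
  have /(mulIf psr')/eqP := E s' r'.
  by rewrite tE eqr_nat eq_sym (negPf ne).
set k := (s + r)%N in tE Z *.
exists (fun i => p`_(k - i)`_i) => a b.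
rewrite Hp.
have Ep : p = \sum_(i < k.+1) (p`_(k - i)`_i *: 'X^i) *: 'X^(k - i).
  apply/polyP => s'; apply/polyP => r'; rewrite coef_sum coef_sum.
  under eq_bigr => i _ do rewrite coefZ coefXn.
  have [e|ne] := eqVneq (s' + r')%N k.
    have r'k : (r' < k.+1)%N by lia.
    rewrite (bigD1 (Ordinal r'k)) //= big1 => [|i /eqP ik].
      have -> : (k - r' = s')%N by lia.
      by rewrite eqxx mulr1 coefZ coefXn eqxx mulr1 addr0.
    have [e2|] := eqVneq s' (k - i)%N; last by rewrite mulr0 coef0.
    case: ik; apply: val_inj => /=; have := ltn_ord i; lia.
  rewrite Z // big1 // => i _.
  have [e2|] := eqVneq s' (k - i)%N; last by rewrite mulr0 coef0.
  rewrite mulr1 coefZ coefXn; have [e3|] := eqVneq r' i; last by rewrite mulr0.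
  by have := ltn_ord i; lia.
rewrite {1}Ep !horner_sum; apply: eq_bigr => i _.
rewrite hornerZ hornerXn -polyC_exp hornerM hornerC hornerZ hornerXn.
by [].
Qed.

End PolynomialFunctions.
Arguments ispoly_id {F}.
Arguments eq_lin1 {F} k1 {x y z1 s1}.
Arguments eq_lin2 {F} k1 k2 {x y z1 s1 z2 s2}.
Arguments eq_lin3 {F} k1 k2 k3 {x y z1 s1 z2 s2 z3 s3}.
Arguments eq_lin4 {F} k1 k2 k3 k4 {x y z1 s1 z2 s2 z3 s3 z4 s4}.

(** * Classification of graded symbols *)

(* P i j is the symbol of a covariant bilinear operator on densities of weights
   w i and w j; [simple] and [perfect] are what graded simplicity becomes in
   terms of symbols. *)
Section GradedSymbols.
Variable F : numFieldType.
Variables (S : int -> Prop) (w : int -> F) (P : int -> int -> F -> F -> F).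
Local Notation N i j := (nz (P i j)).

Hypothesis S0 : S 0.
Hypothesis w0 : w 0 = -1.
Hypothesis PS : forall i j, N i j -> [/\ S i, S j & S (i + j)].
Hypothesis Pdeg : forall i j, N i j ->
  exists2 k : nat, hform k (P i j) & w (i + j) = w i + w j + k%:R.
Hypothesis P0 : forall j a b, S j -> P 0 j a b = b + w j * a.
Hypothesis Panti : forall i j a b, P i j a b = - P j i b a.
Hypothesis Jac : forall i j l a b c,
  P j l b c * P i (j + l) a (b + c) =
  P i j a b * P (i + j) l (a + b) c + P i l a c * P j (i + l) b (a + c).
Hypothesis simple : forall T : int -> Prop, (exists2 i, S i & T i) ->
  (forall i j, T i -> N i j -> T (i + j)) -> forall i, S i -> T i.
Hypothesis perfect : forall m, S m -> w m = 1 ->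
  exists j l a, j + l = m /\ P j l a (- a) != 0.

(** * Nonvanishing of symbols *)

Lemma natF_inj (m n : nat) : m%:R = n%:R :> F -> m = n.
Proof. by move/eqP; rewrite eqr_nat => /eqP. Qed.

Lemma natF0 (n : nat) : n.+1%:R = 0 :> F -> False.
Proof. by move/eqP; rewrite pnatr_eq0. Qed.

Lemma nz_sym i j : N i j -> N j i.
Proof. by move=> [a [b H]]; exists b, a; rewrite Panti oppr_eq0. Qed.

Lemma symbol_hform i j : exists k, hform k (P i j).
Proof.
have [/Pdeg[k Hk _]|n] := pselect (N i j); first by exists k.
exists 0%N, (fun=> 0) => a b; rewrite (nzPn n) big1 // => r _; ring.
Qed.

Lemma nz_zero j : S j -> N 0 j.
Proof. by move=> Sj; exists 0, 1; rewrite P0 // mulr0 addr0 oner_eq0. Qed.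

Lemma symbol_cov j l : N j l -> cov (w j) (w l) (w (j + l)) (P j l).
Proof.
move=> Njl a b c; have [Sj Sl Sjl] := PS Njl.
have := Jac 0 j l a b c; rewrite !add0r !P0 // => E.
by apply: (eq_comb E); ring.
Qed.

Lemma ispoly_symbol i j h1 h2 : ispoly h1 -> ispoly h2 ->
  ispoly (fun t => P i j (h1 t) (h2 t)).
Proof. by have [k Hk] := symbol_hform i j => H1 H2; exact: (ispoly_hform Hk). Qed.

Arguments ispoly_symbol {i j h1 h2}.

Lemma ispoly_symbol_r i j x : ispoly (P i j x).
Proof. exact: (ispoly_symbol (ispoly_cst x) ispoly_id). Qed.

Lemma ispoly_shift (x : F) : ispoly (fun t => x + t).
Proof. by apply: ispolyD; [exact: ispoly_cst | exact: ispoly_id]. Qed.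

Lemma ispoly_refl (x : F) : ispoly (fun t => x - t).
Proof.
by apply: ispolyD; [exact: ispoly_cst | apply: ispolyN; exact: ispoly_id].
Qed.

Lemma symbol_eq0r i j y : y != 0 -> (forall a, P i j a y = 0) -> ~ N i j.
Proof.
move=> y0 H [a [b /eqP]]; apply; have [k Hk] := symbol_hform i j.
exact: (hform_eq0r Hk y0 H).
Qed.

Lemma symbol_eq0l i j x : x != 0 -> (forall b, P i j x b = 0) -> ~ N i j.
Proof.
move=> x0 H [a [b /eqP]]; apply; have [k Hk] := symbol_hform i j.
exact: (hform_eq0l Hk x0 H).
Qed.

Lemma symbol_eq0s i j s : s != 0 -> (forall t, P i j t (s - t) = 0) -> ~ N i j.
Proof.
move=> s0 H [a [b /eqP]]; apply; have [k Hk] := symbol_hform i j.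
exact: (hform_eq0s Hk s0 H).
Qed.

(** For a suitable fixed a and c, both factors are nonzero polynomials in the remaining variable,
    and their product cannot vanish identically. *)
Lemma nz_mul i j l m : (forall a b c, P i j a b * P l m (a + b) c = 0) ->
  N i j -> N l m -> False.
Proof.
move=> H [a [b nab]] [x [c /eqP]]; apply.
have [|||E|E] := @ispoly_dom _ (fun t => P i j a t) (fun t => P l m (a + t) c).
- exact: ispoly_symbol_r.
- exact: ispoly_symbol (ispoly_shift _) (ispoly_cst _).
- by move=> t; exact: H.
- by rewrite E eqxx in nab.
- by have := E (x - a); rewrite [a + _]addrC subrK.
Qed.

Lemma nz_excl p q r s : ~ (N p q /\ N r s) ->
  forall x y x' y', P p q x y * P r s x' y' = 0.
Proof.
move=> H x y x' y'; have [n|n] := pselect (N p q); last by rewrite (nzPn n) mul0r.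
by have [n'|n'] := pselect (N r s); [case: H | rewrite (nzPn n') mulr0].
Qed.

Lemma nz_split i j l : N i j -> N (i + j) l ->
  (N j l /\ N i (j + l)) \/ (N i l /\ N j (i + l)).
Proof.
move=> n1 n2; apply: contrapT => /not_orP[H1 H2].
apply: (@nz_mul i j (i + j) l _ n1 n2) => a b c.
by have := Jac i j l a b c; rewrite (nz_excl H1) (nz_excl H2) addr0.
Qed.

(* If one of the three products in the Jacobi identity vanished, the other two
   would have the same linear factors; the hypothesis on the root of P i j
   (resp. of P (i + j) l) excludes this. *)
Lemma nz_key i j l a0 b0 : N i j -> N (i + j) l ->
  P i j a0 b0 = 0 -> a0 != 0 -> b0 != 0 ->
  [/\ N j l, N i (j + l), N i l & N j (i + l)].
Proof.
move=> n1 n2 r0 a00 b00; have Hs := nz_split n1 n2.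
have [[? ?]|T1] := pselect (N j l /\ N i (j + l)); last first.
  case: Hs => [//|[n3 n4]].
  have [|||H|H] := @ispoly_dom _ (P i l a0) (fun t => P j (i + l) b0 (a0 + t)).
  - exact: ispoly_symbol_r.
  - exact: ispoly_symbol (ispoly_cst _) (ispoly_shift _).
  - move=> c; have := Jac i j l a0 b0 c.
    by rewrite (nz_excl T1) r0 mul0r add0r.
  - by case: (symbol_eq0l a00 H).
  - case: (@symbol_eq0l j (i + l) b0 b00 _ n4) => y.
    by have := H (y - a0); rewrite [a0 + _]addrC subrK.
have [[? ?]|T3] := pselect (N i l /\ N j (i + l)); first by split.
have [|||H|H] := @ispoly_dom _ (P j l b0) (fun t => P i (j + l) a0 (b0 + t)).
- exact: ispoly_symbol_r.
- exact: ispoly_symbol (ispoly_cst _) (ispoly_shift _).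
- move=> c; have := Jac i j l a0 b0 c.
  by rewrite (nz_excl T3) r0 mul0r add0r.
- by case: (symbol_eq0l b00 H).
- case: (@symbol_eq0l i (j + l) a0 a00) => // y.
  by have := H (y - b0); rewrite [b0 + _]addrC subrK.
Qed.

Lemma nz_key2 i j l x0 y0 : N i j -> N (i + j) l ->
  P (i + j) l x0 y0 = 0 -> x0 != 0 -> y0 != 0 -> x0 + y0 != 0 ->
  [/\ N j l, N i (j + l), N i l & N j (i + l)].
Proof.
move=> n1 n2 r0 x00 y00 s0; have Hs := nz_split n1 n2.
have [[? ?]|T1] := pselect (N j l /\ N i (j + l)); last first.
  case: Hs => [//|[n3 n4]].
  have [|||H|H] := @ispoly_dom _ (fun t => P i l t y0) (fun t => P j (i + l) (x0 - t)
    (t + y0)).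
  - exact: ispoly_symbol ispoly_id (ispoly_cst _).
  - apply: ispoly_symbol; first exact: ispoly_refl.
    exact: ispolyD ispoly_id (ispoly_cst _).
  - move=> t; have := Jac i j l t (x0 - t) y0.
    by rewrite (nz_excl T1) [t + (x0 - t)]addrC subrK r0 mulr0 add0r.
  - by case: (symbol_eq0r y00 H).
  - case: (@symbol_eq0s j (i + l) (x0 + y0) s0) => // t.
    by have := H (x0 - t); rewrite subKr => E; rewrite -[RHS]E; congr P; ring.
have [[? ?]|T3] := pselect (N i l /\ N j (i + l)); first by split.
have [|||H|H] := @ispoly_dom _ (fun t => P j l t y0) (fun t => P i (j + l) (x0 - t) (t
  + y0)).
- exact: ispoly_symbol ispoly_id (ispoly_cst _).
- apply: ispoly_symbol; first exact: ispoly_refl.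
  exact: ispolyD ispoly_id (ispoly_cst _).
- move=> t; have := Jac i j l (x0 - t) t y0.
  by rewrite (nz_excl T3) subrK r0 mulr0 addr0.
- by case: (symbol_eq0r y00 H).
- case: (@symbol_eq0s i (j + l) (x0 + y0) s0) => // t.
  by have := H (x0 - t); rewrite subKr => E; rewrite -[RHS]E; congr P; ring.
Qed.

(* The degree K of P i (- i) satisfies w i + w (- i) = -1 - K, and K <= 2. *)
Definition paired i := N i (- i).

Lemma pairedN i : paired i -> paired (- i).
Proof. by move=> /nz_sym; rewrite /paired opprK. Qed.

Lemma paired_S i : paired i -> S i /\ S (- i).
Proof. by case/PS. Qed.

(** Since i + (- i) = 0 and [P 0 j] is nonzero for all j in S, [nz_key] applies to every such j. *)
Lemma paired_root i j a0 b0 : paired i -> P i (- i) a0 b0 = 0 -> a0 != 0 -> b0 != 0 ->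
  S j -> [/\ N i j, N (- i) j, N i (j - i) & N (- i) (i + j)].
Proof.
move=> Xi r0 a00 b00 Sj.
have := @nz_key i (- i) j a0 b0 Xi; rewrite subrr => /(_ (nz_zero Sj) r0 a00 b00).
by rewrite [- i + j]addrC => -[*]; split.
Qed.

(** The root (1, - w_j) of [P 0 j] meets the conditions of [nz_key2] when the weight is neither 0
    nor 1. *)
Lemma paired_nz i j : paired i -> S j -> w j != 0 -> w j != 1 ->
  [/\ N i j, N (- i) j, N i (j - i) & N (- i) (i + j)].
Proof.
move=> Xi Sj wj0 wj1.
have := @nz_key2 i (- i) j 1 (- w j) Xi; rewrite subrr.
rewrite P0 // mulr1 addNr oner_eq0 oppr_eq0 subr_eq0 [1 == _]eq_sym.
move=> /(_ (nz_zero Sj) erefl erefl wj0 wj1).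
by rewrite [- i + j]addrC => -[*]; split.
Qed.

Lemma paired_deg i : paired i -> exists2 K : nat, hform K (P i (- i)) &
  w i + w (- i) + K%:R = -1.
Proof. by move=> Xi; have [K HK] := Pdeg Xi; rewrite subrr w0 => ->; exists K. Qed.

(** The passage from j to i + j and back raises the weight by w_i + w_(-i) + k + k', which must be
    0. *)
Lemma paired_deg_eq i j k k' K : paired i -> w i + w (- i) + K%:R = -1 ->
  w (i + j) = w i + w j + k%:R -> w j = w (- i) + w (i + j) + k'%:R ->
  (k + k' = K.+1)%N.
Proof.
move=> Xi HK E1 E2; apply: natF_inj; move: E2; rewrite E1 => E2.
by apply: (eq_lin2 (-1) (-1) HK E2); rewrite natrD; ring.
Qed.

Lemma deg1 i j : N i j -> hform 1 (P i j) -> (w i != 0) || (w j != 0) ->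
  exists2 c, c != 0 & forall a b, P i j a b = c * (w j * a - w i * b).
Proof.
move=> Nij Hf wij; have [c Hc] := cov1 Hf (symbol_cov Nij) wij.
exists c => //; apply/eqP => c0; case: Nij => a [b].
by rewrite Hc c0 mul0r eqxx.
Qed.

Lemma deg0 i j : N i j -> hform 0 (P i j) ->
  exists2 c, c != 0 & forall a b, P i j a b = c.
Proof.
move=> [a [b nab]] Hf; exists (P i j a b) => // a' b'.
exact: hform0 Hf _ _ _ _.
Qed.

Lemma deg2 i j k : N i j -> hform k (P i j) -> (2 <= k)%N ->
  w i != 0 -> w j != 0 ->
  (k * k.-1)%:R + 2%:R * k%:R * (w i + w j) + 2%:R = 0.
Proof. by move=> Nij Hf k2 wi wj; apply: (cov_sum Hf (symbol_cov Nij) Nij). Qed.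

Lemma deg_div i j k : N i j -> hform k.+1 (P i j) -> w i = 0 -> w j != 0 ->
  exists g, [/\ hform k g, forall a b, P i j a b = a * g a b, nz g &
    cov 1 (w j) (w (i + j)) g].
Proof.
move=> Nij Hf wi wj.
have Hc : cov 0 (w j) (w (i + j)) (P i j) by have := symbol_cov Nij; rewrite wi.
have H0 b : P i j 0 b = 0.
  have := cov_lead Hf (symbol_cov Nij); rewrite wi mul0r add0r => /eqP.
  rewrite mulf_eq0 (negPf wj) => /= /eqP e.
  by have := hformZ b 0 1 Hf; rewrite mulr0 mulr1 e mulr0.
have [g [g1 g2 g3]] := cov_div Hf Hc H0.
exists g; split=> //; case: Nij => a [b nab]; exists a, b.
by apply: contraNN nab => /eqP g0; rewrite g2 g0 mulr0.
Qed.

(** [cov_sum] needs nonzero weights. As [w i] is 0, it is applied to the quotient of the symbol by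
    a, where the first weight has become 1. *)
Lemma paired_deg_le2_aux i K : paired i -> hform K (P i (- i)) ->
  w i + w (- i) + K%:R = -1 -> w i = 0 -> (K <= 2)%N.
Proof.
case: K => [|[|[|K]]] // Xi HK E wi.
have wj : w (- i) != 0.
  apply/eqP => wj; apply: (@natF0 K.+3).
  by apply: (eq_comb E); rewrite wi wj; ring.
have [g [g1 _ g3 g4]] := deg_div Xi HK wi wj.
have := cov_sum g1 g4 g3 isT (oner_neq0 _) wj.
have -> : w (- i) = -1 - K.+3%:R by apply: (eq_comb E); rewrite wi; ring.
move=> E'; exfalso; apply: (@natF0 (K.+2 * K.+2 + 3 * K.+2 - 3)%N).
rewrite (_ : _.+1 = K * K + 7 * K + 8)%N; last by lia.
by apply: (eq_comb (congr1 -%R E')); rewrite !natrM /=; ring.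
Qed.

Lemma paired_deg_le2 i K : paired i -> hform K (P i (- i)) ->
  w i + w (- i) + K%:R = -1 ->
  [\/ K = 0%N, K = 1%N | K = 2 /\ (w i = 0 \/ w (- i) = 0)].
Proof.
move=> Xi HK E.
have [wi|wi] := eqVneq (w i) 0.
  have := paired_deg_le2_aux Xi HK E wi.
  by case: K {HK E} => [|[|[|K]]] // _; [apply: Or31|apply: Or32|apply: Or33; split; auto].
have [wj|wj] := eqVneq (w (- i)) 0.
  have HK' : hform K (P (- i) (- - i)).
    have [c Hc] := hform_swap HK; exists (fun r => - c r) => a b.
    rewrite opprK Panti Hc -sumrN; apply: eq_bigr => r _; ring.
  have := paired_deg_le2_aux (pairedN Xi) HK';
    rewrite opprK [w (- i) + _]addrC => /(_ E wj).
  by case: K {HK E HK'} => [|[|[|K]]] // _; [apply: Or31|apply: Or32|apply: Or33;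
    split; auto].
case: K HK E => [|[|K]] HK E; [exact: Or31|exact: Or32|].
have := deg2 Xi HK isT wi wj.
have -> : w i + w (- i) = -1 - K.+2%:R by apply: (eq_comb E); ring.
move=> E'; exfalso; apply: (@natF0 (K * K + 7 * K + 7)%N).
by apply: (eq_comb (congr1 -%R E')); rewrite !natrM /=; ring.
Qed.

Lemma symbol_r0 i a b : S i -> P i 0 a b = - (a + w i * b).
Proof. by move=> Si; rewrite Panti P0. Qed.

Lemma nz_prod i j l m a b x y : P i j a b * P l m x y != 0 -> N i j /\ N l m.
Proof.
rewrite mulf_eq0 negb_or => /andP[H1 H2].
by split; [exists a, b | exists x, y].
Qed.

Lemma diag_deg_neq0 i k : N i i -> hform k (P i i) -> k != 0%N.
Proof.
move=> [a [b nab]] Hf; apply/eqP => k0; rewrite k0 in Hf.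
case/eqP: nab; have E := Panti i i a b.
rewrite (hform0 Hf b a a b) in E.
have : P i i a b *+ 2 = 0 by rewrite mulr2n {1}E addNr.
by move/eqP; rewrite mulrn_eq0 => /eqP.
Qed.

(** The Jacobi identity for i, i, - i gives the product of [P i i] and [P (i + i) (- i)], of total
    degree one; antisymmetry forbids a constant [P i i], so the other factor is constant. *)
Lemma paired_diag i : paired i -> w i + w (- i) = -1 -> w i != 1 ->
  exists2 c, c != 0 & exists r, [/\ r != 0, w (i + i) = w i + w i + 1,
   forall a b, P (i + i) (- i) a b = r, forall a b, P i (- i) a b = c &
   forall a b, P i i a b * r = c * (1 - w i) * (b - a)].
Proof.
move=> Xi E w1; have [Si S'i] := paired_S Xi.
have [K HK EK] := paired_deg Xi.
have K0 : K = 0%N by apply: natF_inj; apply: (eq_lin2 1 (-1) EK E); ring.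
rewrite {}K0 in HK EK; have [c c0 Hc] := deg0 Xi HK.
exists c => //.
have J a b x : P i i a b * P (i + i) (- i) (a + b) x = c * (1 - w i) * (b - a).
  have := Jac i i (- i) a b x; rewrite subrr !Hc !symbol_r0 // => H.
  by apply: (eq_lin1 (-1) H); ring.
have w1' : 1 - w i != 0 by rewrite subr_eq0 eq_sym.
have [Nii N2i] : N i i /\ N (i + i) (- i).
  apply: (@nz_prod _ _ _ _ 0 1 (0 + 1) 0); rewrite J subr0 mulr1.
  by rewrite mulf_neq0.
have [k1 Hk1 E1] := Pdeg Nii; have [k2 Hk2 E2] := Pdeg N2i.
have k12 : (k1 + k2 = 1)%N.
  apply: natF_inj; rewrite addrK E1 in E2; rewrite natrD.
  by apply: (eq_lin2 (-1) (-1) E2 E); ring.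
have k1n := diag_deg_neq0 Nii Hk1.
have [e1 e2] : k1 = 1%N /\ k2 = 0%N by lia.
rewrite {}e1 {}e2 in Hk1 Hk2 E1 {k12 k1n E2}.
have [r r0 Hr] := deg0 N2i Hk2.
exists r; split=> // a b.
by rewrite -(Hr (a + b) 0) J.
Qed.

(** The Jacobi identity for i, 2i, - i exhibits a linear form in a, b, x as a constant times a form
    in (a + b, x), or times a form in (a, b). In the first case the coefficients of a and b agree
    and the weight is 1/2; in the second that of x is 0 and the weight is -2. *)
Lemma paired_deg0_aux i : paired i -> w i + w (- i) = -1 ->
  [\/ w i = 1, w i = - 2%:R | w i * 2%:R = 1].
Proof.
move=> Xi E; have [|w1] := eqVneq (w i) 1; first by move=> ?; apply: Or31.
have [Si S'i] := paired_S Xi.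
have [c c0 [r [r0 w2 H2 H1 Hii]]] := paired_diag Xi E w1.
have S2 : S (i + i).
  suff: N (i + i) (- i) by case/PS.
  by exists 0, 0; rewrite H2.
have J a b x : P i (i + i) a b * P (i + (i + i)) (- i) (a + b) x =
    c * (3%:R * w i * a + (2%:R - w i) * b + (2%:R + w i) * x).
  have := Jac i (i + i) (- i) a b x.
  rewrite addrK subrr !H1 H2 symbol_r0 // w2 => H.
  by apply: (eq_lin2 (-1) 1 H (Hii a (b + x))); ring.
have [N3 N3'] : N i (i + i) /\ N (i + (i + i)) (- i).
  have [wi|wi] := eqVneq (w i) 0.
    apply: (@nz_prod _ _ _ _ 0 1 (0 + 1) 0); rewrite J wi.
    rewrite mulf_neq0 // !mulr0 add0r addr0 subr0 mulr1.
    by rewrite pnatr_eq0.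
  apply: (@nz_prod _ _ _ _ 1 0 (1 + 0) 0); rewrite J !mulr0 !addr0 mulr1.
  by rewrite !mulf_neq0 // pnatr_eq0.
have [k1 Hk1 E1] := Pdeg N3; have [k2 Hk2 E2] := Pdeg N3'.
have k12 : (k1 + k2 = 1)%N.
  have e : i + (i + i) - i = i + i by ring.
  apply: natF_inj; rewrite e E1 in E2; rewrite natrD.
  by apply: (eq_lin2 (-1) (-1) E2 E); ring.
have [[e1 e2]|[e1 e2]] : (k1 = 0 /\ k2 = 1)%N \/ (k1 = 1 /\ k2 = 0)%N by lia.
- rewrite e1 in Hk1; apply: Or33.
  have := J 0 0 0; have := J 1 (-1) 0.
  rewrite addr0 subrr (hform0 Hk1 0 0 1 (-1)) => -> /(mulfI c0) H.
  apply: (mulfI (_ : 2%:R != 0 :> F)); first by rewrite pnatr_eq0.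
  by apply: (eq_lin1 1 H); ring.
- rewrite e2 in Hk2; apply: Or32.
  have := J 0 1 0; have := J 0 1 1.
  rewrite (hform0 Hk2 _ 1 (0 + 1) 0) => -> /(mulfI c0) H.
  by apply: (eq_lin1 1 H); ring.
Qed.

(** The auxiliary lemma applies to i and to - i, and two of its three values sum to -1 only if they
    are 1 and -2. *)
Lemma paired_deg0 i : paired i -> w i + w (- i) = -1 ->
  (w i = 1 /\ w (- i) = - 2%:R) \/ (w i = - 2%:R /\ w (- i) = 1).
Proof.
move=> Xi E; have E' : w (- i) + w (- - i) = -1 by rewrite opprK addrC.
have [H|H|H] := paired_deg0_aux Xi E; [left|right|].
- by split=> //; apply: (eq_lin2 1 (-1) E H); ring.
- by split=> //; apply: (eq_lin2 1 (-1) E H); ring.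
exfalso; have [H'|H'|H'] := paired_deg0_aux (pairedN Xi) E'.
- apply: (@natF0 4); apply: (eq_lin3 2%:R (-1) (- 2%:R) E H H'); ring.
- apply: (@natF0 0); apply: (eq_lin3 (- 2%:R) 1 2%:R E H H'); ring.
- apply: (@natF0 3); apply: (eq_lin3 2%:R (-1) (-1) E H H'); ring.
Qed.

(** The operator is d : F_0 -> F_1 followed by the Poisson bracket of weights 1 and -3. *)
Lemma paired_deg2_symbol i : paired i -> w i + w (- i) = - 3%:R -> w i = 0 ->
  exists2 c, c != 0 & forall a b, P i (- i) a b = c * a * (3%:R * a + b).
Proof.
move=> Xi E wi; have [K HK EK] := paired_deg Xi.
have K2 : K = 2 by apply: natF_inj; apply: (eq_lin2 1 (-1) EK E); ring.
rewrite {}K2 in HK EK.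
have w' : w (- i) = - 3%:R by apply: (eq_lin2 1 (-1) E wi); ring.
have [|g [g1 g2 [x [y gxy]] g4]] := deg_div Xi HK wi.
  by rewrite w' oppr_eq0 pnatr_eq0.
have [c Hc] : exists c, forall a b, g a b = c * (w (- i) * a - 1 * b).
  by apply: (cov1 g1 g4); rewrite oner_eq0.
exists (- c) => [|a b]; last by rewrite g2 Hc w'; ring.
by rewrite oppr_eq0; apply/eqP => c0; rewrite Hc c0 mul0r eqxx in gxy.
Qed.

(* Here P i (- i) has degree one and is proportional to w (- i) a - w i b, so
   all multiples of i are paired: i spans a line of the grading. *)
Definition regular i := [/\ paired i, w i + w (- i) = - 2%:R, w i != 0 & w i != - 2%:R].

Lemma regularN i : regular i -> regular (- i).
Proof.
case=> Xi E w1 w2; split; rewrite ?opprK; [exact: pairedN | by rewrite addrC | |].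
  by apply: contraNneq w2 => e; apply/eqP; apply: (eq_lin2 1 (-1) E e); ring.
by apply: contraNneq w1 => e; apply/eqP; apply: (eq_lin2 1 (-1) E e); ring.
Qed.

Lemma regular_symbol i : regular i -> exists2 c, c != 0 &
  forall a b, P i (- i) a b = c * (w (- i) * a - w i * b).
Proof.
case=> Xi E w1 w2; have [K HK EK] := paired_deg Xi.
have K1 : K = 1%N by apply: natF_inj; apply: (eq_lin2 1 (-1) EK E); ring.
by rewrite {}K1 in HK; apply: (deg1 Xi HK); rewrite w1.
Qed.

Lemma regular_nz i j : regular i -> S j ->
  [/\ N i j, N (- i) j, N i (j - i) & N (- i) (i + j)].
Proof.
move=> Yi Sj; have [Xi _ w1 _] := Yi; have [_ _ w2 _] := regularN Yi.
have [c c0 Hc] := regular_symbol Yi.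
by apply: (paired_root Xi _ w1 w2 Sj); rewrite Hc; ring.
Qed.

Lemma paired_deg2_nz i j : paired i -> w i + w (- i) = - 3%:R -> w i = 0 -> S j ->
  [/\ N i j, N (- i) j, N i (j - i) & N (- i) (i + j)].
Proof.
move=> Xi E wi Sj; have [c c0 Hc] := paired_deg2_symbol Xi E wi.
apply: (@paired_root i j 1 (- 3%:R) Xi) => //; rewrite ?oner_eq0 ?oppr_eq0 ?pnatr_eq0 //.
by rewrite Hc; ring.
Qed.

(** Such an i turns out to be the exceptional index of a line, and 2i is a regular index from which
    the line is recovered. The Jacobi identities for i, i, - i and for - i, - i, i fix the degrees:
    3 for [P i i], 0 for [P (i + i) (- i)], 1 for [P (- i) (- i)]. *)
Lemma paired_deg2 i : paired i -> w i + w (- i) = - 3%:R -> w i = 0 ->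
  regular (i + i) /\ w (i + i) = 3%:R.
Proof.
move=> Xi E wi; have [Si S'i] := paired_S Xi.
have w' : w (- i) = - 3%:R by apply: (eq_lin2 1 (-1) E wi); ring.
have [c c0 Hc] := paired_deg2_symbol Xi E wi.
have Hc' a b : P (- i) i a b = - c * b * (3%:R * b + a) by rewrite Panti Hc; ring.
have J1 a b x : P i i a b * P (i + i) (- i) (a + b) x = 3%:R * c * a * b * (a - b).
  have := Jac i i (- i) a b x; rewrite subrr !Hc !symbol_r0 // wi => H.
  by apply: (eq_lin1 (-1) H); ring.
have J2 a b x : P (- i) (- i) a b * P (- i - i) i (a + b) x =
    3%:R * c * x * (a - b) * (a + b + 5%:R * x).
  have := Jac (- i) (- i) i a b x; rewrite addNr !Hc' !symbol_r0 // w' => H.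
  by apply: (eq_lin1 (-1) H); ring.
have n3 : 3%:R != 0 :> F by rewrite pnatr_eq0.
have n6 : 6%:R != 0 :> F by rewrite pnatr_eq0.
have [Nii N2i] : N i i /\ N (i + i) (- i).
  apply: (@nz_prod _ _ _ _ 1 (-1) (1 - 1) 0); rewrite J1.
  by rewrite (_ : _ * _ = - (6%:R * c)); [rewrite oppr_eq0 mulf_neq0 | ring].
have [N'ii N'2i] : N (- i) (- i) /\ N (- i - i) i.
  apply: (@nz_prod _ _ _ _ 1 0 (1 + 0) 1); rewrite J2.
  rewrite (_ : _ * _ = 3%:R * c * 6%:R); last by ring.
  by rewrite !mulf_neq0.
have [k1 Hk1 E1] := Pdeg Nii; have [k2 Hk2 E2] := Pdeg N2i.
have [k1' Hk1' E1'] := Pdeg N'ii; have [k2' Hk2' E2'] := Pdeg N'2i.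
have k12 : (k1 + k2 = 3)%N.
  apply: natF_inj; rewrite addrK E1 in E2; rewrite natrD.
  by apply: (eq_lin2 (-1) (-1) E2 E); ring.
have k2n : k2 = 0%N.
  case: k2 Hk2 E2 k12 => // k2 Hk2 _ _.
  have := J1 1 (-1) 0; rewrite subrr (hform00 Hk2) mulr0 => /eqP.
  rewrite (_ : _ * _ = - (6%:R * c)); last by ring.
  by rewrite eq_sym oppr_eq0 (negPf (mulf_neq0 n6 c0)).
have k1n : k1 = 3%N by lia.
rewrite {}k2n {}k1n in Hk2 Hk1 E1 {k12 E2}.
have k12' : (k1' + k2' = 3)%N.
  rewrite addrNK E1' in E2'; apply: natF_inj; rewrite natrD.
  by apply: (eq_lin3 (-1) (-1) 0 E2' E wi); ring.
have k2'n : k2' != 0%N.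
  apply/eqP => e; rewrite {}e in Hk2' k12' E2'.
  have := J2 1 0 1; have := J2 1 0 0; rewrite (hform0 Hk2' _ 0 (1 + 0) 1) => ->.
  rewrite mulr0 !mul0r => /eqP; rewrite (_ : _ * _ = 3%:R * c * 6%:R); last by ring.
  by rewrite eq_sym (negPf (mulf_neq0 (mulf_neq0 n3 c0) n6)).
have [q q0 Hq] := deg0 N2i Hk2.
have Hii a b : P i i a b * q = 3%:R * c * a * b * (a - b).
  by rewrite -(J1 a b 0) Hq.
have w2 : w (i + i) = 3%:R by rewrite E1 wi; ring.
have k1'n := diag_deg_neq0 N'ii Hk1'.
have w'0 : w (- i) != 0 by rewrite w' oppr_eq0.
have k1'1 : k1' = 1%N.
  have k1'2 : k1' != 2.
    apply/eqP => e; rewrite {}e in Hk1'.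
    have H := deg2 N'ii Hk1' isT w'0 w'0.
    by apply: (@natF0 19); apply: (eq_lin2 (-1) 8%:R H w'); rewrite /=; ring.
  by lia.
rewrite {}k1'1 in Hk1' E1'.
have [c1 c10 Hc1] := deg1 N'ii Hk1' (introT orP (or_introl w'0)).
have Q u x : P (- i - i) i u x * c1 = - c * x * (u + 5%:R * x).
  have := J2 ((u + 1) / 2%:R) ((u - 1) / 2%:R) x.
  have -> : (u + 1) / 2%:R + (u - 1) / 2%:R = u by field.
  have e1 : (u + 1) / 2%:R - (u - 1) / 2%:R = 1 by field.
  rewrite Hc1 e1 -mulrBr e1 w' => H.
  by apply: (mulfI n3); apply: (eq_lin1 (-1) H); ring.
split=> //; split; last 1 first.
- by rewrite w2 -subr_eq0 opprK -natrD pnatr_eq0.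
- have e : i + - (i + i) = - i by rewrite opprD addNKr.
  apply: contrapT => NX.
  (* If 2i were not paired, this instance would relate the values of [P (- i - i) i] at (0, 2) and
     (0, 1), which [Q] gives, and yield 30 c^2 = 0. *)
  have := Jac i i (- (i + i)) 1 2%:R 0; rewrite !addr0 !e !Hc.
  rewrite (nzPn NX) mulr0 add0r ![P i (- (i + i)) _ _]Panti opprD => H.
  have E0 : c * c * 30%:R = 0.
    by apply: (eq_lin3 c1 (5%:R * c) (- (14%:R * c)) H (Q 0 2%:R) (Q 0 1)); ring.
  apply: (@natF0 29); apply/eqP; move/eqP: E0.
  by rewrite mulf_eq0 (negPf (mulf_neq0 c0 c0)).
- rewrite w2 opprD E1' w'; ring.
- by rewrite w2.
Qed.

Lemma paired_types i : paired i ->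
  [\/ w i + w (- i) = - 2%:R,
      (w i = 1 /\ w (- i) = - 2%:R) \/ (w i = - 2%:R /\ w (- i) = 1) |
      (w i = 0 /\ w (- i) = - 3%:R) \/ (w i = - 3%:R /\ w (- i) = 0)].
Proof.
move=> Xi; have [K HK E] := paired_deg Xi.
have [K0|K1|[K2 H]] := paired_deg_le2 Xi HK E.
- by apply: Or32; apply: paired_deg0 => //; rewrite -E K0 addr0.
- by apply: Or31; rewrite K1 in E; apply: (eq_lin1 1 E); ring.
- rewrite {}K2 in E; apply: Or33; case: H => wi; [left|right]; split=> //.
    by apply: (eq_lin2 1 (-1) E wi); ring.
  by apply: (eq_lin2 1 (-1) E wi); ring.
Qed.

(** * Multiples and translates of a regular index *)

Lemma neg2_neq0 : - 2%:R != 0 :> F.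
Proof. by rewrite oppr_eq0 pnatr_eq0. Qed.

(** By [paired_deg_eq] the degrees of i on j and of - i on i + j sum to 2. In degree 2 with nonzero
    source weights, the relation of [cov_sum] says that the target has weight 1; this is used in
    both directions. *)
Lemma regular_step i j : regular i -> S j ->
  exists k : nat, [/\ w (i + j) = w i + w j + k%:R, hform k (P i j) &
    [\/ k = 1%N, k = 2 /\ (w j = 0 \/ w (i + j) = 1) |
        k = 0%N /\ (w j = 1 \/ w (i + j) = 0)]].
Proof.
move=> Yi Sj; have [Xi Ei wi _] := Yi; have [_ _ wi' _] := regularN Yi.
have [N1 _ _ N2] := regular_nz Yi Sj.
have [k Hk E1] := Pdeg N1; have [k' Hk' E2] := Pdeg N2; rewrite addKr in E2.
have kk : (k + k' = 2)%N.
  by apply: (paired_deg_eq (K := 1%N) Xi _ E1 E2); rewrite Ei; ring.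
exists k; split=> //.
have [e|[[e1 e2]|[e1 e2]]] : (k = 1 \/ (k = 2 /\ k' = 0) \/ (k = 0 /\ k' = 2))%N by lia.
- exact: Or31.
- apply: Or32; split=> //; have [|wj] := eqVneq (w j) 0; [by left|right].
  rewrite e1 in Hk E1; have H := deg2 N1 Hk isT wi wj.
  apply: (mulfI (_ : 4%:R != 0 :> F)); first by rewrite pnatr_eq0.
  by apply: (eq_lin2 4%:R 1 E1 H); rewrite /=; ring.
- apply: Or33; split=> //; have [|wj] := eqVneq (w (i + j)) 0; [by right|left].
  rewrite e2 in Hk' E2; have H := deg2 N2 Hk' isT wi' wj.
  apply: (mulfI (_ : 4%:R != 0 :> F)); first by rewrite pnatr_eq0.
  by apply: (eq_lin2 4%:R 1 E2 H); rewrite /=; ring.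
Qed.

(** Otherwise the Jacobi identity for i, j, - i - j, restricted to the root (w_i, w_(-i)) of
    [P i (- i)], would reduce to one product of nonzero symbols being 0. *)
Lemma regular_add_paired i j : regular i -> paired j -> paired (i + j).
Proof.
move=> Yi Xj; have [Xi Ei wi _] := Yi; have [_ _ wi' _] := regularN Yi.
have [_ S'j] := paired_S Xj.
have [_ H _ _] := regular_nz Yi S'j; have [_ _ Sl] := PS H.
have [Nil _ _ _] := regular_nz Yi Sl.
have [c c0 Hc] := regular_symbol Yi.
apply: contrapT => NX; rewrite /paired opprD in NX.
have [|||E|E] := @ispoly_dom _ (P i (- i - j) (w i))
    (fun t => P j (- j) (w (- i) - t) (w i + t)).
- exact: ispoly_symbol_r.
- exact: (ispoly_symbol (ispoly_refl _) (ispoly_shift _)).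
- move=> t; have := Jac i j (- i - j) (w i) (w (- i) - t) t.
  rewrite addNKr subrK (nzPn NX) => Z.
  rewrite (_ : j + (- i - j) = - i) in Z; last by ring.
  by rewrite Hc in Z; apply: (eq_lin1 (-1) Z); ring.
- by case: (symbol_eq0l wi E).
- have s0 : w i + w (- i) != 0 by rewrite Ei neg2_neq0.
  case: (@symbol_eq0s j (- j) _ s0) => // t.
  by rewrite -[RHS](E (w (- i) - t)); congr P; ring.
Qed.

Lemma paired0 : paired 0.
Proof. by rewrite /paired oppr0; exact: nz_zero. Qed.

Lemma regular_natmul i (n : nat) : regular i -> paired (n%:Z * i).
Proof.
move=> Yi; elim: n => [|n IH]; first by rewrite mul0r; exact: paired0.
by rewrite intS mulrDl mul1r; exact: regular_add_paired.
Qed.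

Lemma regular_intmul i (n : int) : regular i -> paired (n * i).
Proof.
case: n => n Yi; first exact: regular_natmul.
by rewrite NegzE mulNr; apply: pairedN; exact: regular_natmul.
Qed.

(** [regular_step] adds [w i + 1] to the weight at each step unless the weight 0 or 1 is met, that
    is, unless some n (w_i + 1) is 1 or 2. *)
Lemma mul_line_pos i : regular i ->
  (forall n : nat, n.+1%:R * (w i + 1) != 1 /\ n.+1%:R * (w i + 1) != 2%:R) ->
  forall n : nat, w (n%:Z * i) = n%:R * (w i + 1) - 1.
Proof.
move=> Yi Hn; elim=> [|n IH]; first by rewrite !mul0r w0; ring.
have [S1 _] := paired_S (regular_natmul n Yi).
have [H1 H2] := Hn n.
rewrite intS mulrDl mul1r.
have [k [E _ [k1|[k2 H]|[k0 H]]]] := regular_step Yi S1.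
- by rewrite E IH k1; ring.
- rewrite {}k2 in E; case: H => H.
    case: n IH S1 E H H1 H2 => [|n] IH S1 E H H1 H2.
      rewrite mul0r w0 in H; exfalso; apply: (@natF0 0).
      by apply: (eq_lin1 (-1) H); ring.
    by have [/eqP h1 _] := Hn n; case: h1; apply: (eq_lin2 (-1) 1 IH H); ring.
  by case/eqP: H1; rewrite E IH in H; apply: (eq_lin1 1 H); ring.
- rewrite {}k0 in E; case: H => H.
    case: n IH S1 E H H1 H2 => [|n] IH S1 E H H1 H2.
      rewrite mul0r w0 in H; exfalso; apply: (@natF0 1).
      by apply: (eq_lin1 (-1) H); ring.
    by have [_ /eqP h2] := Hn n; case: h2; apply: (eq_lin2 (-1) 1 IH H); ring.
  by case/eqP: H2; rewrite E IH in H; apply: (eq_lin1 1 H); ring.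
Qed.

(* The weights 0 and 1 may be exchanged, since d : F_0 -> F_1 is covariant. *)
Definition on_line (l : F) (j : int) :=
  w j = l \/ ((l = 0 \/ l = 1) /\ (w j = 0 \/ w j = 1)).

(** [paired_types] gives the weights of the negative multiples from those of the positive ones; this
    is where 0 and 1 may be exchanged. *)
Lemma mul_line_aux i : regular i ->
  (forall n : nat, n.+1%:R * (w i + 1) != 1 /\ n.+1%:R * (w i + 1) != 2%:R) ->
  forall n : int, on_line (n%:~R * (w i + 1) - 1) (n * i).
Proof.
move=> Yi Hn; have L := mul_line_pos Yi Hn.
case=> n; first by left; rewrite L.
have Ln := L n.+1; set h := w i + 1 in Ln *; set l := _ - 1.
have El : l = - 2%:R - (n.+1%:R * h - 1) by rewrite /l NegzE rmorphN /=; ring.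
have [/eqP H1 /eqP H2] := Hn n.
rewrite NegzE mulNr /on_line El.
have [E|[[E1 E2]|[E1 E2]]|[[E1 E2]|[E1 E2]]] := paired_types (regular_natmul n.+1 Yi);
  rewrite Ln in E1 || rewrite Ln in E.
- by left; apply: (eq_lin1 1 E); ring.
- by case: H2; apply: (eq_lin1 1 E1); rewrite /h; ring.
- right; split; last by right.
  by left; apply: (eq_lin1 (-1) E1); ring.
- by case: H1; apply: (eq_lin1 1 E1); rewrite /h; ring.
- right; split; last by left.
  by right; apply: (eq_lin1 (-1) E1); ring.
Qed.

(** The numbers w_i + 1 and w_(-i) + 1 are opposite, so they cannot both have a positive multiple
    equal to 1 or 2: one of i and - i satisfies the hypothesis of [mul_line_aux]. *)
Lemma mul_line i : regular i -> forall n : int, on_line (n%:~R * (w i + 1) - 1) (n * i).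
Proof.
move=> Yi; have [H|] := pselect (forall n : nat,
  n.+1%:R * (w i + 1) != 1 /\ n.+1%:R * (w i + 1) != 2%:R).
  exact: mul_line_aux.
move=> /existsNP[m Hm] n.
have [_ Ei _ _] := Yi.
have h' : w (- i) + 1 = - (w i + 1) by apply: (eq_lin1 1 Ei); ring.
have := mul_line_aux (regularN Yi) _ (- n); rewrite h' rmorphN /= !mulrNN; apply=> k.
have K (a b : nat) : k.+1%:R * - (w i + 1) = a.+1%:R ->
    m.+1%:R * (w i + 1) = b.+1%:R -> False.
  move=> E1 E2; apply: (@natF0 (m.+1 * a.+1 + k.+1 * b.+1).-1).
  rewrite prednK ?addn_gt0 ?muln_gt0 //.
  rewrite natrD !natrM; apply: (eq_lin2 (- m.+1%:R) (- k.+1%:R) E1 E2); ring.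
by split; apply/eqP => E1; apply: Hm; split; apply/eqP => E2;
  [exact: (K 0%N 0%N) | exact: (K 0%N 1%N) | exact: (K 1%N 0%N) | exact: (K 1%N 1%N)].
Qed.

(* Jacobi identity for r, t' and t: the product of P r t and P (r + t) t' would
   be the only nonzero term. *)
Lemma no_detour r t t' : ~ paired r -> N r t -> r + t = - t' -> regular t' -> False.
Proof.
move=> Xr Nrt E Yt.
have [Xt Et wt _] := Yt; have [_ _ wt' _] := regularN Yt.
have [c c0 Hc] := regular_symbol (regularN Yt); rewrite opprK in Hc.
have e1 : t + t' = - r by rewrite -[t'](opprK t') -E; ring.
have e2 : r + t' = - t by rewrite -[t'](opprK t') -E; ring.
have s0 : w (- t') + w t' != 0 by rewrite addrC Et neg2_neq0.
have T3 : forall a b d, P r t' a d * P t (r + t') b (a + d) = 0.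
  have H u : P r t' u (w t') * P t (- t) (w (- t') - u) (u + w t') = 0.
    have := Jac r t t' u (w (- t') - u) (w t').
    rewrite e1 e2 E (nzPn Xr) [u + (_ - u)]addrC subrK Hc => Z.
    by apply: (eq_lin1 (-1) Z); ring.
  have [|||Z|Z] := @ispoly_dom _ (fun u => P r t' u (w t'))
      (fun u => P t (- t) (w (- t') - u) (u + w t')).
  - exact: (ispoly_symbol ispoly_id (ispoly_cst _)).
  - exact: (ispoly_symbol (ispoly_refl _) (ispolyD ispoly_id (ispoly_cst _))).
  - exact: H.
  - by move=> a b d; rewrite (nzPn (symbol_eq0r wt Z)) mul0r.
  - have NX : ~ N t (- t).
      apply: (symbol_eq0s s0) => u; rewrite -[RHS](Z (w (- t') - u)).
      by congr P; ring.
    by move=> a b d; rewrite e2 (nzPn NX) mulr0.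
apply: (@nz_mul r t (- t') t' _ Nrt (nz_sym Xt)) => a b d.
by have := Jac r t t' a b d; rewrite T3 e1 (nzPn Xr) mulr0 addr0 E => <-.
Qed.

(** The weights met are integers at most -2, hence avoid 0 and 1, and [paired_nz] allows one more
    step. The degree of that step is at most 2, and 2 contradicts the quadratic relation, so the
    weight decreases. *)
Lemma mul_weight x : paired x -> w x = - 2%:R -> w (- x) = 0 \/ w (- x) = 1 ->
  forall n : nat, S (n.+1%:Z * x) /\ exists m : nat, w (n.+1%:Z * x) = - m.+2%:R.
Proof.
move=> Xx wx w'x; have [Sx _] := paired_S Xx.
have [K [EK K1]] : exists K : nat, w x + w (- x) + K%:R = -1 /\ (K <= 1)%N.
  by case: w'x => ->; rewrite wx; [exists 1%N | exists 0%N]; split=> //; ring.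
elim=> [|n [Sn [m Em]]]; first by rewrite mul1r; split=> //; exists 0%N.
have wn0 : w (n.+1%:Z * x) != 0 by rewrite Em oppr_eq0 pnatr_eq0.
have wn1 : w (n.+1%:Z * x) != 1.
  by apply/eqP => e; apply: (@natF0 m.+2); apply: (eq_lin2 (-1) 1 e Em); ring.
have [N1 _ _ N2] := paired_nz Xx Sn wn0 wn1.
have [k Hk E1] := Pdeg N1; have [k' _ E2] := Pdeg N2; rewrite addKr in E2.
have kk := paired_deg_eq Xx EK E1 E2.
rewrite intS mulrDl mul1r; split; first by case/PS: N1.
have wx0 : w x != 0 by rewrite wx neg2_neq0.
have k2 : k != 2.
  apply/eqP => k2; rewrite k2 in Hk; have H := deg2 N1 Hk isT wx0 wn0.
  apply: (@natF0 (4 * m + 11)%N); rewrite -addn1 -addnA natrD natrM.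
  apply: (eq_lin3 (-1) 4%:R 4%:R H wx Em).
  by rewrite (_ : 2 * 2.-1 = 2)%N // (_ : m.+2 = m + 2)%N ?natrD; [ring|lia].
exists (m + 2 - k)%N; rewrite E1 wx Em.
have -> : m.+2 = (m + 2 - k + k)%N by lia.
have -> : (m + 2 - k).+2 = (m + 2 - k + 2)%N by lia.
rewrite !natrD; ring.
Qed.

Lemma avoid (l : seq F) : exists n : nat, n.+1%:R \notin l.
Proof.
apply: contrapT => H.
have /uniq_leq_size : uniq [seq n.+1%:R : F | n <- iota 0 (size l).+1].
  by rewrite map_inj_uniq ?iota_uniq // => a b /natF_inj [].
move=> /(_ l); rewrite size_map size_iota ltnn => K.
have // : false by apply: K => _ /mapP[n _ ->]; apply: contrapT => /negP nl; apply: H;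
  exists n.
Qed.

Lemma regular_mul i (n : int) : regular i ->
  n%:~R * (w i + 1) \notin [:: 1; 2%:R; -1; - 2%:R] ->
  regular (n * i) /\ w (n * i) = n%:~R * (w i + 1) - 1.
Proof.
move=> Yi; rewrite !inE !negb_or => /and4P[/eqP h1 /eqP h2 /eqP h3 /eqP h4].
have E1 : w (n * i) = n%:~R * (w i + 1) - 1.
  have [//|[[H|H] _]] := mul_line Yi n.
    by case: h1; apply: (eq_lin1 1 H); ring.
  by case: h2; apply: (eq_lin1 1 H); ring.
have E2 : w (- (n * i)) = - (n%:~R * (w i + 1)) - 1.
  have := mul_line Yi (- n); rewrite rmorphN !mulNr.
  case=> [//|[[H|H] _]].
    by case: h3; apply: (eq_lin1 (-1) H); ring.
  by case: h4; apply: (eq_lin1 (-1) H); ring.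
split=> //; split; [exact: regular_intmul | by rewrite E1 E2; ring | |]; apply/eqP => H.
  by case: h1; apply: (eq_lin2 1 (-1) H E1); ring.
by case: h3; apply: (eq_lin2 1 (-1) H E1); ring.
Qed.

(* The translates of j by large multiples of i avoid any given set of weights. *)
Lemma coset_generic i j (l : seq F) : regular i -> w i + 1 != 0 -> S j ->
  exists n : nat, [/\ n%:R * (w i + 1) \notin l, regular (n%:Z * i),
    w (n%:Z * i) = n%:R * (w i + 1) - 1, w (n%:Z * i + j) \notin l &
    w j = 0 \/ w j = 1 \/ w (n%:Z * i + j) \in [:: 0; 1] \/
    w (n%:Z * i + j) = w (n%:Z * i) + w j + 1].
Proof.
move=> Yi h0 Sj; set h := w i + 1 in h0 *.
(* The second list excludes the three candidates n h - 1 + w_j + k, with k <= 2, that [regular_step]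
   allows for the weight of the translate. *)
have [n] := avoid ([seq x / h | x <- [:: 1; 2%:R; -1; - 2%:R] ++ l] ++
  flatten [seq [seq (x - w j + 1 - k%:R) / h | x <- l] | k <- iota 0 3]).
rewrite mem_cat negb_or => /andP[H1 H2].
have Hn x : n.+1%:R * h = x -> n.+1%:R = x / h by move=> <-; rewrite mulfK.
have H3 : n.+1%:R * h \notin [:: 1; 2%:R; -1; - 2%:R] ++ l.
  by apply: contra H1 => H; apply/mapP; exists (n.+1%:R * h) => //; exact: Hn.
rewrite mem_cat negb_or in H3; case/andP: H3 => H3 H4.
have [Yn] := regular_mul (n := n.+1%:Z) Yi H3.
rewrite -/h -[n.+1%:~R]/(n.+1%:R) => En.
exists n.+1; split=> //.
  have [k [E _ Hk]] := regular_step Yn Sj.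
  apply: contra H2 => H; apply/flattenP.
  exists [seq (x - w j + 1 - k%:R) / h | x <- l].
    by apply/mapP; exists k => //; case: Hk => [->|[-> _]|[-> _]].
  apply/mapP; exists (w (n.+1%:Z * i + j)) => //; apply: Hn.
  by rewrite E En; ring.
have [k [E _ [e|[_ [e|e]]|[_ [e|e]]]]] := regular_step Yn Sj.
- by right; right; right; rewrite E e.
- by left.
- by right; right; left; rewrite e !inE eqxx orbT.
- by right; left.
- by right; right; left; rewrite e !inE eqxx.
Qed.

Lemma paired_generic t : paired t -> w t \notin [:: 0; 1; - 2%:R; - 3%:R] -> regular t.
Proof.
move=> Xt; rewrite !inE !negb_or => /and4P[/eqP h1 /eqP h2 /eqP h3 /eqP h4].
by have [E|[[]|[]]|[[]|[]]] := paired_types Xt => //; split=> //; exact/eqP.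
Qed.

(** Without brackets from non-paired to paired indices, the non-paired ones would support a graded
    ideal, and 0 is paired. *)
Lemma all_paired : (forall r t, S r -> ~ paired r -> N r t -> paired (r + t) -> False) ->
  forall j, S j -> paired j.
Proof.
move=> H j Sj; apply: contrapT => NX.
suff [_ []] : S 0 /\ ~ paired 0 by exact: paired0.
apply: (@simple (fun i => S i /\ ~ paired i)) => //; first by exists j.
move=> r t [Sr Xr] Nrt; split; first by case/PS: Nrt.
by move=> Xrt; apply: (H r t).
Qed.

(** * Supports containing a line of nonzero slope *)

Section SlopeNonzero.
Variable i : int.
Hypotheses (i0 : i != 0) (Yi : regular i) (hi : w i + 1 != 0).

(** [no_detour] requires a regular target. The opposite of r + t becomes regular after translation
    by a large multiple of i, and the bracket from r to r + t has to be translated along. *)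
Lemma slope_all_paired j : S j -> paired j.
Proof.
apply: all_paired => r t Sr Xr Nrt Xrt.
have Xt' := pairedN Xrt; have [St' _] := paired_S Xt'.
have [n [_ Yn _ wn _]] := coset_generic [:: 0; 1; - 2%:R; - 3%:R] Yi hi St'.
have Yt' : regular (n%:Z * i - (r + t)) by apply: paired_generic => //;
  exact: regular_add_paired.
set M := n%:Z * i in Yn Yt' *; have YM := regularN Yn.
have [Srt _] := paired_S Xrt; have [NM _ _ _] := regular_nz YM Srt.
(* The translation by - M passes either to t or to r; in the second case r - M is still not
   paired. *)
have [[_ H]|[_ H]] := nz_split Nrt (nz_sym NM).
  by apply: (no_detour Xr H _ Yt'); ring.
have XrM : ~ paired (r - M).
  by move=> /(regular_add_paired Yn); rewrite addrC subrK.
by apply: (no_detour XrM (nz_sym H) _ Yt'); ring.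
Qed.

Lemma slope_S_add j l : S j -> S l -> S (j + l).
Proof.
move=> Sj Sl.
have [n [_ Yn _ wn _]] := coset_generic [:: 0; 1; - 2%:R; - 3%:R] Yi hi Sj.
have Yt : regular (n%:Z * i + j).
  by apply: paired_generic => //; apply: regular_add_paired => //; exact: slope_all_paired.
have [H _ _ _] := regular_nz Yt Sl; have [_ _ H'] := PS H.
have [H2 _ _ _] := regular_nz (regularN Yn) H'; have [_ _] := PS H2.
by rewrite addrA addrA addNr add0r.
Qed.

Let eta := (w i + 1) / i%:~R.

Lemma on_lineE l j : on_line l j -> l != 0 -> l != 1 -> w j = l.
Proof. by case=> // -[[->|->] _]; rewrite ?eqxx. Qed.

(** The weight of a common multiple n i j is computed from i and from j; n is chosen so that both
    computations avoid the ambiguous weights 0 and 1. *)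
Lemma slope_generic j : regular j -> w j + 1 = j%:~R * eta.
Proof.
move=> Yj; rewrite /eta.
have iF : i%:~R != 0 :> F by rewrite intr_eq0.
pose h := w i + 1; pose h' := w j + 1; rewrite -/h -/h'.
have [n] := avoid [:: 1 / (j%:~R * h); 2%:R / (j%:~R * h); 1 / (i%:~R * h');
  2%:R / (i%:~R * h')].
rewrite !inE !negb_or => /and4P[h1 h2 h3 h4].
have K (x y : F) : n.+1%:R != y / x -> y != 0 -> n.+1%:R * x != y.
  move=> H; apply: contraNneq => y0; rewrite -y0 in H *.
  have [x0|x0] := eqVneq x 0; first by rewrite x0 mulr0.
  by rewrite mulfK ?eqxx in H.
have n1 : 1 != 0 :> F by rewrite oner_eq0.
have n2 : 2%:R != 0 :> F by rewrite pnatr_eq0.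
move: {h1 h2 h3 h4} (K _ _ h1 n1) (K _ _ h2 n2) (K _ _ h3 n1) (K _ _ h4 n2) => h1 h2 h3 h4.
have A (x y : F) : x != y + 1 -> x - 1 != y.
  by apply: contraNneq => <-; rewrite subrK.
have E1 := on_lineE (mul_line Yi (n.+1%:Z * j)).
have E2 := on_lineE (mul_line Yj (n.+1%:Z * i)).
rewrite -/h -/h' in E1 E2. rewrite !rmorphM /= -[n.+1%:~R]/(n.+1%:R) -!mulrA in E1 E2.
have {}E1 := E1 (A _ 0 _) (A _ 1 _); have {}E2 := E2 (A _ 0 _) (A _ 1 _).
rewrite !add0r in E1 E2.
have : n.+1%:R * (j%:~R * h) = n.+1%:R * (i%:~R * h').
  have e : n.+1%:Z * (j * i) = n.+1%:Z * (i * j) by ring.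
  rewrite e in E1.
  by apply: (eq_lin2 (-1) 1 (E1 h1 h2) (E2 h3 h4)); ring.
move/(mulfI (_ : n.+1%:R != 0 :> F)); rewrite pnatr_eq0 => /(_ isT) E.
by apply: (mulfI iF); rewrite -E; field.
Qed.

Lemma slope_line j : S j -> on_line (j%:~R * eta - 1) j.
Proof.
have A k : S k -> w k = k%:~R * eta - 1 \/ w k = 0 \/ w k = 1.
  move=> Sk.
  have [n [_ Yn En wn Hn]] := coset_generic [:: 0; 1; - 2%:R; - 3%:R] Yi hi Sk.
  have Yt : regular (n%:Z * i + k).
    by apply: paired_generic => //; apply: regular_add_paired => //;
      exact: slope_all_paired.
  have Et := slope_generic Yt.
  case: Hn => [|[|[|E]]]; [by right; left|by right; right| |].
    rewrite !inE => H; rewrite !inE !negb_or in wn.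
    by case/and4P: wn => /negPf h1 /negPf h2 _ _; rewrite h1 h2 in H.
  left; rewrite E En in Et; rewrite rmorphD rmorphM /= in Et.
  have iF : i%:~R != 0 :> F by rewrite intr_eq0.
  have e : i%:~R * eta = w i + 1 by rewrite /eta mulrC divfK.
  by apply: (eq_lin2 1 n%:R Et e); rewrite -[n%:~R]/(n%:R); ring.
move=> Sj; have [|wj] := A _ Sj; [by left|right; split=> //].
have [Xj _] := (slope_all_paired Sj, S0).
have [_ S'j] := paired_S Xj.
(* It remains to see that a weight 0 or 1 occurs only where the line itself takes one of these
   values; the weight of - j and [paired_types] decide this. *)
have := A _ S'j; rewrite rmorphN /= => -[E|H].
  have [e|[[e1 e2]|[e1 e2]]|[[e1 e2]|[e1 e2]]] := paired_types Xj.
  - by case: wj => wj; [left|right]; apply: (eq_lin3 1 (-1) 1 E e wj); ring.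
  - by left; apply: (eq_lin2 1 (-1) E e2); ring.
  - exfalso; case: wj => wj; first by apply: (@natF0 1); apply: (eq_lin2 (-1) 1 wj e1);
    ring.
    by apply: (@natF0 2); apply: (eq_lin2 (-1) 1 wj e1); ring.
  - by right; apply: (eq_lin2 1 (-1) E e2); ring.
  - exfalso; case: wj => wj; first by apply: (@natF0 2); apply: (eq_lin2 (-1) 1 wj e1);
    ring.
    by apply: (@natF0 3); apply: (eq_lin2 (-1) 1 wj e1); ring.
exfalso.
have Z (a : nat) (x y : F) : x = a%:R -> y = 0 \/ y = 1 -> x + y = - 2%:R -> False.
  move=> e1 [e2|e2] e3.
    by apply: (@natF0 a.+1); apply: (eq_lin3 (-1) (-1) 1 e1 e2 e3); ring.
  by apply: (@natF0 a.+2); apply: (eq_lin3 (-1) (-1) 1 e1 e2 e3); ring.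
have Z2 (a : nat) (y : F) : y = - a.+2%:R -> y = 0 \/ y = 1 -> False.
  move=> e1 [e2|e2].
    by apply: (@natF0 a.+1); apply: (eq_lin2 1 (-1) e1 e2); ring.
  by apply: (@natF0 a.+2); apply: (eq_lin2 1 (-1) e1 e2); ring.
have [e|[[e1 e2]|[e1 e2]]|[[e1 e2]|[e1 e2]]] := paired_types Xj.
- by case: wj => wj; [apply: (Z 0%N _ _ wj H e)|apply: (Z 1%N _ _ wj H e)].
- exact: (Z2 0%N _ e2 H).
- exact: (Z2 0%N _ e1 wj).
- exact: (Z2 1%N _ e2 H).
- exact: (Z2 1%N _ e1 wj).
Qed.
End SlopeNonzero.

(** * Supports in which all regular weights are -1 *)

Section SlopeZero.
Variable i : int.
Hypotheses (i0 : i != 0) (Yi : regular i) (flat : forall j, regular j -> w j = -1).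

(** A common multiple of x and i has weight at most -2 by [mul_weight], and -1 by [mul_line] with
    slope zero. *)
Lemma flat_weight_neqN2 x : paired x -> w x = - 2%:R -> w (- x) = 0 \/ w (- x) = 1 -> False.
Proof.
move=> Xx wx w'x; have [_ [m Em]] := mul_weight Xx wx w'x (`|i|%N.-1).
have e : (`|i|%N.-1.+1)%:Z * x = (sgz i * x) * i.
  by rewrite prednK ?absz_gt0 // abszEsg; ring.
have := mul_line Yi (sgz i * x); rewrite -e flat // addNr mulr0 add0r.
case=> [|[[H|H] _]].
- by rewrite Em => H; apply: (@natF0 m); apply: (eq_lin1 (-1) H); ring.
- by apply: (@natF0 0); apply: (eq_lin1 (-1) H); ring.
- by apply: (@natF0 1); apply: (eq_lin1 (-1) H); ring.
Qed.

Lemma flat_regular x : paired x -> regular x.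
Proof.
have K2 y : paired y -> w y = 0 -> w (- y) = - 3%:R -> False.
  move=> Xy wy w'y; have E : w y + w (- y) = - 3%:R by rewrite wy w'y add0r.
  have [Y2 w2] := paired_deg2 Xy E wy; apply: (@natF0 3).
  by apply: (eq_lin2 1 (-1) (flat Y2) w2); ring.
move=> Xx; have X'x := pairedN Xx; have [e|[[e1 e2]|[e1 e2]]|[[e1 e2]|[e1 e2]]] :=
  paired_types Xx.
- split=> //; apply/eqP => wx.
    apply: (flat_weight_neqN2 X'x); last by rewrite opprK; left.
    by apply: (eq_lin2 1 (-1) e wx); ring.
  apply: (flat_weight_neqN2 Xx wx); left.
  by apply: (eq_lin2 1 (-1) e wx); ring.
- by case: (flat_weight_neqN2 X'x e2); rewrite opprK; right.
- by case: (flat_weight_neqN2 Xx e1); right.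
- by case: (K2 x).
- by case: (K2 (- x)); rewrite ?opprK.
Qed.

Lemma flat_all_paired j : S j -> paired j.
Proof.
apply: all_paired => r t Sr Xr Nrt Xrt.
by apply: (no_detour Xr Nrt _ (flat_regular (pairedN Xrt))); rewrite opprK.
Qed.
End SlopeZero.

Lemma line_case i : i != 0 -> regular i -> exists eta : F,
  [/\ forall j, S j -> paired j, forall j l, S j -> S l -> S (j + l) &
      forall j, S j -> on_line (j%:~R * eta - 1) j].
Proof.
move=> i0 Yi.
have [[k [k0 Yk hk]]|H] := pselect (exists k, [/\ k != 0, regular k & w k + 1 != 0]).
  exists ((w k + 1) / k%:~R); split.
  - exact: (slope_all_paired Yk hk).
  - exact: (slope_S_add Yk hk).
  - exact: (slope_line k0 Yk hk).
have flat j : regular j -> w j = -1.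
  move=> Yj; have [->|j0] := eqVneq j 0; first exact: w0.
  apply/eqP; rewrite -subr_eq0 opprK; apply: contraT => hj.
  by case: H; exists j.
have Sall := flat_all_paired i0 Yi flat; have YX := flat_regular i0 Yi flat.
exists 0; split=> // [j l Sj Sl | j Sj].
  have [Njl _ _ _] := regular_nz (YX _ (Sall _ Sj)) Sl.
  by case/PS: Njl.
by left; rewrite mulr0 add0r flat //; apply: YX; exact: Sall.
Qed.

(** A nonzero value at (a, - a) is an invariant pairing of densities into F_1 modulo exact forms:
    only the product, for weights of sum 1, and f dg, for weights 0, occur. *)
Lemma weight1_cases j l k a : N j l -> hform k (P j l) ->
  w (j + l) = w j + w l + k%:R -> w (j + l) = 1 -> P j l a (- a) != 0 ->
  (k = 0%N /\ w j + w l = 1) \/ [/\ k = 1%N, w j = 0 & w l = 0].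
Proof.
move=> Njl Hk E E1 Pa.
have [k0|k0] := posnP k; first by left; split=> //; rewrite -E1 E k0 addr0.
right; case: k k0 Hk E => // k _ Hk E.
set q := P j l 1 (-1).
have qE x : P j l x (- x) = x ^+ k.+1 * q.
  by rewrite -(hformZ _ _ _ Hk) mulr1 mulrN1.
have q0 : q != 0.
  by apply: contraNneq Pa => q0; rewrite qE q0 mulr0.
(* Covariance at a = - (b + c), where the left-hand side vanishes because the target has weight
   1. *)
have C b c : (b - w j * (b + c)) * (- c) ^+ k.+1 + (c - w l * (b + c)) * b ^+ k.+1 = 0.
  apply: (mulIf q0); have := symbol_cov Njl (- (b + c)) b c; rewrite E1 mul1r subrr mul0r.
  have -> : - (b + c) + b = - c by ring.
  have -> : - (b + c) + c = - b by ring.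
  have := qE (- c); rewrite opprK => ->; rewrite qE => H.
  by apply: (eq_lin1 (-1) H); ring.
have wl : w l = 0.
  have := C 1 0; rewrite oppr0 exprS mul0r mulr0 add0r expr1n => H.
  by apply: (eq_lin1 (-1) H); ring.
have wj : w j = 0.
  have := C 0 1; rewrite [0 ^+ _]exprS mul0r mulr0 addr0 => H.
  have e : (- 1) ^+ k.+1 != 0 :> F by rewrite signr_eq0.
  by apply: (mulIf e); apply: (eq_lin1 (-1) H); ring.
split=> //; apply: natF_inj; rewrite E wj wl in E1.
by apply: (eq_lin1 1 E1); ring.
Qed.

(** * Weights and generators of a line *)

Section Line.
Variable eta : F.
Hypotheses (SX : forall j, S j -> paired j)
  (Sadd : forall j l, S j -> S l -> S (j + l))
  (lineS : forall j, S j -> on_line (j%:~R * eta - 1) j).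

Lemma S_opp j : S j -> S (- j).
Proof. by move=> /SX /paired_S[]. Qed.

Lemma lineP j : S j -> [\/ w j = j%:~R * eta - 1,
  j%:~R * eta = 1 /\ w j = 1 | j%:~R * eta = 2%:R /\ w j = 0].
Proof.
move=> Sj; have [e|[[l|l] [e|e]]] := lineS Sj; first exact: Or31.
- by apply: Or31; rewrite l e.
- by apply: Or32; split=> //; apply: (eq_lin1 1 l); ring.
- by apply: Or33; split=> //; apply: (eq_lin1 1 l); ring.
- by apply: Or31; rewrite l e.
Qed.

(** The pairings that [perfect] and [weight1_cases] allow into m are excluded by the positions of
    the indices on the line, except for j = l of weight 0 with j eta = 1 and m = 2j. That last case
    needs the Jacobi identity. *)
Lemma no_weight1 m : S m -> w m != 1.
Proof.
move=> Sm; apply/eqP => wm.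
have [j [l [a [jl Pa]]]] := perfect Sm wm.
have Njl : N j l by exists a, (- a).
have [Sj Sl _] := PS Njl; have [k Hk E] := Pdeg Njl.
have etam : m%:~R * eta = 1 \/ m%:~R * eta = 2%:R.
  have [e|[e _]|[_ e]] := lineP Sm; [right|by left|].
    by apply: (eq_lin2 1 (-1) wm e); ring.
  by rewrite wm in e; move/eqP: e; rewrite oner_eq0.
have eta0 : eta != 0.
  apply/eqP => e0; case: etam; rewrite e0 mulr0 => /eqP; rewrite eq_sym.
    by rewrite oner_eq0.
  by rewrite pnatr_eq0.
have Em : m%:~R * eta = j%:~R * eta + l%:~R * eta by rewrite -jl rmorphD /=; ring.
have inj x y : x%:~R * eta = y%:~R * eta -> x = y.
  by move/(mulIf eta0)/eqP; rewrite eqr_int => /eqP.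
rewrite -jl in wm.
have no3 : m%:~R * eta = 3%:R -> False.
  move=> e; case: etam => e'; [apply: (@natF0 1)|apply: (@natF0 0)];
    by apply: (eq_lin2 (-1) 1 e e'); ring.
have no4 : m%:~R * eta = 4%:R -> False.
  move=> e; case: etam => e'; [apply: (@natF0 2)|apply: (@natF0 1)];
    by apply: (eq_lin2 (-1) 1 e e'); ring.
have n01 : 0 = 1 :> F -> False by move/eqP; rewrite eq_sym oner_eq0.
have [[_ E']|[k1 wj wl]] := weight1_cases Njl Hk E wm Pa.
  have mixed x y : w x = x%:~R * eta - 1 -> y%:~R * eta = 1 -> w y = 1 ->
      w x + w y = 1 -> False.
    move=> e1 e2 e3; rewrite e1 e3 => H.
    have xy : x = y by apply: inj; rewrite e2; apply: (eq_lin1 1 H); ring.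
    by apply: n01; rewrite -e3 -xy e1 xy e2 subrr.
  have [e1|[e1 e1']|[e1 e1']] := lineP Sj; have [e2|[e2 e2']|[e2 e2']] := lineP Sl.
  - by apply: no3; rewrite e1 e2 in E'; apply: (eq_lin2 1 1 Em E'); ring.
  - exact: (mixed j l).
  - apply: no4; rewrite e1 e2' in E'; rewrite Em e2.
    by apply: (eq_lin1 1 E'); ring.
  - by apply: (mixed l j) => //; rewrite addrC.
  - rewrite e1' e2' in E'; apply: n01; apply: (eq_lin1 (-1) E'); ring.
  - by apply: no3; rewrite Em e1 e2; ring.
  - apply: no4; rewrite e1' e2 in E'; rewrite Em e1.
    by apply: (eq_lin1 1 E'); ring.
  - by apply: no3; rewrite Em e1 e2; ring.
  - by apply: n01; rewrite -E' e1' e2' addr0.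
have val x : S x -> w x = 0 -> x%:~R * eta = 1 \/ x%:~R * eta = 2%:R.
  move=> Sx wx; have [e|[_ e]|[e _]] := lineP Sx; [left| |by right].
    by apply: (eq_lin2 1 (-1) wx e); ring.
  by case: n01; rewrite -wx e.
have [[e1|e1] [e2|e2]] := (val _ Sj wj, val _ Sl wl); last 3 first.
- by apply: no3; rewrite Em e1 e2; ring.
- by apply: no3; rewrite Em e1 e2; ring.
- by apply: no4; rewrite Em e1 e2; ring.
have jl' : l = j by apply: inj; rewrite e1 e2.
rewrite {}jl' {}k1 in Njl Hk wm.
have Sn (n : nat) : S (n%:Z * j).
  by elim: n => [|n IH]; rewrite ?mul0r // intS mulrDl mul1r; exact: Sadd.
have wn (n : nat) : w (n.+3%:Z * j) = n.+2%:R.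
  have e : (n.+3%:Z * j)%:~R * eta = n.+3%:R.
    by rewrite rmorphM /= -mulrA e1 mulr1.
  have := lineP (Sn n.+3); rewrite e => -[->|[e' _]|[e' _]].
  - by rewrite -[in LHS](addn1 n.+2) natrD addrK.
  - by case: (@natF0 n.+1); apply: (eq_lin1 1 e'); ring.
  - by case: (@natF0 n); apply: (eq_lin1 1 e'); ring.
(* From the weights 2 and 3 of 3j and 4j on, brackets with j have symbol a constant times a, so they
   commute. The Jacobi identity for j, j, 3j then makes the product of [P j j] and [P (j + j) t]
   vanish, though both are nonzero. *)
pose t := 3%:Z * j.
have wt : w t = 2%:R := wn 0%N.
have wt0 : w t != 0 by rewrite wt pnatr_eq0.
have St : S t := Sn 3.
have e4 : j + t = 4%:Z * j by rewrite /t; ring.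
have e5 : j + (j + t) = 5%:Z * j by rewrite /t; ring.
have Yt : regular t.
  apply: paired_generic; first exact: SX.
  rewrite wt !inE !negb_or pnatr_eq0 /=; apply/and3P; split; apply/eqP => H.
  - by case: (@natF0 0); apply: (eq_lin1 1 H); ring.
  - by case: (@natF0 3); apply: (eq_lin1 1 H); ring.
  - by case: (@natF0 4); apply: (eq_lin1 1 H); ring.
have [Ntj _ _ _] := regular_nz Yt Sj; have [Ntm _ _ _] := regular_nz Yt (Sadd Sj Sj).
have [S4 _] := paired_S (SX (Sadd Sj St)).
have [Njt Nmt] := (nz_sym Ntj, nz_sym Ntm).
have [Ntjt _ _ _] := regular_nz Yt S4.
have w4 : w (j + t) = 3%:R by rewrite e4 wn.
have w5 : w (j + (j + t)) = 4%:R by rewrite e5 wn.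
have w40 : w (j + t) != 0 by rewrite w4 pnatr_eq0.
have one x y : w x = 0 -> w y != 0 -> N x y -> w (x + y) = w y + 1 ->
    exists2 c, c != 0 & forall a b, P x y a b = c * a.
  move=> wx wy Nxy Exy; have [q Hq Eq] := Pdeg Nxy.
  have q1 : q = 1%N.
    by apply: natF_inj; rewrite Exy in Eq; apply: (eq_lin2 (-1) (-1) Eq wx); ring.
  rewrite q1 in Hq; have [|c c0 Hc] := deg1 Nxy Hq; first by rewrite wy orbT.
  exists (c * w y) => [|x' y']; first by rewrite mulf_neq0.
  by rewrite Hc wx; ring.
have [|c1 _ H1] := one j t wj wt0 Njt; first by rewrite w4 wt; ring.
apply: (nz_mul _ Njl Nmt) => x y z; have := Jac j j t x y z.
have [n|n] := pselect (N j (j + t)); last by rewrite !(nzPn n) !mulr0 addr0 => <-.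
have [|c2 _ H2] := one j (j + t) wj w40 n; first by rewrite w5 w4; ring.
by rewrite !H1 !H2 => H; apply: (eq_lin1 (-1) H); ring.
Qed.

Lemma weightE j : S j ->
  w j = if j%:~R * eta == 2%:R then 0 else j%:~R * eta - 1.
Proof.
move=> Sj; have w1 := no_weight1 Sj.
have [E|[_ e]|[e ->]] := lineP Sj; last by rewrite e eqxx.
  by case: eqP => // e; case/eqP: w1; rewrite E e; ring.
by rewrite e eqxx in w1.
Qed.

Lemma exceptional_nz j l : S j -> j%:~R * eta = 2%:R -> S l -> N j l /\ N (- j) l.
Proof.
move=> Sj e Sl.
have wj : w j = 0 by rewrite weightE // e eqxx.
have wj' : w (- j) = - 3%:R.
  rewrite weightE ?rmorphN ?mulNr ?e /=; last exact: S_opp.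
  case: eqP => [H|_]; last by ring.
  by exfalso; apply: (@natF0 3); apply: (eq_lin1 (-1) H); ring.
have E : w j + w (- j) = - 3%:R by rewrite wj wj' add0r.
by have [] := paired_deg2_nz (SX Sj) E wj Sl.
Qed.

(** Regularity, or the nonvanishing at exceptional indices, suffices except when g eta = -1. There
    only a j of weight 0 needs care: it is the exceptional index or - g. *)
Lemma generator_N g j : S g -> S j -> g%:~R * eta != 1 -> N g j.
Proof.
move=> Sg Sj g1.
have [e|g2] := eqVneq (g%:~R * eta) 2%:R; first by have [] := exceptional_nz Sg e Sj.
have [e|g2'] := eqVneq (g%:~R * eta) (- 2%:R).
  have e' : (- g)%:~R * eta = 2%:R by rewrite rmorphN mulNr e opprK.
  by have [_] := exceptional_nz (S_opp Sg) e' Sj; rewrite opprK.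
have wg : w g = g%:~R * eta - 1 by rewrite weightE // (negPf g2).
have wg' : w (- g) = - (g%:~R * eta) - 1.
  rewrite weightE; last exact: S_opp.
  rewrite rmorphN mulNr; case: eqP => // H; case/eqP: g2'.
  by rewrite -H opprK.
have [e|g1'] := eqVneq (g%:~R * eta) (-1); last first.
  have Yg : regular g.
    split; [exact: SX | by rewrite wg wg'; ring | |]; apply/eqP => H.
      by case/eqP: g1; apply: (eq_lin2 1 (-1) H wg); ring.
    by case/eqP: g1'; apply: (eq_lin2 1 (-1) H wg); ring.
  by have [] := regular_nz Yg Sj.
have eta0 : eta != 0.
  apply/eqP => eta0; apply: (@natF0 0); rewrite eta0 mulr0 in e.
  by apply: (eq_lin1 1 e); ring.
have [wj|wj] := eqVneq (w j) 0; last first.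
  by have [] := paired_nz (SX Sg) Sj wj (no_weight1 Sj).
have [/eqP ej|ej] := boolP (j%:~R * eta == 2%:R).
  by apply: nz_sym; have [] := exceptional_nz Sj ej Sg.
rewrite weightE // (negPf ej) in wj.
have -> : j = - g; last exact: SX.
apply/eqP; rewrite -(eqr_int F); apply/eqP; apply: (mulIf eta0).
by rewrite rmorphN; apply: (eq_lin2 1 1 wj e); ring.
Qed.

Lemma S_mul g (n : int) : S g -> S (n * g).
Proof.
move=> Sg; have Sn (m : nat) : S (m%:Z * g).
  by elim: m => [|m IH]; rewrite ?mul0r // intS mulrDl mul1r; exact: Sadd.
by case: n => n; rewrite ?NegzE ?mulNr; [|apply: S_opp]; exact: Sn.
Qed.

(** S is a subgroup of the integers. Its generator is chosen up to sign so that [g eta != 1]: the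
    constants of brackets with g are later isolated by division by g eta - 1. *)
Lemma generator i : i != 0 -> S i -> exists g, [/\ g != 0, S g,
  g%:~R * eta != 1 & forall j, S j -> exists n, j = n * g].
Proof.
move=> i0 Si.
have exP : exists n : nat, `[< (0 < n)%N /\ S n%:Z >].
  exists `|i|%N; apply/asboolP; split; first by rewrite absz_gt0.
  by rewrite abszEsg; exact: S_mul.
case: (ex_minnP exP) => d /asboolP[d0 Sd] dmin.
have dg j : S j -> exists n, j = n * d%:Z.
  move=> Sj; exists (j %/ d%:Z)%Z; rewrite [LHS](divz_eq j d%:Z).
  suff -> : (j %% d%:Z)%Z = 0 by rewrite addr0.
  have r0 : (0 <= (j %% d%:Z)%Z) by apply: modz_ge0; lia.
  have rd : ((j %% d%:Z)%Z < d%:Z) by apply: ltz_pmod; lia.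
  have Sr : S (j %% d%:Z)%Z.
    have -> : (j %% d%:Z)%Z = j + - ((j %/ d%:Z)%Z * d%:Z).
      by rewrite {2}(divz_eq j d%:Z); ring.
    by apply: Sadd => //; apply: S_opp; exact: S_mul.
  case: (j %% d%:Z)%Z r0 rd Sr => [r|//] _ rd Sr.
  have [->//|r0] := posnP r.
  have : (d <= r)%N by apply: dmin; apply/asboolP.
  by lia.
have [e|ne] := eqVneq (d%:Z%:~R * eta) 1.
  exists (- d%:Z); split.
  - by rewrite oppr_eq0; lia.
  - exact: S_opp.
  - rewrite rmorphN mulNr e; apply/eqP => H; apply: (@natF0 1).
    by apply: (eq_lin1 (-1) H); ring.
  - by move=> j /dg[n ->]; exists (- n); ring.
by exists d%:Z; split=> //; lia.
Qed.
End Line.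

(** * Supports without nonzero regular index *)

Section NoLine.
Hypothesis noY : forall i, regular i -> i = 0.
Variable i0 : int.
Hypotheses (i0n : i0 != 0) (Si0 : S i0).

(** Otherwise the nonzero indices would support a graded ideal without degree 0. *)
Lemma paired_ex : exists2 x, x != 0 & paired x.
Proof.
apply: contrapT => H.
suff [_ /eqP] : S 0 /\ 0 != 0 :> int by [].
apply: (@simple (fun i => S i /\ i != 0)) => //; first by exists i0.
move=> r t [Sr r0] Nrt; split; first by case/PS: Nrt.
apply/eqP => E; apply: H; exists r => //; rewrite /paired.
by rewrite (_ : - r = t) //; apply/eqP; rewrite eq_sym -addr_eq0 addrC E.
Qed.

Lemma paired_type x : paired x -> x != 0 -> (w x = - 2%:R /\ (w (- x) = 0 \/ w (- x) =
  1)) \/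
  (w (- x) = - 2%:R /\ (w x = 0 \/ w x = 1)).
Proof.
have K2 y : paired y -> w y = 0 -> w (- y) = - 3%:R -> y = 0.
  move=> Xy wy w'y; have E : w y + w (- y) = - 3%:R by rewrite wy w'y add0r.
  by have [/noY H _] := paired_deg2 Xy E wy; lia.
move=> Xx x0; have [e|[[e1 e2]|[e1 e2]]|[[e1 e2]|[e1 e2]]] := paired_types Xx.
- have [wx|wx] := eqVneq (w x) 0.
    right; split; last by left.
    by apply: (eq_lin2 1 (-1) e wx); ring.
  have [wx'|wx'] := eqVneq (w x) (- 2%:R).
    by left; split=> //; left; apply: (eq_lin2 1 (-1) e wx'); ring.
  by case/eqP: x0; apply: noY.
- by right; split=> //; right.
- by left; split=> //; right.
- by case/eqP: x0; apply: K2.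
- by case/eqP: x0; have := K2 (- x) (pairedN Xx) e2; rewrite opprK => /(_ e1); lia.
Qed.

(* In CL1 the only extremal index is 1. *)
Definition extremal x := paired x /\ w x = - 2%:R.

Lemma extremal_neq0 x : extremal x -> x != 0.
Proof.
case=> _ wx; apply/eqP => x0; rewrite x0 w0 in wx.
by apply: (@natF0 0); apply: (eq_lin1 1 wx); ring.
Qed.

Lemma extremal_weightN_cases x : extremal x -> w (- x) = 0 \/ w (- x) = 1.
Proof.
move=> Xx; have x0 := extremal_neq0 Xx; case: Xx => Xx wx.
have [[] //|[_ [e|e]]] := paired_type Xx x0; rewrite wx in e.
  by case: (@natF0 1); apply: (eq_lin1 (-1) e); ring.
by case: (@natF0 2); apply: (eq_lin1 (-1) e); ring.
Qed.

Lemma extremal_symbol x : extremal x -> exists2 c, c != 0 &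
  (w (- x) = 0 /\ forall a b, P x (- x) a b = c * b) \/
  (w (- x) = 1 /\ forall a b, P x (- x) a b = c).
Proof.
move=> X2x; have [Xx wx] := X2x; have [K HK E] := paired_deg Xx; rewrite wx in E.
have [w'x|w'x] := extremal_weightN_cases X2x; rewrite w'x in E.
  have K1 : K = 1%N by apply: natF_inj; apply: (eq_lin1 1 E); ring.
  rewrite K1 in HK; have [|c c0 Hc] := deg1 Xx HK; first by rewrite wx neg2_neq0.
  exists (c * 2%:R); first by rewrite mulf_neq0 // pnatr_eq0.
  by left; split=> // a b; rewrite Hc w'x wx; ring.
have K0 : K = 0%N by apply: natF_inj; apply: (eq_lin1 1 E); ring.
by rewrite K0 in HK; have [c c0 Hc] := deg0 Xx HK; exists c => //; right.
Qed.

Lemma extremal_diff x x' : extremal x -> extremal x' -> x != x' ->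
  N x' (x - x') /\ exists k : nat,
    [/\ (k <= 1)%N, hform k (P x' (x - x')) & w (x - x') = - k%:R].
Proof.
move=> [Xx wx] X2x' ne; have [Xx' wx'] := X2x'; have [Sx _] := paired_S Xx.
have wx0 : w x != 0 by rewrite wx neg2_neq0.
have wx'0 : w x' != 0 by rewrite wx' neg2_neq0.
have wx1 : w x != 1.
  by apply/eqP => e; rewrite wx in e; apply: (@natF0 2); apply: (eq_lin1 (-1) e); ring.
have [_ N1 N2 _] := paired_nz Xx' Sx wx0 wx1.
have e : x' + (x - x') = x by ring.
have [k Hk E] := Pdeg N2; rewrite e wx wx' in E.
have [k' _ E'] := Pdeg N1; rewrite addrC in E'.
split=> //; exists k; split=> //; last by apply: (eq_lin1 (-1) E); ring.
have [K E1 K1] : exists2 K : nat, w (- x') + w (- - x') + K%:R = -1 & (K <= 1)%N.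
  by rewrite opprK wx'; have [->|->] := extremal_weightN_cases X2x';
    [exists 1%N|exists 0%N]; rewrite //; ring.
have kk : (k' + k = K.+1)%N.
  apply: (paired_deg_eq (i := - x') (j := x) (pairedN Xx') E1); rewrite [- x' + x]addrC //.
  by rewrite opprK wx wx'; exact: E.
have wz : w (x - x') = - k%:R by apply: (eq_lin1 (-1) E); ring.
case: k {E} Hk kk wz => [|[|[|k]]] // Hk kk wz; last by lia.
have wz0 : w (x - x') != 0 by rewrite wz neg2_neq0.
have H := deg2 N2 Hk isT wx'0 wz0.
by case: (@natF0 11); apply: (eq_lin3 (-1) 4%:R 4%:R H wx' wz); rewrite /=; ring.
Qed.

(** By [extremal_diff] the weights of both x - x' and x' - x are 0 or -1, whereas a nonzero paired
    index or its opposite has weight -2. So x - x' is not paired, and one term of the Jacobi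
    identity for x, - x', x' - x disappears. *)
Lemma extremal_pair_aux x x' : extremal x -> extremal x' -> x != x' ->
  [/\ ~ N (x - x') (- (x - x')), w (- x) = 1, N x (x' - x) & forall a b c d,
   P (- x') (x' - x) b c * P x (- x) a d = P x (x' - x) a c * P (- x') x' b (a + c)].
Proof.
move=> Xx Xx' ne; have ne' : x' != x by rewrite eq_sym.
have [N1 [k [k1 Hk Ek]]] := extremal_diff Xx Xx' ne.
have [N2 [l [l1 Hl El]]] := extremal_diff Xx' Xx ne'.
have NX : ~ N (x - x') (- (x - x')).
  move=> Xz; have z0 : x - x' != 0 by rewrite subr_eq0.
  rewrite -[x' - x]opprB in El.
  have [[e _]|[e _]] := paired_type Xz z0.
    rewrite Ek in e; have := oppr_inj e => /natF_inj; lia.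
  rewrite El in e; have := oppr_inj e => /natF_inj; lia.
have J a b c : P (- x') (x' - x) b c * P x (- x) a (b + c) =
    P x (x' - x) a c * P (- x') x' b (a + c).
  have := Jac x (- x') (x' - x) a b c.
  rewrite (_ : - x' + (x' - x) = - x); last by ring.
  rewrite (_ : x + (x' - x) = x'); last by ring.
  by rewrite -[x' - x]opprB (nzPn NX) mulr0 add0r.
have [c c0 Hc] := extremal_symbol Xx; have [c' c'0 Hc'] := extremal_symbol Xx'.
case: Hc => -[wx Hc]; last first.
  by split=> // a b d e; rewrite -J !Hc.
exfalso; apply: (@symbol_eq0r x (x' - x) 1 (oner_neq0 _) _ N2) => a.
have := J a (-1) 1; rewrite Hc addNr mulr0 mulr0 => /esym/eqP.
rewrite mulf_eq0 => /orP[/eqP //|]; rewrite Panti.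
by case: Hc' => -[_ ->]; rewrite ?mulrN1 ?opprK ?oppr_eq0 (negPf c'0).
Qed.

Lemma extremal_pair x x' : extremal x -> extremal x' -> x != x' ->
  [/\ w (- x) = 1, w (x' - x) = 0, N x (x' - x) & N (- x') (x' - x)].
Proof.
move=> Xx Xx' ne; have ne' : x' != x by rewrite eq_sym.
have [NX wx N1 J] := extremal_pair_aux Xx Xx' ne.
have [_ wx' N2 _] := extremal_pair_aux Xx' Xx ne'.
have [c c0 [[]|[_ Hc]]] := extremal_symbol Xx.
  by rewrite wx => /eqP; rewrite oner_eq0.
have [c' c'0 [[]|[_ Hc']]] := extremal_symbol Xx'.
  by rewrite wx' => /eqP; rewrite oner_eq0.
have {}J a b d : P (- x') (x' - x) b d * c = - (P x (x' - x) a d * c').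
  by have := J a b d 0; rewrite Hc [P (- x') x' _ _]Panti Hc' mulrN.
have [_ [k [k1 Hk Ek]]] := extremal_diff Xx' Xx ne'.
split=> //.
- case: k k1 Hk Ek => [|[|//]] _ Hk Ek; first by rewrite Ek oppr0.
  have [_ wx2] := Xx.
  have [|q q0 Hq] := deg1 N1 Hk; first by rewrite wx2 neg2_neq0.
  exfalso; have := J 0 0 0; rewrite (J 1 0 0) !Hq Ek wx2 => H.
  have H2 : q * c' = 0 by apply: (eq_lin1 1 H); ring.
  by move/eqP: H2; rewrite mulf_eq0 (negPf q0) (negPf c'0).
- have [a [b nab]] := N1; exists 0, b; apply: contraNneq nab => e.
  have := J a 0 b; rewrite e mul0r => /esym/eqP.
  by rewrite oppr_eq0 mulf_eq0 (negPf c'0) orbF => /eqP ->.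
Qed.
(** Two distinct extremal indices would thus produce a whole arithmetic progression of them, which
    [extremal_unique] refutes. *)
Lemma extremal_reflect x x' : extremal x -> extremal x' -> x != x' -> extremal (x' +
  (x' - x)).
Proof.
move=> Xx Xx' ne; have ne' : x' != x by rewrite eq_sym.
have [wx wz' N1 N2] := extremal_pair Xx Xx' ne.
have [wx' wz N3 N4] := extremal_pair Xx' Xx ne'.
have [NX _ _ _] := extremal_pair_aux Xx Xx' ne.
rewrite -[x' - x]opprB in N1 N2 wz' *; set z := x - x' in N1 N2 N3 N4 wz wz' NX *.
have e1 : z + x' = x by rewrite /z; ring.
have e2 : - z - x' = - x by rewrite /z; ring.
have [[_ N5]|[//]] := @nz_split z x' (- z) (nz_sym N3) (ltac:(rewrite e1; exact: N1)).
have [[_ N6]|[H _]] := @nz_split (- z) (- x') z (nz_sym N2) (ltac:(rewrite e2;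
  exact: N4)); last first.
  by case: NX; exact: nz_sym.
have [[_ H]|[N7 N8]] := @nz_split (- z) (- x' + z) x' N6 (ltac:(rewrite (_ : - z + _ =
  - x'); [exact: nz_sym (Xx').1 | ring])).
  by case: NX; apply: nz_sym; rewrite (_ : - x' + z + x' = z) // in H; ring.
have e3 : - z + x' = x' + - z by rewrite addrC.
have wxx : w (x' + - z) = - 2%:R.
  have [k _ E] := Pdeg (nz_sym N7); have [k' _ E'] := Pdeg N5.
  have e4 : z + (x' + - z) = x' by ring.
  rewrite e4 wz Xx'.2 add0r in E'.
  rewrite wz' addr0 Xx'.2 in E.
  have : (k + k' = 0)%N.
    by apply: natF_inj; rewrite natrD; apply: (eq_lin2 (-1) (-1) E E'); ring.
  by case: k E => // E _; rewrite E; ring.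
split=> //; rewrite /paired.
have -> : - (x' + - z) = - x' + z by ring.
by apply: nz_sym; rewrite e3 in N8.
Qed.

(** Along a progression of extremal indices with difference u, all nonzero multiples of u have
    weight 0 by [extremal_pair]; but a common multiple of x and u has weight at most -2 by
    [mul_weight]. *)
Lemma extremal_unique x x' : extremal x -> extremal x' -> x = x'.
Proof.
move=> Xx Xx'; apply/eqP; apply: contraT => ne.
pose u := x' - x; have u0 : u != 0 by rewrite subr_eq0 eq_sym.
have Xn (n : nat) : extremal (x + n%:Z * u) /\ extremal (x + n.+1%:Z * u).
  elim: n => [|n [H1 H2]].
    by rewrite mul0r addr0 mul1r /u [x + _]addrC subrK.
  split=> //; have -> : x + n.+2%:Z * u = x + n.+1%:Z * u + (x + n.+1%:Z * u - (x +
    n%:Z * u)).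
    by rewrite -addn2 -addn1 !PoszD; ring.
  apply: extremal_reflect => //; apply/eqP => /addrI /(mulIf u0); lia.
have wn (n : int) : n != 0 -> w (n * u) = 0.
  have Hne (m : nat) : x != x + m.+1%:Z * u.
    by apply/eqP => /eqP; rewrite -subr_eq0 opprD addNKr oppr_eq0 mulf_eq0 (negPf u0).
  case: n => [[//|m] _|m _].
    have [_ e _ _] := extremal_pair Xx (Xn m).2 (Hne m).
    by rewrite addrC addKr in e.
  have Hne' : x + m.+1%:Z * u != x by rewrite eq_sym.
  have [_ e _ _] := extremal_pair (Xn m).2 Xx Hne'.
  by rewrite NegzE mulNr; rewrite opprD addNKr in e.
have [_ [m Em]] := mul_weight Xx.1 Xx.2 (extremal_weightN_cases Xx) (`|u|%N.-1).
have e : (`|u|%N.-1.+1)%:Z * x = (sgz u * x) * u.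
  by rewrite prednK ?absz_gt0 // abszEsg; ring.
rewrite e wn in Em; last by rewrite mulf_neq0 ?sgz_eq0 //; exact: extremal_neq0.
by case: (@natF0 m.+1); apply: (eq_lin1 1 Em); ring.
Qed.

Lemma paired_extremal y x : paired y -> extremal x -> [\/ y = 0, y = x | y = - x].
Proof.
move=> Xy Xx; have [->|y0] := eqVneq y 0; first exact: Or31.
have [[wy _]|[wy _]] := paired_type Xy y0.
  by apply: Or32; exact: extremal_unique.
by apply: Or33; rewrite -(@extremal_unique (- y) x) ?opprK //; split=> //; exact: pairedN.
Qed.

Lemma extremal_ex : exists x, extremal x.
Proof.
have [x x0 Xx] := paired_ex; have [[wx _]|[wx _]] := paired_type Xx x0; first by exists x.
by exists (- x); split=> //; exact: pairedN.
Qed.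

(** A paired l is 0, x or - x. For 0 and - x the bracket is one with L_0, whose symbol b + a
    vanishes at (a, - a) in weight 1. For l = x the weight of j is 3, and the Jacobi identity for x,
    - x, - x gives a vanishing product of nonzero symbols. *)
Lemma extremal_weightN_aux x j l a : extremal x -> w (- x) = 1 -> j + l = - x ->
  P j l a (- a) != 0 -> paired l -> False.
Proof.
move=> Xx w'x jl Pa Xl; have [X'x wx] := Xx; have [Sx S'x] := paired_S X'x.
have Njl : N j l by exists a, (- a).
have [l0|lx|lx] := paired_extremal Xl Xx.
- have j' : j = - x by rewrite -jl l0 addr0.
  by rewrite l0 j' symbol_r0 // w'x mul1r subrr oppr0 eqxx in Pa.
- have [k Hk E] := Pdeg Njl.
  have wjl : w (j + l) = 1 by rewrite jl.
  have [[_ E']|[_ _ E']] := weight1_cases Njl Hk E wjl Pa; last first.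
    by apply: (@natF0 1); rewrite lx wx in E'; apply: (eq_lin1 (-1) E'); ring.
  have wj : w j = 3%:R by rewrite lx wx in E'; apply: (eq_lin1 1 E'); ring.
  have [Sj _ _] := PS Njl.
  have wj0 : w j != 0 by rewrite wj pnatr_eq0.
  have wj1 : w j != 1.
    by apply/eqP => H; rewrite wj in H; apply: (@natF0 1); apply: (eq_lin1 1 H); ring.
  have [_ _ _ N1] := paired_nz X'x Sj wj0 wj1.
  have j' : j = - x - x by apply: (addIr x); rewrite subrK -jl lx.
  have e : x + j = - x by rewrite j'; ring.
  rewrite e in N1; rewrite lx j' in Njl.
  have [c c0 [[]|[_ Hc]]] := extremal_symbol Xx.
    by rewrite w'x => /eqP; rewrite oner_eq0.
  apply: (nz_mul _ N1 Njl) => p q s.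
  have := Jac x (- x) (- x) s p q; rewrite subrr !Hc P0 // symbol_r0 // w'x.
  rewrite [P x _ _ _]Panti => H.
  by apply: (eq_lin1 (-1) H); ring.
- have j' : j = 0 by apply: (addIr l); rewrite jl lx add0r.
  by rewrite j' lx P0 // w'x mul1r addNr eqxx in Pa.
Qed.

(** If the weight were 1, [perfect] would give a bracket of j and l into - x; continuing it by x to
    degree 0 makes j or l paired by [nz_split]. *)
Lemma extremal_weightN x : extremal x -> w (- x) = 0.
Proof.
move=> Xx; have [//|w'x] := extremal_weightN_cases Xx; exfalso.
have [X'x wx] := Xx; have [Sx S'x] := paired_S X'x.
have [j [l [a [jl Pa]]]] := perfect S'x w'x.
have Njl : N j l by exists a, (- a).
have [[N1 N2]|[N1 N2]] := @nz_split j l x Njl (ltac:(rewrite jl; exact: nz_sym)).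
  have e : l + x = - j by apply: (addIr (- x)); rewrite addrK -jl; ring.
  rewrite e in N2.
  have Pa' : P l j (- a) (- - a) != 0 by rewrite Panti opprK oppr_eq0.
  by apply: (extremal_weightN_aux Xx w'x _ Pa' N2); rewrite addrC.
have e : j + x = - l by apply: (addIr (- x)); rewrite addrK -jl; ring.
rewrite e in N2.
by apply: (extremal_weightN_aux Xx w'x jl Pa N2).
Qed.

(** * The half-line generated by the extremal index *)

Section CartanType.
Variable x : int.
Hypothesis Xx : extremal x.
Let A (i : int) := exists n : nat, i = (n%:Z - 1) * x.

Lemma paired_A i : paired i -> A i.
Proof.
move=> Xi; have [->|->|->] := paired_extremal Xi Xx.
- by exists 1%N; rewrite subrr mul0r.
- by exists 2; rewrite mul1r.
- by exists 0%N; rewrite mulN1r.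
Qed.

Lemma symbol_x : exists2 c, c != 0 & forall a b, P x (- x) a b = c * b.
Proof.
have [c c0 [[_ H]|[H _]]] := extremal_symbol Xx; first by exists c.
by rewrite extremal_weightN // in H; move/eqP: H; rewrite eq_sym oner_eq0.
Qed.

Lemma nz_mx (n : nat) : N (- x) (n.+1%:Z * x).
Proof.
have [Sn [m Em]] := mul_weight Xx.1 Xx.2 (extremal_weightN_cases Xx) n.
have [] // := paired_nz Xx.1 Sn; rewrite Em; first by rewrite oppr_eq0 pnatr_eq0.
by apply/eqP => H; apply: (@natF0 m.+2); apply: (eq_lin1 (-1) H); ring.
Qed.

(** Induction on n: bracketing with - x pushes a bracket into (n - 1) x down by one step, and a
    bracket into 0 means a paired index. The target - x, at the bottom, is instead brought back to 0
    by x. *)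
Lemma not_reach (n : nat) : forall i t, ~ A i -> N i t ->
  i + t = (n%:Z - 1) * x -> False.
Proof.
have [Xx1 _] := Xx.
elim: n => [|n IH] i t Ai Nit.
  rewrite sub0r mulN1r => E.
  have [[_ H]|[H1 H2]] := @nz_split i t x Nit (ltac:(rewrite E; exact: nz_sym)).
    apply: Ai; apply: paired_A; rewrite /paired (_ : - i = t + x) //.
    by apply: (addIr (- x)); rewrite addrK -E; ring.
  have e : t = - (i + x) by apply: (addrI i); rewrite E; ring.
  have Xix : paired (i + x) by apply: nz_sym; rewrite -e.
  have [e1|e1|e1] := paired_extremal Xix Xx.
  - by apply: Ai; exists 0%N; rewrite sub0r mulN1r; apply: (addIr x); rewrite e1 addNr.
  - by apply: Ai; exists 1%N; rewrite subrr mul0r; apply: (addIr x); rewrite e1 add0r.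
  (* Left is the case i = - 2x, t = x. At (s, 1 - s, - s) the Jacobi identity for i, x, x keeps only
     [P i x s (1 - s)] times a nonzero constant, since [P x (- x)] vanishes when its second argument
     does. *)
  have ix : i = - x - x by apply: (addIr x); rewrite e1; ring.
  have tx : t = x by rewrite e e1 opprK.
  have nX : ~ N i (x + x).
    have -> : x + x = - i by rewrite ix; ring.
    by move=> /paired_A.
  have [c c0 Hc] := symbol_x.
  rewrite tx in Nit.
  apply: (symbol_eq0s (oner_neq0 F) _ Nit) => s.
  have := Jac i x x s (1 - s) (- s).
  rewrite (nzPn nX) e1 subrr mulr0 Hc [s + _]addrC subrK [P (- x) x _ _]Panti Hc => H.
  by apply: (mulIf c0); apply: (eq_lin1 1 H); ring.
case: n IH => [_|n IH] E.
  rewrite subrr mul0r in E; apply: Ai; apply: paired_A; rewrite /paired (_ : - i = t) //.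
  by apply: (addrI i); rewrite E subrr.
have e : (n.+2%:Z - 1) * x = n.+1%:Z * x by rewrite -addn1 PoszD addrK.
have e' y : y = n.+1%:Z * x -> y - x = (n.+1%:Z - 1) * x.
  by move=> ->; ring.
rewrite e in E.
have [[_ H]|[_ H]] := @nz_split i t (- x) Nit (ltac:(rewrite E; exact: nz_sym (nz_mx n))).
  by apply: (IH _ _ Ai H); rewrite addrA; exact: e'.
apply: (IH (i - x) t _ (nz_sym H)); last by rewrite -(e' (i + t)) //; ring.
move=> [m Em]; apply: Ai; exists m.+1.
by apply: (addIr (- x)); rewrite Em -addn1 PoszD; ring.
Qed.

Lemma S_A i : S i -> A i.
Proof.
move=> Si; apply: contrapT => Ai.
suff [_ []] : S 0 /\ ~ A 0 by exists 1%N; rewrite subrr mul0r.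
apply: (@simple (fun i => S i /\ ~ A i)) => //; first by exists i.
move=> r t [Sr Ar] Nrt; split; first by case/PS: Nrt.
by move=> [n En]; apply: (not_reach Ar Nrt En).
Qed.

Lemma A_S i : A i -> S i.
Proof.
move=> [[|[|n]] ->].
- by rewrite sub0r mulN1r; case: (paired_S Xx.1).
- by rewrite subrr mul0r.
- rewrite (_ : n.+2%:Z - 1 = n.+1%:Z); last by rewrite -addn1 PoszD addrK.
  by case: (mul_weight Xx.1 Xx.2 (extremal_weightN_cases Xx) n).
Qed.

(** As - 2x is outside S, the Jacobi identity for y = (n + 2) x, - x, - x has one term less and
    shows that [P y (- x)] is linear in its second argument. [cov_lead] then excludes degrees above
    one. *)
Lemma weight_A_step (n : nat) : w (n.+1%:Z * x) = - n.+2%:R /\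
  exists2 c, c != 0 & forall a b, P (n.+1%:Z * x) (- x) a b = c * b.
Proof.
elim: n => [|n [wn [c c0 Hc]]]; first by rewrite mul1r Xx.2; split=> //; exact: symbol_x.
set y := n.+2%:Z * x.
have e : y + - x = n.+1%:Z * x by rewrite /y intS; ring.
have nS : ~ N (- x) (- x).
  case/PS=> _ _ /S_A[m Em]; have := extremal_neq0 Xx.
  have : (m%:Z + 1) * x = 0.
    by rewrite (_ : (m%:Z + 1) * x = (m%:Z - 1) * x - (- x - x)); [rewrite Em subrr | ring].
  by move/eqP; rewrite mulf_eq0 => /orP[|->] //; rewrite -PoszD; lia.
have f a b : P y (- x) a b = P y (- x) a 1 * b.
  have := Jac y (- x) (- x) a b 1; rewrite (nzPn nS) e Hc.
  rewrite [P (- x) _ _ _]Panti Hc => H.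
  by apply: (mulIf c0); apply: (eq_lin1 (-1) H); ring.
have Ny := nz_mx n.+1; rewrite -/y in Ny.
have [_ [m Em]] := mul_weight Xx.1 Xx.2 (extremal_weightN_cases Xx) n.+1; rewrite -/y in Em.
have wy0 : w y != 0 by rewrite Em oppr_eq0 pnatr_eq0.
have [k Hk E] := Pdeg Ny.
have k1 : k = 1%N.
  case: k Hk E => [|k] Hk E.
    case: Ny => a [b]; rewrite (hform0 Hk a b 0 b) Panti f mulr0 oppr0 eqxx //.
  have [g [Hg g1 [a [b gab]] g2]] := deg_div Ny Hk (extremal_weightN Xx) wy0.
  case: k Hk E Hg => // k Hk E Hg; exfalso.
  have gE s t : g s t = g 1 t.
    move: s; apply: (ispoly_eq (ispoly_hform Hg ispoly_id (ispoly_cst t)) (ispoly_cst _)).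
    move=> s s0; apply: (mulfI s0); rewrite -g1 Panti f.
    by have := g1 1 t; rewrite Panti f mul1r => <-; ring.
  have g0 s : g s 0 = 0.
    have := hformZ 2%:R 1 0 Hg; rewrite mulr0 !gE => /eqP.
    rewrite -subr_eq0 -{1}[g 1 0]mul1r -mulrBl mulf_eq0 => /orP[|/eqP //].
    rewrite subr_eq0 eq_sym -natrX -[1]/(1%:R) eqr_nat.
    by rewrite expnS; have := expn_gt0 2 k; lia.
  have := cov_lead Hg g2; rewrite g0 mulr0 add0r => /eqP.
  rewrite mulf_eq0 (negPf wy0) gE /= => /eqP g11.
  case/eqP: gab; rewrite gE; have [->|b0] := eqVneq b 0; first exact: g0.
  by rewrite -(gE b) -[b in g b b]mulr1 (hformZ _ _ _ Hg) g11 mulr0.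
rewrite {}k1 in Hk E.
have wy : w y = - n.+3%:R.
  rewrite addrC e wn extremal_weightN // add0r in E.
  by apply: (eq_lin1 (-1) E); ring.
split=> //.
have [|q q0 Hq] := deg1 Ny Hk; first by rewrite wy0 orbT.
exists (- q * w y) => [|a b]; first by rewrite mulf_neq0 // oppr_eq0.
by rewrite Panti Hq extremal_weightN //; ring.
Qed.

Lemma weight_A (n : nat) : w ((n%:Z - 1) * x) = - n%:R.
Proof.
case: n => [|[|n]].
- by rewrite sub0r mulN1r extremal_weightN // oppr0.
- by rewrite subrr mul0r w0.
- rewrite (_ : n.+2%:Z - 1 = n.+1%:Z); last by rewrite -addn1 PoszD addrK.
  by have [-> _] := weight_A_step n.
Qed.
End CartanType.

Lemma cartan_case : exists x, [/\ x != 0,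
  forall i, S i <-> exists n : nat, i = (n%:Z - 1) * x,
  forall n : nat, w ((n%:Z - 1) * x) = - n%:R &
  forall n : nat, N (- x) (n.+1%:Z * x)].
Proof.
have [x Xx] := extremal_ex; exists x; split.
- exact: extremal_neq0.
- by move=> i; split; [exact: S_A | exact: A_S].
- exact: weight_A.
- exact: nz_mx.
Qed.
End NoLine.

(** * Structure constants on the half-line *)

Section CartanConstants.
Variable x : int.
Hypotheses (x0 : x != 0) (Sx : forall i, S i <-> exists n : nat, i = (n%:Z - 1) * x)
  (wx : forall n : nat, w ((n%:Z - 1) * x) = - n%:R)
  (Nx : forall n : nat, N (- x) (n.+1%:Z * x)).
Let v (n : int) : F := - 1 - n%:~R.
Let Q (m n : int) := P (m * x) (n * x).

Lemma cartan_S (m : int) : -1 <= m -> S (m * x).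
Proof.
by move=> m1; apply/Sx; exists (absz (m + 1)); congr (_ * _); lia.
Qed.

Lemma cartan_w (m : int) : -1 <= m -> w (m * x) = v m.
Proof.
move=> m1; have -> : m = (absz (m + 1))%:Z - 1 by lia.
by rewrite wx /v rmorphB /=; ring.
Qed.

Lemma cartan_form (m n : int) : -1 <= m -> -1 <= n -> exists c, forall a b,
  Q m n a b = c * (v n * a - v m * b).
Proof.
move=> m1 n1; have [Nmn|H] := pselect (N (m * x) (n * x)); last first.
  by exists 0 => a b; rewrite /Q (nzPn H); ring.
have [_ _] := PS Nmn; rewrite -mulrDl => /Sx[k /(mulIf x0) Ek].
have mn : -1 <= m + n by lia.
have [q Hq E] := Pdeg Nmn; rewrite -mulrDl !cartan_w // in E.
have q1 : q = 1%N.
  by apply: natF_inj; apply: (eq_lin1 (-1) E); rewrite /v rmorphD /=; ring.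
rewrite q1 in Hq; have [|c _ Hc] := deg1 Nmn Hq; last first.
  by exists c => a b; rewrite /Q Hc !cartan_w.
rewrite !cartan_w // /v -negb_and; apply/negP => /andP[/eqP v1 /eqP v2].
have e y : - 1 - y%:~R = 0 :> F -> y = -1.
  move=> H; apply/eqP; rewrite -(eqr_int F); apply/eqP.
  by apply: (eq_lin1 (-1) H); rewrite rmorphN /=; ring.
by move: mn; rewrite (e _ v1) (e _ v2).
Qed.

(** Rescaling makes the constants of brackets with -1 equal to 1; the Jacobi identity for -1, n, p
    then gives C(n, p) = C(n - 1, p), and induction reaches all pairs. For the pair (-1, -1) both
    sides are 0. *)
Lemma cartan_normal : exists mu : int -> F, [/\ forall n, mu n != 0, mu 0 = 1 &
  forall (m n : int) a b, -1 <= m -> -1 <= n ->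
    mu m * mu n * Q m n a b = mu (m + n) * (v n * a - v m * b)].
Proof.
have /choice[c' Hc'] : forall mn : int * int, exists c, -1 <= mn.1 -> -1 <= mn.2 ->
    forall a b, Q mn.1 mn.2 a b = c * (v mn.2 * a - v mn.1 * b).
  move=> [m n]; have [/andP[m1 n1]|H] := boolP ((-1 <= m) && (-1 <= n)).
    by have [c Hc] := cartan_form m1 n1; exists c.
  by exists 0 => /= m1 n1; rewrite m1 n1 in H.
pose c (m n : int) := c' (m, n).
have Hc (m n : int) : -1 <= m -> -1 <= n -> forall a b,
  Q m n a b = c m n * (v n * a - v m * b).
  by move=> m1 n1 a b; rewrite (Hc' (m, n)).
have vN1 : v (-1) = 0 by rewrite /v rmorphN /=; ring.
have v0 (n : int) : 0 <= n -> v n != 0.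
  move=> n0; rewrite /v -opprD oppr_eq0 -[1]/(1%:~R) -rmorphD intr_eq0; lia.
have c0 (n : int) : -1 <= n -> c 0 n = 1.
  move=> n1; have := Hc 0 n isT n1 0 1; rewrite /Q mul0r P0; last exact: cartan_S.
  by rewrite /v => H; apply: (eq_lin1 (-1) H); ring.
have cs (m n : int) : -1 <= m -> -1 <= n -> (0 <= m) || (0 <= n) -> c m n = c n m.
  move=> m1 n1 mn.
  have E a b : (c m n - c n m) * (v n * a - v m * b) = 0.
    by have := Hc m n m1 n1 a b; rewrite /Q Panti -/(Q n m b a) Hc // => H;
      apply: (eq_lin1 (-1) H); ring.
  apply/eqP; rewrite -subr_eq0; apply/eqP; case/orP: mn => /v0 nz0.
    by apply: (mulIf nz0); apply: (eq_lin1 (-1) (E 0 1)); ring.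
  by apply: (mulIf nz0); apply: (eq_lin1 1 (E 1 0)); ring.
have cn (n : nat) : c (-1) n != 0.
  case: n => [|n]; first by rewrite cs // c0 // oner_eq0.
  apply/eqP => H; have [a [b]] := Nx n.
  have := Hc (-1) n.+1 isT isT a b; rewrite /Q mulN1r => ->.
  by rewrite H mul0r eqxx.
(* [mu] is solved recursively from the constants [c (-1) n]. On negative indices it is set to 1:
   this normalizes -1, and the value at -2 only occurs multiplied by 0. *)
have [mu [mu_n mu0 muN1 muS]] : exists mu : int -> F, [/\ forall n, mu n != 0,
  mu 0 = 1, mu (-1) = 1 &
    forall n : nat, mu n.+1 * c (-1) n.+1 = mu n].
  pose f := fix f (n : nat) : F := if n is n'.+1 then f n' / c (-1) n'.+1 else 1.
  exists (fun n : int => if n is Posz n' then f n' else 1); split=> //.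
    case=> [|n] /=; last exact: oner_neq0.
    by elim=> [|n IH] /=; rewrite ?oner_eq0 // mulf_neq0 // invr_eq0.
  by move=> n /=; rewrite divfK.
pose C (m n : int) := mu m * mu n * c m n / mu (m + n).
have C1 (n : nat) : C (-1) n = 1.
  rewrite /C muN1 mul1r; case: n => [|n].
    by rewrite addr0 muN1 divr1 mu0 mul1r cs // c0.
  by rewrite (_ : -1 + n.+1%:Z = n) ?muS ?divff //; lia.
have J (n p : nat) : C n p = C (n%:Z - 1) p.
  pose A a b y := (c n p * c (-1) (n%:Z + p)) * ((v p * b - v n * y) * v (n%:Z + p) * a) -
     ((c (-1) n * c (n%:Z - 1) p) * (v n * a * (v p * (a + b) - v (n%:Z - 1) * y)) +
     (c (-1) p * c n (p%:Z - 1)) * (v p * a * (v (p%:Z - 1) * b - v n * (a + y)))).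
  have A0 a b y : A a b y = 0.
    have := Jac (-1 * x) (n%:Z * x) (p%:Z * x) a b y.
    rewrite -!mulrDl -!/(Q _ _ _ _) !Hc //; try lia.
    rewrite vN1 [-1 + n%:Z]addrC [-1 + p%:Z]addrC => H.
    by rewrite /A; apply: (eq_lin1 1 H); ring.
  have vn := v0 n isT; have vp := v0 p isT; have vnp := v0 (n%:Z + p) isT.
  have e1 : c (-1) n * c (n%:Z - 1) p = c (-1) p * c n (p%:Z - 1).
    apply: (mulIf vn); apply: (mulIf vp).
    by apply: (eq_lin2 (- 2%:R^-1) (- 2%:R^-1) (A0 1 0 0) (A0 (-1) 0 0)); rewrite /A; field.
  have e2 : c n p * c (-1) (n%:Z + p) = c (-1) n * c (n%:Z - 1) p.
    apply: (mulIf vp); apply: (mulIf vnp).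
    have ve : v (n%:Z + p) = v n + v (p%:Z - 1) by rewrite /v !rmorphB !rmorphD /=; ring.
    by apply: (eq_lin3 1 (-1) (- (v p * v (p%:Z - 1))) (A0 1 1 0) (A0 1 0 0) e1);
      rewrite /A ve; ring.
  have E1 := C1 n; have E2 := C1 (n + p)%N; rewrite /C muN1 !mul1r in E1 E2.
  rewrite [-1 + _]addrC in E1; rewrite [-1 + _]addrC in E2.
  have {}E1 : mu n * c (-1) n = mu (n%:Z - 1) by rewrite -[RHS]mul1r -E1 divfK.
  have {}E2 : mu (n%:Z + p) * c (-1) (n%:Z + p) = mu ((n + p)%N%:Z - 1).
    by rewrite -PoszD -[RHS]mul1r -E2 divfK.
  have e3 : n%:Z - 1 + p = (n + p)%N%:Z - 1 by rewrite PoszD; ring.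
  rewrite /C e3 -E1 -E2.
  have m1 := mu_n (n%:Z + p).
  have c1 := cn (n + p)%N.
  apply: (mulIf c1); rewrite PoszD.
  transitivity (mu n * mu p * (c n p * c (-1) (n%:Z + p)) / mu (n%:Z + p)); first by field.
  by rewrite e2; field; rewrite m1 -PoszD c1.
have Cnp (n p : nat) : C (n%:Z - 1) p = 1.
  elim: n => [|n IH]; first by rewrite sub0r C1.
  by rewrite -addn1 PoszD addrK J.
have key (m n : int) a b : -1 <= m -> 0 <= n ->
    mu m * mu n * Q m n a b = mu (m + n) * (v n * a - v m * b).
  move=> m1 n0; have := Cnp (absz (m + 1)) `|n|%N.
  rewrite (_ : (absz (m + 1))%:Z - 1 = m); last by lia.
  rewrite (_ : `|n|%N%:Z = n); last by lia.
  rewrite /C => E; rewrite Hc //; last by lia.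
  have m3 := mu_n (m + n).
  have {}E : mu m * mu n * c m n = mu (m + n) by rewrite -[RHS]mul1r -E divfK.
  by rewrite -E; ring.
exists mu; split=> // m n a b m1 n1.
have [n0|n0] := boolP (0 <= n); first exact: key.
have [m0|m0] := boolP (0 <= m).
  by rewrite /Q Panti mulrN [mu m * _]mulrC [m + n]addrC -/(Q n m b a) key //; ring.
have -> : m = -1 by lia.
have -> : n = -1 by lia.
rewrite vN1 Hc // vN1; ring.
Qed.
End CartanConstants.

(** * Structure constants on a line *)

Section LineConstants.
Variables (eta : F) (g : int).
Let th := g%:~R * eta.
Hypotheses (g0 : g != 0) (Sg : forall i, S i <-> exists n : int, i = n * g)
  (th1 : th != 1) (Ng : forall n : int, N g (n * g))
  (wE : forall j, S j ->
    w j = if j%:~R * eta == 2%:R then 0 else j%:~R * eta - 1).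
Let v (n : int) : F := n%:~R * th - 1.
Let exc (n : int) := n%:~R * th == 2%:R.
(** Where weight 0 stands in for weight 1, this is the symbol a of d : F_0 -> F_1. Once sources and
    target are composed with these maps, a single formula, that of the Poisson bracket for the
    weights [v], covers all cases. *)
Let T (n : int) (a : F) := if exc n then a else 1.
Let Q (m n : int) := P (m * g) (n * g).

Lemma line_w (n : int) : w (n * g) = if exc n then 0 else v n.
Proof.
by rewrite wE; [rewrite rmorphM /= -mulrA | apply/Sg; exists n].
Qed.

Lemma line_vD (m n : int) : v (m + n) = v m + v n + 1.
Proof. by rewrite /v rmorphD /=; ring. Qed.

Lemma excE (n : int) : exc n = (v n == 1).
Proof. by rewrite /exc /v subr_eq. Qed.

Lemma exc_inj (m n : int) : m%:~R * th = n%:~R * th -> m%:~R * th != 0 -> m = n.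
Proof.
move=> E; rewrite mulf_eq0 negb_or => /andP[_ t0].
by apply/eqP; rewrite -(eqr_int F); apply/eqP; apply: (mulIf t0).
Qed.

Lemma T_neq0 (n : int) a : a != 0 -> T n a != 0.
Proof. by rewrite /T; case: exc; rewrite ?oner_eq0. Qed.

(** For m != 0 the degree is 2. Division by the variable of the source of weight 0 leaves a Poisson
    bracket; if the other weight is also 0, covariance makes the symbol vanish on both axes, which
    leaves a b. *)
Lemma line_form_excr (m n : int) : ~~ exc m -> exc n -> N (m * g) (n * g) ->
  exists2 c, c != 0 & forall a b,
    Q m n a b * T (m + n) (a + b) = c * T m a * T n b * (v n * a - v m * b).
Proof.
move=> em en Nmn; have /eqP vn : v n == 1 by rewrite -excE.
rewrite /T en (negPf em).
have thn0 : n%:~R * th != 0 by rewrite (eqP en) pnatr_eq0.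
have [Sm Sn _] := PS Nmn.
have wn : w (n * g) = 0 by rewrite line_w en.
have wm : w (m * g) = v m by rewrite line_w (negPf em).
have [/eqP m0|m0] := boolP (m == 0).
  exists 1 => [|a b]; first exact: oner_neq0.
  rewrite m0 add0r en /Q mul0r P0 // wn vn /v mul0r; ring.
have emn : ~~ exc (m + n).
  apply: contra m0 => /eqP H; rewrite -(addrK n m) subr_eq0.
  by apply/eqP; apply: exc_inj; rewrite ?H ?pnatr_eq0 // (eqP en).
rewrite (negPf emn).
have [k Hk E] := Pdeg Nmn; rewrite -mulrDl line_w (negPf emn) wm wn line_vD vn in E.
have k2 : k = 2 by apply: natF_inj; apply: (eq_lin1 (-1) E); ring.
rewrite {}k2 in Hk E.
have [vm|vm] := eqVneq (v m) 0; last first.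
  have Hk' : hform 2 (P (n * g) (m * g)).
    have [c Hc] := hform_swap Hk; exists (fun r => - c r) => a b.
    by rewrite Panti Hc -sumrN; apply: eq_bigr => r _; ring.
  have [|f [f1 f2 [x [y fxy]] f4]] := deg_div (nz_sym Nmn) Hk' wn; first by rewrite wm.
  have [|c Hc] := cov1 f1 f4; first by rewrite oner_eq0.
  exists c => [|a b]; last by rewrite /Q Panti f2 Hc wm vn; ring.
  by apply: contraNneq fxy => c0; rewrite Hc c0 mul0r.
have Hcov := symbol_cov Nmn; rewrite wm vm wn -mulrDl line_w (negPf emn) line_vD vm vn
  in Hcov.
have H1 a : P (m * g) (n * g) a 0 = 0.
  have H2 : P (m * g) (n * g) 0 0 = 0 := hform00 Hk.
  have := Hcov (- a) a 0; rewrite addNr H2 => H.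
  have [->//|a0] := eqVneq a 0.
  by apply: (mulfI a0); apply: (eq_lin1 (-1) H); ring.
have H2 b : P (m * g) (n * g) 0 b = 0.
  have H2 : P (m * g) (n * g) 0 0 = 0 := hform00 Hk.
  have := Hcov (- b) 0 b; rewrite addNr H2 => H.
  have [->//|b0] := eqVneq b 0.
  by apply: (mulfI b0); apply: (eq_lin1 (-1) H); ring.
have [f Hf Ef] := hform_axes Hk H1 H2.
exists (f 0 0) => [|a b]; last by rewrite /Q Ef (hform0 Hf a b 0 0) vn vm; ring.
have [a [b nab]] := Nmn; apply: contraNneq nab => f0.
by rewrite Ef (hform0 Hf a b 0 0) f0 mulr0.
Qed.

(** The weights give the degree: 1 when no exceptional index is involved, 0 if only the target is
    exceptional, 2 or 3 if one or both sources are (m or n zero aside). Two exceptional sources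
    coincide, and antisymmetry leaves a b (a - b). *)
Lemma line_form (m n : int) : exists c,
  (N (m * g) (n * g) -> c = 0 -> v m = 0 /\ v n = 0) /\ forall a b,
    Q m n a b * T (m + n) (a + b) = c * T m a * T n b * (v n * a - v m * b).
Proof.
have [Nmn|H] := pselect (N (m * g) (n * g)); last first.
  by exists 0; split=> // a b; rewrite /Q (nzPn H); ring.
have [em|em] := boolP (exc m); have [en|en] := boolP (exc n); last first.
- have [k Hk E] := Pdeg Nmn.
  rewrite -mulrDl !line_w (negPf em) (negPf en) line_vD in E.
  have [emn|emn] := boolP (exc (m + n)); rewrite ?emn ?(negPf emn) in E.
    have vmn : v m + v n = 0.
      have := emn; rewrite excE line_vD => /eqP H; apply: (eq_lin1 1 H); ring.
    have k0 : k = 0%N.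
      by apply: natF_inj; apply: (eq_lin2 (-1) (-1) E vmn); ring.
    rewrite {}k0 in Hk; have [c c0 Hc] := deg0 Nmn Hk.
    have vn : v n != 0.
      apply/eqP => vn; have vm : v m = 0 by rewrite vn addr0 in vmn.
      have mn : m = n.
        apply: exc_inj; first by apply: (eq_lin2 1 (-1) vm vn); rewrite /v; ring.
        have -> : m%:~R * th = 1 by apply: (eq_lin1 1 vm); rewrite /v; ring.
        exact: oner_neq0.
      by rewrite mn in Nmn Hk; case/eqP: (diag_deg_neq0 Nmn Hk).
    exists (c / v n); split.
      by move=> _ /eqP; rewrite mulf_eq0 invr_eq0 (negPf c0) (negPf vn).
    move=> a b; rewrite /Q Hc /T emn (negPf em) (negPf en).
    have -> : v m = - v n by apply: (eq_lin1 1 vmn); ring.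
    by field.
  have k1 : k = 1%N by apply: natF_inj; apply: (eq_lin1 (-1) E); ring.
  rewrite {}k1 in Hk; have wm : w (m * g) = v m by rewrite line_w (negPf em).
  have wn : w (n * g) = v n by rewrite line_w (negPf en).
  have [|c c0 Hc] := deg1 Nmn Hk.
    rewrite wm wn -negb_and; apply/negP => /andP[/eqP vm /eqP vn].
    by rewrite excE line_vD vm vn addr0 add0r eqxx in emn.
  exists c; split; first by move=> _ /eqP; rewrite (negPf c0).
  by move=> a b; rewrite /Q Hc wm wn /T (negPf emn) (negPf em) (negPf en); ring.
- have [c c0 Hc] := line_form_excr em en Nmn; exists c; split=> //.
  by move=> _ /eqP; rewrite (negPf c0).
- have [c c0 Hc] := line_form_excr en em (nz_sym Nmn); exists c; split.
    by move=> _ /eqP; rewrite (negPf c0).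
  move=> a b; rewrite /Q Panti mulNr [m + n]addrC [a + b]addrC Hc; ring.
have mn : m = n.
  by apply: exc_inj; rewrite (eqP em) ?(eqP en) // pnatr_eq0.
rewrite {}mn in Nmn em *; have /eqP vn : v n == 1 by rewrite -excE.
have enn : ~~ exc (n + n).
  rewrite excE line_vD vn; apply/eqP => H; apply: (@natF0 1).
  by apply: (eq_lin1 1 H); ring.
have [k Hk E] := Pdeg Nmn.
rewrite -mulrDl !line_w (negPf enn) en line_vD vn in E.
have k3 : k = 3 by apply: natF_inj; apply: (eq_lin1 (-1) E); ring.
rewrite {}k3 in Hk.
have Hcov := symbol_cov Nmn; rewrite -mulrDl !line_w (negPf enn) en line_vD vn in Hcov.
have H1 a : P (n * g) (n * g) a 0 = 0.
  have H2 : P (n * g) (n * g) 0 0 = 0 := hform00 Hk.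
  have := Hcov (- a) a 0; rewrite addNr H2 => H.
  have [->//|a0] := eqVneq a 0.
  have a20 : a * 2%:R != 0 by rewrite mulf_neq0 // pnatr_eq0.
  by apply: (mulfI a20); apply: (eq_lin1 (-1) H); ring.
have H2 b : P (n * g) (n * g) 0 b = 0 by rewrite Panti H1 oppr0.
have [f Hf Ef] := hform_axes Hk H1 H2.
have fE a b : a != 0 -> b != 0 -> f a b = - f b a.
  move=> a0 b0; apply: (mulfI (mulf_neq0 a0 b0)).
  by have := Panti (n * g) (n * g) a b; rewrite !Ef => H; apply: (eq_lin1 1 H); ring.
have f01 : f 0 1 = - f 1 0.
  have := fE 1 1 (oner_neq0 _) (oner_neq0 _); rewrite (hform1 Hf 1 1) !mulr1 => H.
  apply: (mulfI (_ : 2%:R != 0 :> F)); first by rewrite pnatr_eq0.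
  by apply: (eq_lin1 1 H); ring.
exists (f 1 0); split.
  have [a [b nab]] := Nmn => _ f0; case/eqP: nab.
  by rewrite Ef (hform1 Hf a b) f01 f0; ring.
by move=> a b; rewrite /Q Ef (hform1 Hf a b) f01 /T em (negPf enn) vn; ring.
Qed.

(** Brackets with index 1 are normalized; the Jacobi identity for 1, n, p gives C(1 + n, p) = C(n,
    p) if v p != 0. For v n = 0 the roles are exchanged by antisymmetry, and if v m = v n = 0 both
    sides vanish. *)
Lemma line_normal : exists mu : int -> F, [/\ forall n, mu n != 0, mu 0 = 1 &
  forall (m n : int) a b, mu m * mu n * Q m n a b * T (m + n) (a + b) =
    mu (m + n) * T m a * T n b * (v n * a - v m * b)].
Proof.
have /choice[c' Hc'] := fun mn : int * int => line_form mn.1 mn.2.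
pose c (m n : int) := c' (m, n).
have Hc m n a b : Q m n a b * T (m + n) (a + b) = c m n * T m a * T n b * (v n * a - v
  m * b).
  by have [_ ->] := Hc' (m, n).
have cn (n : int) : c 1 n != 0.
  apply/eqP => H; have [/(_ _ H)[]] := Hc' (1, n); rewrite /= ?mul1r //.
  by move/eqP; rewrite /v mul1r subr_eq0 (negPf th1).
have exc0 : exc 0 = false by apply/eqP; rewrite mul0r => /esym/eqP; rewrite pnatr_eq0.
have c0 n : c 0 n = 1.
  have := Hc 0 n 0 1; rewrite /Q mul0r P0; last by apply/Sg; exists n.
  rewrite add0r add0r /v /T exc0 => H.
  by case: (exc n) H => H; apply: (eq_lin1 (-1) H); ring.
have c10 : c 1 0 = 1.
  have := Hc 1 0 1 0.
  rewrite /Q mul0r symbol_r0; last by apply/Sg; exists 1.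
  have T11 : T 1 1 = 1 by rewrite /T; case: exc.
  rewrite !addr0 T11 /T exc0 /v mul0r => H.
  by apply: (eq_lin1 1 H); ring.
have term m n p a b y :
  Q n p b y * Q m (n + p) a (b + y) * T (m + n + p) (a + b + y) =
  T m a * T n b * T p y * (c m (n + p) * c n p *
    ((v p * b - v n * y) * (v (n + p) * a - v m * (b + y)))).
  have H1 := Hc m (n + p) a (b + y); have H2 := Hc n p b y.
  rewrite !addrA in H1.
  by apply: (eq_lin2 (Q n p b y) (c m (n + p) * T m a * (v (n + p) * a - v m * (b +
    y))) H1 H2); ring.
have J n p : v p != 0 -> c 1 n * c (1 + n) p = c 1 (n + p) * c n p.
  move=> vp.
  have E b : b != 0 -> c 1 (n + p) * c n p *
      ((v p * b - v n * 1) * (v (n + p) * 1 - v 1 * (b + 1))) =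
    c 1 n * c (1 + n) p * ((v n * 1 - v 1 * b) * (v p * (1 + b) - v (1 + n) * 1)) +
    c n (1 + p) * c 1 p * ((v p * 1 - v 1 * 1) * (v (1 + p) * b - v n * (1 + 1))).
    move=> b0; have TT : T 1 1 * T n b * T p 1 != 0.
      by rewrite !mulf_neq0 // T_neq0 ?oner_eq0.
    apply: (mulfI TT); rewrite -term.
    have H := Jac (1 * g) (n * g) (p * g) 1 b 1.
    rewrite -!mulrDl -!/(Q _ _ _ _) in H; rewrite H [RHS]mulrDr mulrDl.
    congr (_ + _).
      have H1 := Hc (1 + n) p (1 + b) 1; have H2 := Hc 1 n 1 b.
      by apply: (eq_lin2 (Q 1 n 1 b) (c (1 + n) p * T p 1 * (v p * (1 + b) - v (1 + n)
        * 1)) H1 H2); ring.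
    have := term n 1 p b 1 1.
    rewrite [n + 1]addrC [b + 1]addrC => ->; ring.
  have n1 : 1 != 0 :> F := oner_neq0 _.
  have n2 : 2%:R != 0 :> F by rewrite pnatr_eq0.
  have n1' : - 1 != 0 :> F by rewrite oppr_eq0.
  have n2' : - 2%:R != 0 :> F by rewrite oppr_eq0.
  have v1 : v 1 != 0 by rewrite /v mul1r subr_eq0.
  apply: (mulfI v1); apply: (mulfI vp).
  (* This combination extracts the coefficient of b^2, to which the last term of [E] does not
     contribute. The value b = 0 is avoided because [T n b] may vanish there. *)
  by apply: (eq_lin4 (6%:R^-1) (6%:R^-1) (- 6%:R^-1) (- 6%:R^-1)
    (E _ n2) (E _ n2') (E _ n1) (E _ n1')); field.
have [mu [mu_n mu0 muS]] : exists mu : int -> F, [/\ forall n, mu n != 0, mu 0 = 1 &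
    forall n, mu (1 + n) = c 1 n * mu n].
  pose f := fix f (n : nat) : F := if n is n'.+1 then c 1 n' * f n' else 1.
  pose h := fix h (n : nat) : F :=
    if n is n'.+1 then h n' / c 1 (Negz n') else 1.
  exists (fun n : int => match n with Posz n' => f n' | Negz n' => h n'.+1 end).
  split=> //.
    case=> n; first by elim: n => [|n IH] /=; rewrite ?oner_eq0 ?mulf_neq0.
    have h0 : h n != 0.
      by elim: n => [|n IH] /=; rewrite ?oner_eq0 // mulf_neq0 // invr_eq0.
    by rewrite /= mulf_neq0 // invr_eq0.
  case=> [n|[|n]].
  - by rewrite (_ : 1 + n%:Z = n.+1%:Z) // intS.
  - by rewrite (_ : 1 + Negz 0 = 0%N) //= mulrC divfK.
  - rewrite (_ : 1 + Negz n.+1 = Negz n) /=; last by rewrite !NegzE; lia.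
    by rewrite [RHS]mulrC divfK.
pose C m n := mu m * mu n * c m n / mu (m + n).
have CS n p : v p != 0 -> C (1 + n) p = C n p.
  move=> /(J n) E; rewrite /C -addrA !muS.
  have m1 := mu_n (n + p); have c1 := cn (n + p); have c2 := cn n.
  transitivity (mu n * mu p * (c 1 n * c (1 + n) p) / (c 1 (n + p) * mu (n + p))).
    by field; rewrite m1 c1.
  by rewrite E; field; rewrite m1 c1.
have C1 m n : v n != 0 -> C m n = 1.
  move=> vn; have C0 : C 0 n = 1.
    by rewrite /C mu0 mul1r c0 add0r mulr1 divff.
  have Cn (k : nat) : C k n = 1.
    by elim: k => [|k IH] //; rewrite intS CS.
  have C'n (k : nat) : C (- k%:Z) n = 1.
    elim: k => [|k IH]; first by rewrite oppr0.
    rewrite -CS // (_ : 1 + - k.+1%:Z = - k%:Z) //; lia.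
  by case: m => m; rewrite ?NegzE.
have key m n a b : v n != 0 -> mu m * mu n * Q m n a b * T (m + n) (a + b) =
    mu (m + n) * T m a * T n b * (v n * a - v m * b).
  move=> /(C1 m); rewrite /C => E.
  have m1 := mu_n (m + n).
  have {}E : mu m * mu n * c m n = mu (m + n) by rewrite -[RHS]mul1r -E divfK.
  by rewrite -E -mulrA Hc; ring.
exists mu; split=> // m n a b.
have [vn|vn] := eqVneq (v n) 0; last exact: key.
have [vm|vm] := eqVneq (v m) 0.
  by rewrite -mulrA Hc vn vm; ring.
rewrite /Q Panti -/(Q n m b a).
by have := key n m b a vm; rewrite [n + m]addrC [b + a]addrC => H;
  apply: (eq_lin1 (-1) H); ring.
Qed.
End LineConstants.

Definition cartan_type (x : int) (mu : int -> F) : Prop :=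
  [/\ x != 0, forall i, S i <-> exists n : nat, i = (n%:Z - 1) * x,
      forall n : nat, N (- x) (n.+1%:Z * x),
      (forall n, mu n != 0) /\ mu 0 = 1 &
      forall (m n : int) a b, -1 <= m -> -1 <= n ->
        mu m * mu n * P (m * x) (n * x) a b =
        mu (m + n) * ((- 1 - n%:~R) * a - (- 1 - m%:~R) * b)].

Definition line_type (g : int) (th : F) (mu : int -> F) : Prop :=
  let T (n : int) (a : F) := if n%:~R * th == 2%:R then a else 1 in
  [/\ g != 0, forall i, S i <-> exists n : int, i = n * g,
      forall n : int, N g (n * g),
      (forall n, mu n != 0) /\ mu 0 = 1 &
      forall (m n : int) a b,
        mu m * mu n * P (m * g) (n * g) a b * T (m + n) (a + b) =
        mu (m + n) * T m a * T n b * ((n%:~R * th - 1) * a - (m%:~R * th - 1) * b)].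

Theorem symbol_classification :
  [\/ forall i, S i -> i = 0, exists x mu, cartan_type x mu |
      exists g th mu, line_type g th mu].
Proof.
have [[i [i0 Si]]|H] := pselect (exists i, i != 0 /\ S i); last first.
  apply: Or31 => i Si; apply/eqP; apply: contraT => i0.
  by case: H; exists i.
have [[j [j0 Yj]]|H] := pselect (exists j, j != 0 /\ regular j); last first.
  have noY j : regular j -> j = 0.
    by move=> Yj; apply/eqP; apply: contraT => j0; case: H; exists j.
  have [x [x0 Sx wx Nx]] := cartan_case noY i0 Si.
  have [mu [mu0 mu1 H1]] := cartan_normal x0 Sx wx Nx.
  by apply: Or32; exists x, mu.
have [eta [SX Sadd lineS]] := line_case j0 Yj.
have Sj : S j by case: Yj => /paired_S[].
have [g [g0 Sg th1 genS]] := generator eta SX Sadd j0 Sj.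
have SgE k : S k <-> exists n : int, k = n * g.
  by split=> [|[n ->]]; [exact: genS | exact: (S_mul SX Sadd)].
have Ng (n : int) : N g (n * g).
  by apply: (generator_N SX Sadd lineS Sg _ th1); exact: (S_mul SX Sadd n Sg).
have [mu [mu0 mu1 H1]] := line_normal g0 SgE th1 Ng (weightE SX Sadd lineS).
by apply: Or33; exists g, (g%:~R * eta), mu.
Qed.

End GradedSymbols.

(** * Evaluation of the formal variables *)

Section Evaluation.
Variables (F : numFieldType) (A : lmodType {poly F}).

Section Generic.
Variables (K : choiceType) (phi : K -> F).

Definition evK (f : {malg A[K]}) : A :=
  \sum_(k <- msupp f) (phi k)%:P *: f@_k.

Lemma evKw (d : {fset K}) f : (msupp f `<=` d)%fset ->
  evK f = \sum_(k <- d) (phi k)%:P *: f@_k.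
Proof.
move=> le; rewrite /evK (big_fset_incl _ le) // => k _ /mcoeff_outdom ->.
by rewrite scaler0.
Qed.

Lemma evK0 : evK 0 = 0.
Proof. by rewrite /evK msupp0 big_seq_fset0. Qed.

Lemma evKD f g : evK (f + g) = evK f + evK g.
Proof.
rewrite (evKw (msuppD_le f g)) (evKw (fsubsetUl (msupp f) (msupp g))).
rewrite (evKw (fsubsetUr (msupp f) (msupp g))) -big_split /=.
by apply: eq_bigr => k _; rewrite mcoeffD scalerDr.
Qed.

Lemma evKN f : evK (- f) = - evK f.
Proof.
by apply/eqP; rewrite -addr_eq0 -evKD addNr evK0.
Qed.

Lemma evK_sum (I : Type) (r : seq I) (f : I -> {malg A[K]}) :
  evK (\sum_(i <- r) f i) = \sum_(i <- r) evK (f i).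
Proof.
elim: r => [|i r IH]; first by rewrite !big_nil evK0.
by rewrite !big_cons evKD IH.
Qed.

Lemma evKU a k : evK << a *g k >> = (phi k)%:P *: a.
Proof.
rewrite (evKw msuppU_le) big_seq_fset1 mcoeffUU //.
Qed.
End Generic.

Definition ev (l : F) := evK (fun n : nat => l ^+ n).
Definition ev2 (l m : F) := evK (fun n : nat * nat => l ^+ n.1 * m ^+ n.2).

Lemma coef_pscale (q : {poly {poly F}}) (a : A) n :
  (pscale q a)@_n = q`_n *: a.
Proof.
rewrite /pscale raddf_sum /=.
under eq_bigr => i _ do rewrite mcoeffU.
have [lt|ge] := ltnP n (size q).
  rewrite (bigD1 (Ordinal lt)) //= eqxx mulr1n big1 ?addr0 // => i.
  by rewrite -val_eqE /= => /negPf ->; rewrite mulr0n.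
rewrite big1 ?nth_default ?scale0r // => i _.
by rewrite (_ : _ == _ = false) ?mulr0n //; apply/eqP => e; have := ltn_ord i;
  rewrite [X in (X < _)%N]e ltnNge ge.
Qed.

Lemma ev_pscale l q a : ev l (pscale q a) = q.[l%:P] *: a.
Proof.
rewrite /ev /pscale evK_sum horner_coef scaler_suml; apply: eq_bigr => i _.
by rewrite evKU scalerA mulrC polyC_exp.
Qed.

Lemma ev2_pscale2 l m q a : ev2 l m (pscale2 q a) = q.[m%:P%:P].[l%:P] *: a.
Proof.
rewrite /ev2 /pscale2 evK_sum [q.[_]]horner_coef horner_sum scaler_suml.
apply: eq_bigr => i _; rewrite evK_sum -!polyC_exp hornerM hornerC.
rewrite horner_coef mulr_suml scaler_suml; apply: eq_bigr => j _.
by rewrite evKU scalerA polyCM !polyC_exp; congr (_ *: _); ring.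
Qed.

Lemma ev_pact l q f : ev l (pact q f) = q.[l%:P] *: ev l f.
Proof.
rewrite {1}/ev /pact evK_sum [in RHS]/ev [in RHS]/evK scaler_sumr.
apply: eq_bigr => n _; rewrite -/(ev l _) ev_pscale scalerA hornerM horner_exp hornerX.
by rewrite polyC_exp.
Qed.

Lemma ev_psubst l q f :
  ev l (psubst q f) = \sum_(n <- msupp f) q.[l%:P] ^+ n *: f@_n.
Proof.
rewrite /ev /psubst evK_sum; apply: eq_bigr => n _.
by rewrite -/(ev l _) ev_pscale horner_exp.
Qed.

Lemma ev_bound (f : {malg A[nat]}) : exists N : nat, forall n, (N <= n)%N -> f@_n = 0.
Proof.
exists (\max_(i <- msupp f) i).+1 => n Hn; apply: mcoeff_outdom.
apply/negP => nf; move: Hn.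
by rewrite (big_fsetD1 n nf) /= gtn_max ltnn.
Qed.

Lemma evE N l (f : {malg A[nat]}) : (forall n, (N <= n)%N -> f@_n = 0) ->
  ev l f = \sum_(n < N) (l ^+ n)%:P *: f@_(n : nat).
Proof.
move=> H; pose d := [fset n | n in iota 0 N]%fset.
have le : (msupp f `<=` d)%fset.
  apply/fsubsetP => n; rewrite -mcoeff_neq0 => nf; rewrite inE /= mem_iota /= add0n.
  by rewrite ltnNge; apply: contraNN nf => /H ->.
rewrite /ev (evKw _ le) -(big_mkord xpredT (fun n => (l ^+ n)%:P *: f@_n)).
rewrite /index_iota subn0; apply: perm_big.
rewrite uniq_perm ?iota_uniq ?fset_uniq // => n.
by rewrite inE.
Qed.

Lemma scale_cst (c : F) (a : A) : c != 0 -> c%:P *: a = 0 -> a = 0.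
Proof.
move=> c0 /(congr1 (fun x => c^-1%:P *: x)).
by rewrite scalerA scaler0 -polyCM mulVf // scale1r.
Qed.

(** A Vandermonde argument inside a submodule: the value at 2 l minus 2^N times the value at l loses
    the top coefficient [c N] and multiplies [c i] by the invertible scalar 2^i - 2^N. *)
Lemma vpoly_in (Q : A -> Prop) N (c : nat -> A) : Q 0 ->
  (forall p x y, Q x -> Q y -> Q (p *: x + y)) ->
  (forall l : F, Q (\sum_(n < N) (l ^+ n)%:P *: c n)) ->
  forall n, (n < N)%N -> Q (c n).
Proof.
move=> Q0 QL; have QZ p x : Q x -> Q (p *: x) by move=> Qx; rewrite -[_ *: x]addr0;
  exact: QL.
have QB x y : Q x -> Q y -> Q (x - y).
  by move=> Qx Qy; rewrite addrC -scaleN1r; exact: QL.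
elim: N c => [|N IH] c H // n.
have cn i : (i < N)%N -> Q (c i).
  move=> iN; have ne : (2%:R ^+ i - 2%:R ^+ N : F) != 0.
    rewrite subr_eq0 -!natrX eqr_nat eqn_exp2l //; lia.
  suff /(QZ (2%:R ^+ i - 2%:R ^+ N)^-1%:P) : Q ((2%:R ^+ i - 2%:R ^+ N : F)%:P *: c i).
    by rewrite scalerA -polyCM mulVf // scale1r.
  move: i iN {ne}; apply: IH => l.
  have H1 := H (2%:R * l); have H2 := H l.
  rewrite !big_ord_recr /= in H1 H2.
  have := QB _ _ H1 (QZ (2%:R ^+ N)%:P _ H2).
  rewrite scalerDr scalerA exprMn polyCM opprD addrACA subrr addr0.
  rewrite scaler_sumr -sumrB.
  under eq_bigr => i _ do rewrite exprMn scalerA -scalerBl -polyCM -polyCB -mulrBl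
    mulrC polyCM -scalerA.
  by [].
rewrite ltnS leq_eqVlt => /orP[/eqP->|]; last exact: cn.
have /QB := H 1; rewrite big_ord_recr /= => /(_ (\sum_(i < N) (1 ^+ i)%:P *: c i)).
rewrite [X in X - _]addrC addrK expr1n scale1r; apply.
by elim/big_ind: _ => // [x y|i _]; [move=> Qx; rewrite -[x]scale1r;
  exact: QL|apply: QZ; exact: cn].
Qed.

Lemma vpoly0 N (c : nat -> A) :
  (forall l : F, \sum_(n < N) (l ^+ n)%:P *: c n = 0) ->
  forall n, (n < N)%N -> c n = 0.
Proof.
by apply: (@vpoly_in (fun x => x = 0)) => // p x y -> ->; rewrite scaler0 addr0.
Qed.

Lemma ev_in (Q : A -> Prop) (f : {malg A[nat]}) : Q 0 ->
  (forall p x y, Q x -> Q y -> Q (p *: x + y)) ->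
  (forall l, Q (ev l f)) -> forall n, Q f@_n.
Proof.
move=> Q0 QL H n; have [N HN] := ev_bound f.
have [/HN -> //|nN] := leqP N n.
by apply: (@vpoly_in Q N (fun n => f@_n)) => // l; rewrite -(evE _ HN).
Qed.

Lemma ev_eq0 (f : {malg A[nat]}) : (forall l, ev l f = 0) -> f = 0.
Proof.
move=> H; have [N HN] := ev_bound f.
apply/malgP => n; rewrite mcoeff0; have [/HN //|nN] := leqP N n.
by apply: (@vpoly0 N (fun n => f@_n)) => // l; rewrite -(evE _ HN).
Qed.

Lemma ev_inj (f g : {malg A[nat]}) : (forall l, ev l f = ev l g) -> f = g.
Proof.
move=> H; apply/eqP; rewrite -subr_eq0; apply/eqP; apply: ev_eq0 => l.
by rewrite /ev evKD evKN -!/(ev _ _) H subrr.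
Qed.

End Evaluation.

(** * Brackets at scalar values of the variable *)

Section Bracket.
Variables (F : numFieldType) (A : conformal F).
Implicit Types (a b c : A) (l m : F).

Definition br a b l : A := ev l (bracket a b).

Hypothesis HA : lie_conformal A.

Lemma ev2_pnest l m (p q : F) P Q (g : A -> {malg A[nat]}) f :
  P.[m%:P%:P].[l%:P] = p%:P -> Q.[m%:P%:P].[l%:P] = q%:P ->
  ev2 l m (pnest P Q g f) = \sum_(k <- msupp f) (p ^+ k)%:P *: ev q (g f@_k).
Proof.
move=> HP HQ; rewrite /ev2 /pnest evK_sum; apply: eq_bigr => k _.
rewrite evK_sum [in RHS]/ev [in RHS]/evK scaler_sumr; apply: eq_bigr => n _.
by rewrite -/(ev2 l m _) ev2_pscale2 hornerM !horner_exp hornerM !horner_exp HP HQ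
  -!polyC_exp scalerA.
Qed.

Lemma brZDl (x : F) a a' b l :
  br (x%:P *: a + a') b l = x%:P *: br a b l + br a' b l.
Proof.
by rewrite /br (bracket_linearl HA) /ev evKD -!/(ev _ _) ev_pact /cst hornerC.
Qed.

Lemma brZDr (x : F) a b b' l :
  br a (x%:P *: b + b') l = x%:P *: br a b l + br a b' l.
Proof.
by rewrite /br (bracket_linearr HA) /ev evKD -!/(ev _ _) ev_pact /cst hornerC.
Qed.

Lemma brDl a a' b l : br (a + a') b l = br a b l + br a' b l.
Proof. by have := brZDl 1 a a' b l; rewrite !scale1r. Qed.

Lemma brDr a b b' l : br a (b + b') l = br a b l + br a b' l.
Proof. by have := brZDr 1 a b b' l; rewrite !scale1r. Qed.

Lemma br0l b l : br 0 b l = 0.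
Proof. by apply: (addrI (br 0 b l)); rewrite -brDl !addr0. Qed.

Lemma br0r a l : br a 0 l = 0.
Proof. by apply: (addrI (br a 0 l)); rewrite -brDr !addr0. Qed.

Lemma brcl (x : F) a b l : br (x%:P *: a) b l = x%:P *: br a b l.
Proof. by have := brZDl x a 0 b l; rewrite br0l !addr0. Qed.

Lemma brcr (x : F) a b l : br a (x%:P *: b) l = x%:P *: br a b l.
Proof. by have := brZDr x a b 0 l; rewrite br0r !addr0. Qed.

Lemma br_sumr (I : Type) (r : seq I) a (f : I -> A) l :
  br a (\sum_(i <- r) f i) l = \sum_(i <- r) br a (f i) l.
Proof.
by elim: r => [|i r IH]; rewrite ?big_nil ?br0r // !big_cons brDr IH.
Qed.

Lemma br_suml (I : Type) (r : seq I) b (f : I -> A) l :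
  br (\sum_(i <- r) f i) b l = \sum_(i <- r) br (f i) b l.
Proof.
by elim: r => [|i r IH]; rewrite ?big_nil ?br0l // !big_cons brDl IH.
Qed.

Lemma brZl (p : {poly F}) a b l : br (p *: a) b l = p.[- l]%:P *: br a b l.
Proof.
elim/poly_ind: p a => [|p c IH] a; first by rewrite horner0 !scale0r br0l.
rewrite scalerDl -scalerA brDl brcl IH hornerMXaddC polyCD polyCM scalerDl.
congr (_ + _); rewrite -scalerA; congr (_ *: _).
rewrite /br (bracket_sesquil HA) ev_pact /lam hornerN hornerX.
by rewrite -polyCN.
Qed.

Lemma brZr (p : {poly F}) a b l :
  br a (p *: b) l = (p \Po ('X + l%:P)) *: br a b l.
Proof.
elim/poly_ind: p b => [|p c IH] b; first by rewrite comp_poly0 !scale0r br0r.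
rewrite scalerDl -scalerA brDr brcr IH comp_poly_MXaddC scalerDl.
congr (_ + _); rewrite -scalerA; congr (_ *: _).
by rewrite /br (bracket_sesquir HA) ev_pact /lam /dl hornerD hornerC hornerX.
Qed.

Lemma brE a b l : br a b l = \sum_(k <- msupp (bracket a b)) (l ^+ k)%:P *: (bracket a
  b)@_k.
Proof. by []. Qed.

Lemma br_jacobi a b c l m :
  br a (br b c m) l = br (br a b l) c (l + m) + br b (br a c l) m.
Proof.
have E := congr1 (ev2 l m) (bracket_jacobi HA a b c).
rewrite /ev2 evKD -!/(ev2 l m _) in E.
rewrite (@ev2_pnest l m m l mu2 lam2) ?(@ev2_pnest l m l (l + m) lam2 (lam2 + mu2))
  ?(@ev2_pnest l m l m lam2 mu2) in E;
  rewrite /lam2 /mu2 ?hornerD ?hornerX ?hornerC ?hornerX ?polyCD //.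
rewrite [br b c m]brE [br a b l]brE [br a c l]brE !br_sumr br_suml.
under eq_bigr => k _ do rewrite brcr.
under [in RHS]eq_bigr => k _ do rewrite brcl.
under [X in _ + X]eq_bigr => k _ do rewrite brcr.
exact: E.
Qed.

(** The variable is replaced by - l - d, which is not a scalar, so the right-hand side is a sum over
    coefficients and not a value of [br]. *)
Lemma br_skew a b l :
  br a b l = - \sum_(n <- msupp (bracket b a)) (- l%:P - 'X) ^+ n *: (bracket b a)@_n.
Proof.
rewrite /br (bracket_skew HA) /ev evKN -/(ev _ _) ev_psubst; congr (- _).
by apply: eq_bigr => n _; rewrite /lam /dl !hornerE.
Qed.

End Bracket.

(** * Rank one *)

(* The fractions x / d with x in M and d <> 0 form a vector space in which a
   torsion-free module M embeds; by its universal property, so does M in any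
   tensor product with the field of fractions. *)
Section Localization.
Local Open Scope quotient_scope.
Variables (R : idomainType) (M : lmodType R).
Hypothesis tf : forall (p : R) (x : M), p *: x = 0 -> (p == 0) || (x == 0).

Lemma tfI (p : R) (x y : M) : p != 0 -> p *: x = p *: y -> x = y.
Proof.
move=> p0 /eqP; rewrite -subr_eq0 -scalerBr => /eqP /tf.
by rewrite (negPf p0) subr_eq0 => /eqP.
Qed.

Definition mfrac := {u : M * R | u.2 != 0}.

Definition mk_mfrac (x : M) (d : R) : mfrac := insubd (exist _ (x, 1) (oner_neq0 R)) (x, d).

Lemma mfracK x d : d != 0 -> val (mk_mfrac x d) = (x, d).
Proof. by move=> d0; rewrite /mk_mfrac /insubd insubT. Qed.

Definition mfrac_eq (u v : mfrac) := (val v).2 *: (val u).1 == (val u).2 *: (val v).1.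

Lemma mfrac_refl : reflexive mfrac_eq.
Proof. by move=> u; rewrite /mfrac_eq. Qed.

Lemma mfrac_sym : symmetric mfrac_eq.
Proof. by move=> u v; rewrite /mfrac_eq eq_sym. Qed.

Lemma mfrac_trans : transitive mfrac_eq.
Proof.
move=> [[y e] /= e0] [[x d] /= d0] [[z c] /= c0]; rewrite /mfrac_eq /= => /eqP H1 /eqP H2.
apply/eqP; apply: (tfI e0).
by rewrite scalerA mulrC -scalerA H1 scalerA mulrC -scalerA H2 !scalerA mulrC.
Qed.

Canonical mfrac_equiv := EquivRel mfrac_eq mfrac_refl mfrac_sym mfrac_trans.

Definition localization := {eq_quot mfrac_eq}.
HB.instance Definition _ : EqQuotient _ mfrac_eq localization := EqQuotient.on localization.
HB.instance Definition _ := Choice.on localization.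

Definition loc (x : M) (d : R) : localization := \pi_localization (mk_mfrac x d).

Lemma loc_eq x d y e : d != 0 -> e != 0 -> (loc x d = loc y e) <-> e *: x = d *: y.
Proof.
move=> d0 e0; split.
  by move=> /eqmodP; rewrite /= /mfrac_eq !mfracK // => /eqP.
by move=> H; apply/eqmodP; rewrite /= /mfrac_eq !mfracK //; apply/eqP.
Qed.

Lemma loc_ex (u : localization) : exists x d, d != 0 /\ u = loc x d.
Proof.
elim/quotW: u => -[[x d] /= d0]; exists x, d; split=> //.
by rewrite /loc; congr (\pi _); apply: val_inj; rewrite /= mfracK.
Qed.

Definition lnum (u : localization) : M := (val (repr u)).1.
Definition lden (u : localization) : R := (val (repr u)).2.

Lemma lden0 u : lden u != 0.
Proof. exact: valP (repr u). Qed.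

Lemma loc_repr x d : d != 0 -> d *: lnum (loc x d) = lden (loc x d) *: x.
Proof.
move=> d0; apply/(loc_eq _ _ (lden0 _) d0).
rewrite -[RHS]reprK /loc; congr (\pi _).
apply: val_inj; rewrite mfracK ?lden0 // /lnum /lden -/(loc x d).
by case: (val (repr (loc x d))).
Qed.

Definition loc_add u v := loc (lden v *: lnum u + lden u *: lnum v) (lden u * lden v).
Definition loc_opp u := loc (- lnum u) (lden u).

Local Notation K := {fraction R}.
Definition loc_scale (k : K) u := loc (\n_(repr k) *: lnum u) (\d_(repr k) * lden u).

Lemma loc_addE x d y e : d != 0 -> e != 0 ->
  loc_add (loc x d) (loc y e) = loc (e *: x + d *: y) (d * e).
Proof.
move=> d0 e0; apply/loc_eq; rewrite ?mulf_neq0 ?lden0 //.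
rewrite !scalerDr !scalerA; congr (_ + _).
  set p := _ * lden _; have -> : p = (e * lden (loc y e)) * d by rewrite /p; ring.
  by rewrite -scalerA loc_repr // !scalerA; congr (_ *: _); ring.
set p := _ * lden _; have -> : p = (d * lden (loc x d)) * e by rewrite /p; ring.
by rewrite -scalerA loc_repr // !scalerA; congr (_ *: _); ring.
Qed.

Lemma loc_oppE x d : d != 0 -> loc_opp (loc x d) = loc (- x) d.
Proof.
by move=> d0; apply/loc_eq; rewrite ?lden0 // !scalerN loc_repr.
Qed.

Lemma frac_repr (k : K) : k * tofrac \d_(repr k) = tofrac \n_(repr k).
Proof.
rewrite -{1}[k]reprK; case: (repr k) => -[n d] /= d0.
unlock FracField.tofrac; rewrite -[LHS]FracField.pi_mul; apply/eqmodP.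
by rewrite /= FracField.equivfE /= /FracField.mulf /= !numden_Ratio ?mulr1 ?oner_eq0
  //= mulrC.
Qed.

(** The relation k q = p stands for k = p / q: scaling may be computed with any representative,
    which spares the other lemmas the chosen one. *)
Lemma loc_scaleE p q k x d : q != 0 -> d != 0 -> k * tofrac q = tofrac p ->
  loc_scale k (loc x d) = loc (p *: x) (q * d).
Proof.
move=> q0 d0 Hk.
have E : \n_(repr k) * q = p * \d_(repr k).
  by apply/eqP; rewrite -tofrac_eq !tofracM -Hk -frac_repr mulrAC.
have dk : \d_(repr k) != 0 by exact: denom_ratioP.
apply/loc_eq; rewrite ?mulf_neq0 ?lden0 //.
rewrite [LHS]scalerA [q * d * _](_ : _ = p * \d_(repr k) * d); last by rewrite -E; ring.
by rewrite -scalerA loc_repr // !scalerA; congr (_ *: _); ring.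
Qed.

Lemma loc_addA : associative loc_add.
Proof.
move=> u v z; have [x [d [d0 ->]]] := loc_ex u; have [y [e [e0 ->]]] := loc_ex v.
have [t [c [c0 ->]]] := loc_ex z; rewrite !loc_addE ?mulf_neq0 //.
apply/loc_eq; rewrite ?mulf_neq0 // !scalerDr !scalerA -addrA.
by congr (_ *: _ + (_ *: _ + _ *: _)); ring.
Qed.

Lemma loc_addC : commutative loc_add.
Proof.
move=> u v; have [x [d [d0 ->]]] := loc_ex u; have [y [e [e0 ->]]] := loc_ex v.
by rewrite !loc_addE // addrC mulrC.
Qed.

Lemma loc_add0 : left_id (loc 0 1) loc_add.
Proof.
move=> u; have [x [d [d0 ->]]] := loc_ex u.
by rewrite !loc_addE ?oner_eq0 // scaler0 add0r scale1r mul1r.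
Qed.

Lemma loc_addN : left_inverse (loc 0 1) loc_opp loc_add.
Proof.
move=> u; have [x [d [d0 ->]]] := loc_ex u.
rewrite loc_oppE // loc_addE // scalerN addNr.
by apply/loc_eq; rewrite ?mulf_neq0 ?oner_eq0 // !scaler0.
Qed.

HB.instance Definition _ := GRing.isZmodule.Build localization loc_addA loc_addC
  loc_add0 loc_addN.

Lemma frac_ex (k : K) : exists p q, q != 0 /\ k * tofrac q = tofrac p.
Proof. by exists \n_(repr k), \d_(repr k); rewrite frac_repr; split=> //;
  exact: denom_ratioP. Qed.

Lemma loc_scaleA k l u : loc_scale k (loc_scale l u) = loc_scale (k * l) u.
Proof.
have [p [q [q0 Hk]]] := frac_ex k; have [r [s [s0 Hl]]] := frac_ex l.
have [x [d [d0 ->]]] := loc_ex u.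
rewrite (loc_scaleE _ s0 d0 Hl) (loc_scaleE _ q0 _ Hk) ?mulf_neq0 //.
rewrite (@loc_scaleE (p * r) (q * s)) ?mulf_neq0 ?scalerA ?mulrA //.
by rewrite !tofracM -Hk -Hl; ring.
Qed.

Lemma loc_scale1 : left_id 1 loc_scale.
Proof.
move=> u; have [x [d [d0 ->]]] := loc_ex u.
by rewrite (@loc_scaleE 1 1) ?oner_eq0 ?mulr1 // scale1r mul1r.
Qed.

Lemma loc_scaleDr : right_distributive loc_scale +%R.
Proof.
move=> k u v; have [x [d [d0 ->]]] := loc_ex u; have [y [e [e0 ->]]] := loc_ex v.
have [p [q [q0 Hk]]] := frac_ex k.
rewrite [_ + _]loc_addE // (loc_scaleE _ q0 _ Hk) ?mulf_neq0 // (loc_scaleE _ q0 _ Hk)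
  // (loc_scaleE _ q0 _ Hk) //.
rewrite [RHS]loc_addE ?mulf_neq0 //; apply/loc_eq; rewrite ?mulf_neq0 //.
rewrite !scalerDr !scalerA; congr (_ *: _ + _ *: _); ring.
Qed.

Lemma loc_scaleDl u : {morph loc_scale^~ u : k l / k + l}.
Proof.
move=> k l; have [p [q [q0 Hk]]] := frac_ex k; have [r [s [s0 Hl]]] := frac_ex l.
have [x [d [d0 ->]]] := loc_ex u.
rewrite (loc_scaleE _ s0 d0 Hl) (loc_scaleE _ q0 d0 Hk).
rewrite (@loc_scaleE (p * s + r * q) (q * s)) ?mulf_neq0 //; last first.
  by rewrite tofracD !tofracM -Hk -Hl; ring.
rewrite [RHS]loc_addE ?mulf_neq0 //; apply/loc_eq; rewrite ?mulf_neq0 //.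
rewrite !scalerA -scalerDl !scalerA; congr (_ *: _); ring.
Qed.

HB.instance Definition _ := GRing.Zmodule_isLmodule.Build K localization
  loc_scaleA loc_scale1 loc_scaleDr loc_scaleDl.

Lemma loc_semilinear p x y : loc (p *: x + y) 1 = tofrac p *: loc x 1 + loc y 1.
Proof.
rewrite [_ *: loc x 1](@loc_scaleE p 1) ?oner_eq0 ?tofrac1 ?mulr1 //.
by rewrite [RHS]loc_addE ?oner_eq0 // !scale1r mulr1.
Qed.

Lemma loc_inj x y : loc x 1 = loc y 1 -> x = y.
Proof. by move=> /(loc_eq _ _ (oner_neq0 R) (oner_neq0 R)); rewrite !scale1r. Qed.

End Localization.

Lemma dim1_dependent (K : fieldType) (V : lmodType K) n (v : 'I_n -> V) :
  (forall w, exists! c : {ffun 'I_n -> K}, w = \sum_i c i *: v i) ->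
  (n <= 1)%N -> forall x y : V, exists a b : K, ((a != 0) || (b != 0)) /\ a *: x = b *: y.
Proof.
move=> Hv n1 x y; have [c [cE _]] := Hv x; have [d [dE _]] := Hv y.
case: n n1 v Hv c cE d dE => [|[|//]] _ v _ c cE d dE.
  by exists 1, 1; rewrite oner_eq0 cE dE !big_ord0.
rewrite big_ord1 in cE; rewrite big_ord1 in dE.
have [c0|c0] := eqVneq (c ord0) 0.
  by exists 1, 0; rewrite oner_eq0 cE c0 !scale0r scaler0.
by exists (d ord0), (c ord0); rewrite c0 orbT cE dE !scalerA mulrC.
Qed.

Lemma clear_denominators (K : fieldType) (V : lmodType K) (a b p q r s : K) (x y : V) :
  a * q = p -> b * s = r -> q != 0 -> s != 0 -> (a != 0) || (b != 0) ->
  a *: x = b *: y ->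
  ((p * s != 0) || (r * q != 0)) /\ (p * s) *: x = (r * q) *: y.
Proof.
move=> <- <- q0 s0 ab E; split.
  by rewrite !mulf_eq0 !(negPf q0) !(negPf s0) !orbF.
rewrite (_ : a * q * s = q * s * a); last by ring.
rewrite (_ : b * s * q = q * s * b); last by ring.
by rewrite -!scalerA E.
Qed.

Section Rank.
Variables (F : fieldType) (M : lmodType {poly F}).
Hypothesis tf : forall (p : {poly F}) (x : M), p *: x = 0 -> (p == 0) || (x == 0).

Lemma rank1_dependent n : has_rank M n -> (n <= 1)%N -> forall x y : M,
  exists p q : {poly F}, ((p != 0) || (q != 0)) /\ p *: x = q *: y.
Proof.
move=> [V [f [[fl univ] [v Hv]]]] n1 x y.
have [h [hf _]] := univ _ _ (loc_semilinear tf).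
have f0 : f 0 = 0.
  by have := fl 1 0 0; rewrite scale1r tofrac1 scale1r addr0 => /eqP;
    rewrite -subr_eq subrr => /eqP.
have fZ p z : f (p *: z) = tofrac p *: f z by have := fl p z 0; rewrite f0 !addr0.
have finj z t : f z = f t -> z = t.
  move=> E; have : h (f z) = h (f t) by rewrite E.
  by rewrite !hf => /loc_inj.
have [a [b [ab E]]] := dim1_dependent Hv n1 (f x) (f y).
have [p [q [q0 Ha]]] := frac_ex a. have [r [s [s0 Hb]]] := frac_ex b.
have q1 : tofrac q != 0 by rewrite tofrac_eq0.
have s1 : tofrac s != 0 by rewrite tofrac_eq0.
have [nz0 E1] := clear_denominators Ha Hb q1 s1 ab E.
exists (p * s), (r * q); split.
  by rewrite -(tofrac_eq0 (p * s)) -(tofrac_eq0 (r * q)) !tofracM.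
by apply: finj; rewrite !fZ (tofracM p s) (tofracM r q).
Qed.
End Rank.

(** * Graded ideals *)

Lemma submodClosed_of (R : nzRingType) (A : lmodType R) (Q : A -> Prop) : Q 0 ->
  (forall p x y, Q x -> Q y -> Q (p *: x + y)) ->
  exists I : submodClosed A, forall x, x \in I <-> Q x.
Proof.
move=> Q0 QL; pose S : {pred A} := fun x => `[< Q x >].
have HS : submod_closed S.
  split; first by apply/asboolP.
  by move=> p x y /asboolP Qx /asboolP Qy; apply/asboolP; exact: QL.
pose I : submodClosed A := HB.pack S (GRing.isSubmodClosed.Build R A S HS).
by exists I => x; split=> [/asboolP|H]; [|apply/asboolP].
Qed.

Section Degree.
Variables (F : numFieldType) (A : conformal F).
Hypothesis HA : lie_conformal A.

Definition has_deg (f : {malg A[nat]}) (N : nat) :=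
  f@_N != 0 /\ forall n, (N < n)%N -> f@_n = 0.

Lemma has_deg_ex f : f != 0 -> exists N, has_deg f N.
Proof.
move=> f0; have [N HN] := ev_bound f.
elim: N HN => [|N IH] HN.
  by case/eqP: f0; apply/malgP => n; rewrite mcoeff0 HN.
have [fN|fN] := eqVneq f@_N 0; last by exists N; split.
by apply: IH => n; rewrite leq_eqVlt => /orP[/eqP<-|/HN].
Qed.

Lemma has_deg_uniq f N M : has_deg f N -> has_deg f M -> N = M.
Proof.
move=> [fN HN] [fM HM]; have [/HN fM0|/HM fN0|//] := ltngtP N M.
  by rewrite fM0 eqxx in fM.
by rewrite fN0 eqxx in fN.
Qed.

Lemma has_deg_brZr (a x : A) p N : p != 0 -> has_deg (bracket a x) N ->
  has_deg (bracket a (p *: x)) ((size p).-1 + N).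
Proof.
move=> p0 [fN HN]; set f := bracket a x in fN HN.
pose q : {poly {poly F}} := map_poly polyC p \Po ('X + 'X%:P).
have sX : size ('X + 'X%:P : {poly {poly F}}) = 2 by rewrite size_XaddC.
have sq : size q = size p.
  by rewrite /q size_comp_poly2 ?sX // size_map_polyC.
have lq : lead_coef q = (lead_coef p)%:P.
  rewrite lead_coef_comp ?sX // lead_coefXaddC expr1n mulr1.
  by rewrite lead_coef_map_inj //; exact: polyC_inj.
have E : bracket a (p *: x) = pact q f.
  apply: ev_inj => l; rewrite -/(br _ _ _) brZr // ev_pact.
  congr (_ *: _); rewrite /q horner_comp !hornerE /comp_poly addrC.
  by [].
have coefE m : (pact q f)@_m = \sum_(n <- msupp f) (q * lam ^+ n)`_m *: f@_n.
  by rewrite /pact raddf_sum /=; apply: eq_bigr => n _; rewrite coef_pscale.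
have sp : (0 < size p)%N by rewrite size_poly_gt0.
split.
  rewrite E coefE (big_fsetD1 N) /=; last by rewrite -mcoeff_neq0.
  rewrite big_seq big1 => [|n]; last first.
    rewrite !inE => /andP[nN _]; rewrite coefMXn; case: ltnP => [_|le];
      first by rewrite scale0r.
    have [lt|gt|e] := ltngtP n N; last by rewrite e eqxx in nN.
      rewrite nth_default ?scale0r // sq -addnBA ?(ltnW lt) //.
      by rewrite -[X in (X <= _)%N](prednK sp) -addn1 leq_add2l subn_gt0.
    by rewrite HN ?scaler0.
  rewrite addr0 coefMXn ltnNge leq_addl /= addnK -sq -[q`_ _]/(lead_coef q) lq.
  apply: contra_neq fN; apply: scale_cst; rewrite lead_coef_eq0 //.
move=> n Hn; rewrite E coefE big_seq big1 // => i fi.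
rewrite coefMXn; case: ltnP => [_|le]; first by rewrite scale0r.
have [lt|gt] := ltnP N i; first by rewrite HN ?scaler0.
rewrite nth_default ?scale0r // sq leq_subRL // -ltnS.
by rewrite -(prednK sp) addnS ltnS (leq_ltn_trans _ Hn) // addnC leq_add2l.
Qed.

(* The leading term in l of p (d + l) is a nonzero scalar, so that [[a, p x]]
   has degree deg p + deg [[a, x]] even if A has torsion. *)
Lemma torsion_central p (x : A) : p != 0 -> p *: x = 0 -> forall a l, br a x l = 0.
Proof.
move=> p0 px a l; have [f0|/has_deg_ex[N HN]] := eqVneq (bracket a x) 0.
  by rewrite /br f0 /ev evK0.
have [] := has_deg_brZr p0 HN; rewrite px.
suff -> : bracket a (0 : A) = 0 by rewrite mcoeff0 eqxx.
by apply: ev_eq0 => m; rewrite -/(br _ _ _) br0r.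
Qed.

End Degree.

Section Decomposition.
Variables (F : numFieldType) (L : conformal F) (G : int -> submodClosed L).
Hypothesis HL : lie_conformal L.
Hypothesis HG : graded G.
Hypothesis HS : graded_simple G.

Lemma G_br i j a b l : a \in G i -> b \in G j -> br a b l \in G (i + j).
Proof.
move=> Ga Gb; rewrite /br /ev /evK; apply: rpred_sum => n _.
by apply: rpredZ; exact: HG.2.
Qed.

Definition decomposition (a : L) (x : int -> L) :=
  (forall i, x i \in G i) /\
  exists s, [/\ uniq s, forall i, i \notin s -> x i = 0 & a = \sum_(i <- s) x i].

Lemma decomposition_ex a : exists x, decomposition a x.
Proof.
have [s [x [Gx ->]]] := HG.1.1 a.
exists (fun i => x i *+ count_mem i s); split=> [i|].
  by rewrite -scaler_nat rpredZ.
exists (undup s); split=> [|i|]; first exact: undup_uniq.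
  by rewrite mem_undup => /count_memPn ->; rewrite mulr0n.
rewrite -big_undup_iterop_count; apply: eq_bigr => i _.
by rewrite /= Monoid.iteropE /= iter_addr addr0.
Qed.

Definition component (a : L) : int -> L := projT1 (cid (decomposition_ex a)).

Lemma componentP a : decomposition a (component a).
Proof. exact: projT2 (cid (decomposition_ex a)). Qed.

Lemma decomposition0 x : decomposition 0 x -> forall i, x i = 0.
Proof.
move=> [Gx [s [us xs E]]] i; have [/xs //|] := boolP (i \notin s).
by rewrite negbK; apply: HG.1.2 Gx _ _.
Qed.

Lemma big_widen (s t : seq int) (x : int -> L) : uniq s -> uniq t ->
  {subset s <= t} -> (forall i, i \notin s -> x i = 0) ->
  \sum_(i <- s) x i = \sum_(i <- t) x i.
Proof.
move=> us ut st xs; rewrite [RHS](bigID (mem s) predT) /= [X in _ + X]big1 ?addr0 =>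
  [|i /xs //].
rewrite -[in RHS]big_filter; apply: perm_big; apply: uniq_perm;
  rewrite ?filter_uniq // => i.
by rewrite mem_filter; case: (boolP (i \in s)) => [/st|].
Qed.

Lemma decompositionZD p a b x y : decomposition a x -> decomposition b y ->
  decomposition (p *: a + b) (fun i => p *: x i + y i).
Proof.
move=> [Gx [s [us xs ->]]] [Gy [t [ut yt ->]]]; split=> [i|].
  by apply: rpredD => //; exact: rpredZ.
exists (undup (s ++ t)); split=> [|i|]; first exact: undup_uniq.
  by rewrite mem_undup mem_cat negb_or => /andP[/xs -> /yt ->]; rewrite scaler0 addr0.
rewrite (@big_widen s (undup (s ++ t)) x) ?undup_uniq // => [|i is_]; last first.
  by rewrite mem_undup mem_cat is_.
rewrite (@big_widen t (undup (s ++ t)) y) ?undup_uniq // => [|i it]; last first.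
  by rewrite mem_undup mem_cat it orbT.
by rewrite scaler_sumr -big_split.
Qed.

Lemma decomposition_uniq a x y : decomposition a x -> decomposition a y -> x =1 y.
Proof.
move=> Hx Hy; have := decompositionZD (-1) Hx Hy.
rewrite scaleN1r addNr => /decomposition0 H i; apply/eqP.
by rewrite -subr_eq0 -oppr_eq0 opprB addrC -scaleN1r H.
Qed.

Lemma component_eq a x : decomposition a x -> component a =1 x.
Proof. by move=> Hx; apply: decomposition_uniq Hx; exact: componentP. Qed.

Lemma componentZD p a b i : component (p *: a + b) i = p *: component a i + component b i.
Proof.
by rewrite (component_eq (decompositionZD p (componentP a) (componentP b))).
Qed.

Lemma component_in a i : component a i \in G i.
Proof. by case: (componentP a). Qed.

Lemma decomposition_homog i a : a \in G i ->
  decomposition a (fun j => if j == i then a else 0).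
Proof.
move=> Ga; split=> [j|]; first by case: eqP => [->//|_]; exact: rpred0.
exists [:: i]; split=> // [j|]; last by rewrite big_seq1 eqxx.
by rewrite inE => /negPf ->.
Qed.

Lemma component_homog i a j : a \in G i -> component a j = if j == i then a else 0.
Proof. by move=> Ga; rewrite (component_eq (decomposition_homog Ga)). Qed.

Lemma component0 i : component 0 i = 0.
Proof. by rewrite (component_homog _ (rpred0 (G 0))); case: eqP. Qed.

Lemma componentD a b i : component (a + b) i = component a i + component b i.
Proof. by have := componentZD 1 a b i; rewrite !scale1r. Qed.

Lemma component_sum (I : Type) (r : seq I) (f : I -> L) i :
  component (\sum_(k <- r) f k) i = \sum_(k <- r) component (f k) i.
Proof.
elim: r => [|k r IH]; first by rewrite !big_nil component0.
by rewrite !big_cons componentD IH.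
Qed.

Lemma component_sumE a : exists s, [/\ uniq s, forall i, i \notin s -> component a i = 0
  & a = \sum_(i <- s) component a i].
Proof. by case: (componentP a). Qed.

(** Graded simplicity in homogeneous form: the ideal consists of the elements all of whose
    components satisfy [Q]. By [ev_in], values of the bracket can be tested in place of its
    coefficients. *)
Lemma graded_ideal (Q : int -> L -> Prop) : (forall i, Q i 0) ->
  (forall i p x y, Q i x -> Q i y -> Q i (p *: x + y)) ->
  (forall i j a x, a \in G i -> x \in G j -> Q j x -> forall l, Q (i + j) (br a x l)) ->
  (forall i x, x \in G i -> Q i x -> x = 0) \/ (forall i x, x \in G i -> Q i x).
Proof.
move=> Q0 QL QI.
have [||I HI] := @submodClosed_of _ L (fun a => forall i, Q i (component a i)).
- by move=> i; rewrite component0.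
- by move=> p x y Qx Qy i; rewrite componentZD; exact: QL.
have homog i x : x \in G i -> x \in I <-> Q i x.
  move=> Gx; rewrite HI; split=> [/(_ i)|Qx j].
    by rewrite (component_homog _ Gx) eqxx.
  by rewrite (component_homog _ Gx); case: eqP => [->|_].
have Qsum i (J : Type) (r : seq J) (P : pred J) (f : J -> L) : (forall j,
  P j -> Q i (f j)) ->
    Q i (\sum_(j <- r | P j) f j).
  move=> H; elim/big_ind: _ => // x y Qx Qy.
  by rewrite -[x]scale1r; exact: QL.
have idI : ideal I.
  move=> a x /HI Qx n; apply/HI => k.
  apply: (@ev_in _ _ (fun y => Q k (component y k))) => [|p u v Qu Qv|l].
  - by rewrite component0.
  - by rewrite componentZD; exact: QL.
  have [s [_ _ ->]] := component_sumE a; have [t [_ _ ->]] := component_sumE x.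
  rewrite -/(br _ _ _) br_suml // component_sum; apply: (Qsum) => i _.
  rewrite br_sumr // component_sum; apply: (Qsum) => j _.
  have Gij := G_br l (component_in a i) (component_in x j).
  rewrite (component_homog _ Gij); case: eqP => [->|_]; last exact: Q0.
  apply: QI; [exact: component_in | exact: component_in | exact: Qx].
have gI : graded_submod G I.
  move=> s x us Gx /HI Qs i is_; apply/(homog _ _ (Gx i)).
  have := Qs i; rewrite component_sum (bigD1_seq i) //= big1 => [|j ji].
    by rewrite addr0 (component_homog _ (Gx i)) eqxx.
  by rewrite (component_homog _ (Gx j)) eq_sym (negPf ji).
case: (HS idI gI) => H; [left|right] => i x Gx.
  by move/(homog _ _ Gx)/H.
by apply/(homog _ _ Gx).
Qed.

End Decomposition.

(** * The action of L_0 on a generator *)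

Section WeightFunctions.
Variable F : numFieldType.

Lemma coef_comp_shift (p : {poly F}) n c : (size p <= n.+2)%N ->
  (p \Po ('X + c%:P))`_n.+1 = p`_n.+1 /\
  (p \Po ('X + c%:P))`_n = p`_n + n.+1%:R * c * p`_n.+1.
Proof.
move=> sp.
have H (j : nat) : (p \Po ('X + c%:P))`_j = \sum_(i < n.+2) p`_i * (('X + c%:P) ^+ i)`_j.
  rewrite coef_comp_poly (big_ord_widen n.+2 (fun i => p`_i * (('X + c%:P) ^+ i)`_j)) //.
  rewrite big_mkcond /=; apply: eq_bigr => i _; case: ltnP => // le.
  by rewrite nth_default ?mul0r.
have sz i : size (('X + c%:P) ^+ i) = i.+1.
  by rewrite -[c]opprK polyCN size_exp_XsubC.
have S (i j : nat) : (i < j)%N -> (('X + c%:P) ^+ i)`_j = 0.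
  by move=> ij; rewrite nth_default // sz.
have Tp i : (('X + c%:P) ^+ i)`_i = 1.
  have := lead_coef_exp ('X + c%:P) i; rewrite lead_coefXaddC expr1n.
  by rewrite lead_coefE sz.
have U : (('X + c%:P) ^+ n.+1)`_n = n.+1%:R * c.
  elim: (n) => [|k IH]; first by rewrite expr1 coefD coefX coefC add0r mul1r.
  rewrite exprS mulrDl coefD coefXM coefCM /= IH Tp mulr1 -[in RHS]natr1 mulrDl.
  by rewrite mul1r.
split; rewrite H !big_ord_recr /= big1 ?add0r => [|i _].
- by rewrite S // mulr0 add0r Tp mulr1.
- by rewrite S ?mulr0 // ltnW // ltnS.
- by rewrite Tp U mulr1; ring.
- by rewrite S ?mulr0.
Qed.

Lemma coefM_top (p q : {poly F}) n : (size p <= n.+2)%N -> (size q <= n.+2)%N ->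
  (p * q)`_(n + n.+1) = p`_n * q`_n.+1 + p`_n.+1 * q`_n.
Proof.
move=> sp sq; rewrite coefM.
have n1 : (n < (n + n.+1).+1)%N by lia.
have n2 : (n.+1 < (n + n.+1).+1)%N by lia.
rewrite (bigD1 (Ordinal n1)) //= (bigD1 (Ordinal n2)) //=; last first.
  by apply/eqP => /(congr1 val) /=; lia.
rewrite [X in _ + (_ + X)]big1 ?addr0 => [|i /andP[]].
  by rewrite addKn (_ : n + n.+1 - n.+1 = n)%N //; lia.
rewrite -!val_eqE /= => in1 in2.
have [lt|gt] := ltnP i n.
  by rewrite [q`_ _]nth_default ?mulr0 // (leq_trans sq) //; lia.
by rewrite nth_default ?mul0r // (leq_trans sp) //; lia.
Qed.

(* For a generator v of a rank one module with [[L, v]] = q(d, l) v, the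
   hypothesis is the Jacobi identity for L, L and v; its coefficients of highest
   degree in d show that q has degree one in d. *)
Lemma weight_function (q : {poly {poly F}}) : q != 0 ->
  (forall l m, (q.[m%:P] \Po ('X + l%:P)) * q.[l%:P] -
     (q.[l%:P] \Po ('X + m%:P)) * q.[m%:P] = (l - m)%:P * q.[(l + m)%:P]) ->
  exists al de, forall l, q.[l%:P] = 'X + (al + de * l)%:P.
Proof.
move=> q0 J.
have [l0 ql0] : exists l, q.[l%:P] != 0.
  apply: contrapT => H; case/eqP: q0; apply: bipoly0 => a b.
  suff -> : q.[b%:P] = 0 by rewrite horner0.
  by apply/eqP; apply: contraT => qb; case: H; exists b.
(* At m = 0 the hypothesis says f(x + l) = f(x) + l for f = [q.[0]] wherever q(l) is nonzero, hence
   for every l by polynomiality. *)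
have [al Eal] : exists al, q.[0] = 'X + al%:P.
  have phi0 l : q.[l%:P] != 0 -> q.[0] \Po ('X + l%:P) = q.[0] + l%:P.
    move=> ql; have := J l 0; rewrite polyC0 subr0 !addr0 comp_polyXr mulrC.
    rewrite -mulrBr mulrC => /(mulIf ql)/eqP.
    by rewrite subr_eq => /eqP ->; rewrite addrC.
  have phiE l x : q.[0].[x + l] = q.[0].[x] + l.
    pose f x := q.[0].[x].
    have Ql0 : exists y, q.[l0%:P].[y] != 0.
      apply: contrapT => H; case/eqP: ql0; apply: poly_fun0 => t _.
      by apply/eqP; apply: contraT => qt; case: H; exists t.
    have [y qy] := Ql0.
    have H : forall l, (q.[0].[x + l] - q.[0].[x] - l) * (map_poly (horner_eval y)
      q).[l] = 0.
      move=> m; rewrite -[m in X in _ * X](hornerC m y) (horner_map (horner_eval y)) /=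
        /horner_eval.
      have [->|/phi0 E] := eqVneq q.[m%:P] 0; first by rewrite horner0 mulr0.
      have := congr1 (fun p : {poly F} => p.[x]) E; rewrite horner_comp !hornerE => ->.
      by rewrite [X in X * _](_ : _ = 0) ?mul0r //; ring.
    have [] := @ispoly_dom _ (fun l => q.[0].[x + l] - q.[0].[x] - l)
      (fun l => (map_poly (horner_eval y) q).[l]) _ _ H.
    - exists ((q.[0] \Po ('X + x%:P)) - (q.[0].[x])%:P - 'X) => t.
      by rewrite !hornerE horner_comp !hornerE [t + x]addrC.
    - by exists (map_poly (horner_eval y) q).
    - by move=> /(_ l) E; apply: (eq_comb E); ring.
    - move=> /(_ l0); rewrite -[l0 in X in X = _](hornerC l0 y) (horner_map
      (horner_eval y)) /= /horner_eval => E.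
      by rewrite E eqxx in qy.
  exists q.[0].[0]; apply/eqP; rewrite -subr_eq0; apply/eqP; apply: poly_fun0 => t _.
  by rewrite !hornerE -{1}[t]add0r phiE; ring.
(* n + 1 is the degree of q in d; it is at least 1 because q(0) = d + al. *)
have [n [sn [k qkn]]] : exists n, (forall l, (size q.[l%:P] <= n.+2)%N) /\ exists k,
  q`_k`_n.+1 != 0.
  pose m := (\max_(i < size q) size (q`_i : {poly F})%R)%N.
  have sm l : (size q.[l%:P] <= m)%N.
    rewrite horner_coef; apply: (leq_trans (size_sum _ _ _)).
    apply/bigmax_leqP => i _; rewrite -polyC_exp mulrC mul_polyC.
    by apply: (leq_trans (size_scale_leq _ _));
      exact: (@leq_bigmax _ (fun i : 'I_(size q) => size (q`_i : {poly F})%R) i).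
  have m2 : (2 <= m)%N by have := sm 0; rewrite Eal size_XaddC.
  exists (m - 2)%N; split=> [l|]; first by rewrite (leq_trans (sm l)) //; lia.
  have sq : (0 < size q)%N by rewrite size_poly_gt0.
  have cq : (0 < #|'I_(size q)|)%N by rewrite card_ord.
  have [k Hk] := @bigop.eq_bigmax _ (fun i : 'I_(size q) => size (q`_i : {poly F})%R) cq.
  exists k; have -> : ((m - 2).+1 = (size (q`_k : {poly F})%R).-1)%N by rewrite -Hk
    -/m; lia.
  rewrite -lead_coefE lead_coef_eq0 -size_poly_eq0 -Hk -/m; lia.
pose c l := q.[l%:P]`_n.+1.
pose cp := map_poly (coefp n.+1) q.
have cE l : c l = cp.[l].
  rewrite /c horner_coef coef_sum /cp (@horner_coef_wide _ (size q)); last exact: size_poly.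
  apply: eq_bigr => i _; rewrite -polyC_exp coefMC coef_map_id0 //=.
  by rewrite /coefp coef0.
(* The terms of degree 2n + 2 in d cancel on the left; this compares those of degree 2n + 1. *)
have K l m : n.+1%:R * (l - m) * (c l * c m) = (l - m) * q.[(l + m)%:P]`_(n + n.+1).
  have := congr1 (fun p : {poly F} => p`_(n + n.+1)) (J l m).
  rewrite /= coefCM => <-; rewrite coefB.
  have [t1 t2] := coef_comp_shift l (sn m); have [t3 t4] := coef_comp_shift m (sn l).
  rewrite !coefM_top ?size_comp_poly2 ?size_XaddC // t1 t2 t3 t4 /c; ring.
have cnz : exists t, c t != 0.
  apply: contrapT => H; case/eqP: qkn.
  have /(congr1 (fun p : {poly F} => p`_k)) : cp = 0.
    apply: poly_fun0 => t _; rewrite -cE; apply/eqP; apply: contraT => ct.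
    by case: H; exists t.
  by rewrite coef0 coef_map_id0 /coefp ?coef0.
(* For n > 0 the degree 2n + 1 exceeds n + 1, so the right-hand side of [K] is 0 and [c l * c m]
   vanishes for all l != m. *)
have n0 : n = 0%N.
  case: n => [//|n] in sn qkn c cp cE K cnz *; have [t ct] := cnz; case/eqP: (ct).
  have Z l m : l != m -> c l * c m = 0.
    move=> lm; have := K l m; rewrite [X in _ = _ * X]nth_default; last first.
      by rewrite (leq_trans (sn _)) //; lia.
    rewrite mulr0 -mulrA => /eqP; rewrite mulf_eq0 pnatr_eq0 /= mulf_eq0 subr_eq0
      (negPf lm) /=.
    by move/eqP.
  rewrite cE; suff /(congr1 (fun p : {poly F} => p.[0])) : cp \Po ('X + t%:P) = 0.
    by rewrite horner_comp !hornerE.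
  apply: poly_fun0 => s s0; rewrite horner_comp !hornerE -cE.
  have st : s + t != t by rewrite -subr_eq0 addrK.
  by have /eqP := Z _ _ st; rewrite mulf_eq0 (negPf ct) orbF => /eqP.
subst n.
have c0 : c 0 = 1 by rewrite /c polyC0 Eal coefD coefX coefC addr0.
(* [K] at m = - l gives c(l) c(- l) = 1, so the polynomial c is invertible, hence constant. *)
have c1 l : c l = 1.
  have E : cp * (cp \Po (- 'X)) = 1.
    apply/eqP; rewrite -subr_eq0; apply/eqP; apply: poly_fun0 => s s0.
    rewrite !(hornerE, horner_comp) -!cE; apply/eqP; rewrite subr_eq0; apply/eqP.
    have := K s (- s); rewrite subrr opprK mul1r -/(c 0) c0; apply: mulfI.
    by rewrite -mulr2n mulrn_eq0.
  have /size_poly1P[a _ Ea] : size cp == 1%N.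
    by have := size_mul_eq1 cp (cp \Po (- 'X)); rewrite E size_poly1 eqxx => /esym/andP[].
  by rewrite -c0 !cE Ea !hornerC.
pose b l := q.[l%:P]`_0.
pose bp := map_poly (coefp 0) q.
have bE l : b l = bp.[l].
  rewrite /b horner_coef coef_sum /bp (@horner_coef_wide _ (size q)); last exact: size_poly.
  apply: eq_bigr => i _; rewrite -polyC_exp coefMC coef_map_id0 //=.
  by rewrite /coefp coef0.
have qE l : q.[l%:P] = 'X + (b l)%:P.
  apply/polyP => -[|[|i]]; rewrite coefD coefX coefC /= ?add0r ?addr0 //; first exact: c1.
  by rewrite nth_default // (leq_trans (sn l)).
have B l m : l * b l - m * b m = (l - m) * b (l + m).
  have := congr1 (fun p : {poly F} => p.[0]) (J l m); rewrite !qE.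
  by rewrite !(hornerE, horner_comp) => E; apply: (eq_comb E); ring.
(* The derivative of [B] in m at m = 0; this equation leaves only affine solutions b. *)
have D : 'X * bp^`() = bp - (bp.[0])%:P.
  apply/eqP; rewrite -subr_eq0; apply/eqP; apply: poly_fun0 => l _.
  pose H := (l * b l)%:P - 'X * bp - (l%:P - 'X) * (bp \Po ('X + l%:P)).
  have H0 : H = 0.
    apply: poly_fun0 => m _; rewrite /H !(hornerE, horner_comp) -!bE [m + l]addrC.
    by apply: (eq_comb (B l m)); ring.
  have := congr1 (fun q : {poly F} => q^`().[0]) H0.
  rewrite /H /= deriv0 horner0 !(derivN, derivD, derivM, derivC, derivZ, derivX,
    deriv_comp) !hornerE !horner_comp !hornerE /= => E.
  by apply: (eq_lin1 (-1) E); ring.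
exists bp`_0, bp`_1 => l; rewrite qE bE; congr (_ + _%:P).
have bp2 j : bp`_j.+2 = 0.
  have := congr1 (fun q : {poly F} => q`_j.+2) D;
    rewrite /= coefXM /= coef_deriv coefB coefC /= subr0.
  move/eqP; rewrite -subr_eq0 -mulr_natr -[X in _ - X]mulr1 -mulrBr -natr1 addrK.
  by rewrite mulf_eq0 pnatr_eq0 orbF => /eqP.
rewrite (@horner_coef_wide _ 2); last by apply/leq_sizeP => -[|[|j]] // _.
by rewrite !big_ord_recr big_ord0 /= add0r expr0 expr1 mulr1.
Qed.
End WeightFunctions.

(** * Homogeneous components *)

Section VirasoroGrading.
Variables (F : numFieldType) (L : conformal F) (G : int -> submodClosed L).
Hypothesis HL : lie_conformal L.
Hypothesis HG : graded G.
Hypothesis HS : graded_simple G.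
Hypothesis Hrank : forall i, exists n : nat, has_rank (submod (G i)) n /\ (n <= 1)%N.
Variable e0 : L.
Hypothesis e0G : e0 \in G 0.
Hypothesis G0e : forall x, x \in G 0 -> exists p, x = p *: e0.
Hypothesis e0_free : forall p, p *: e0 = 0 -> p = 0.
Hypothesis e0e0 : forall l, br e0 e0 l = ('X + (2%:R * l)%:P) *: e0.

Lemma torsion_free p (x : L) : p *: x = 0 -> (p == 0) || (x == 0).
Proof.
have [p0|p0 px] := eqVneq p 0 => //=.
have [|||H|H] := graded_ideal HL HG HS (Q := fun i x => exists2 p, p != 0 & p *: x = 0).
- by move=> i; exists 1; rewrite ?oner_eq0 // scaler0.
- move=> i q u v [p1 p10 pu] [p2 p20 pv]; exists (p1 * p2); first by rewrite mulf_neq0.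
  rewrite scalerDr -[X in _ + X]scalerA pv scaler0 addr0 scalerA.
  by rewrite (_ : _ * q = (p2 * q) * p1) -?scalerA ?pu ?scaler0 //; ring.
- move=> i j a u _ _ [q q0 qu] l; exists 1; first by rewrite oner_eq0.
  by rewrite (torsion_central HL q0 qu) scaler0.
- have [s [_ _ ->]] := component_sumE HG x.
  rewrite big1 // => i _; apply: (H i); first exact: component_in.
  by exists p => //; rewrite -[_ *: _]addr0 -(component0 HG i) -componentZD addr0 px
    component0.
- by have [q q0 /e0_free qe] := H _ _ e0G; rewrite qe eqxx in q0.
Qed.

Lemma scale_inj p q (x : L) : x != 0 -> p *: x = q *: x -> p = q.
Proof.
move=> x0 /eqP; rewrite -subr_eq0 -scalerBl => /eqP/torsion_free.
by rewrite (negPf x0) orbF subr_eq0 => /eqP.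
Qed.

Lemma G_dependent i x y : x \in G i -> y \in G i ->
  exists p q, ((p != 0) || (q != 0)) /\ p *: x = q *: y.
Proof.
move=> Gx Gy; have [n [Hn n1]] := Hrank i.
have tf (p : {poly F}) (u : submod (G i)) : p *: u = 0 -> (p == 0) || (u == 0).
  by move=> /(congr1 val)/torsion_free.
have [p [q [pq E]]] := rank1_dependent tf Hn n1 (exist _ x Gx : submod (G i)) (exist _
  y Gy).
exists p, q; split=> //.
exact: (congr1 val E).
Qed.

Lemma G_generator i x : x \in G i -> bracket e0 x != 0 ->
  exists v, [/\ v \in G i, v != 0, bracket e0 v != 0 &
    forall y, y \in G i -> exists p, y = p *: v].
Proof.
move=> Gx bx.
pose Pd N := `[< exists2 v, v \in G i & has_deg (bracket e0 v) N >].
have exP : exists N, Pd N.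
  by have [N HN] := has_deg_ex bx; exists N; apply/asboolP; exists x.
case: (ex_minnP exP) => N /asboolP[v Gv dv] minN.
have bv : bracket e0 v != 0.
  by case: dv => dv _; apply: contra_neq dv => ->; rewrite mcoeff0.
have b0 : bracket e0 (0 : L) = 0.
  by apply: ev_eq0 => m; rewrite -/(br _ _ _) br0r.
have v0 : v != 0 by apply: contra_neq bv => ->.
(* v minimizes the degree of its bracket with e0, so division leaves no remainder *)
exists v; split=> // y Gy; have [p [q [pq E]]] := G_dependent Gy Gv.
have p0 : p != 0.
  apply/eqP => p0; move: pq E; rewrite p0 eqxx scale0r /= => q0 /esym/torsion_free.
  by rewrite (negPf q0) (negPf v0).
exists (q %/ p).
have Gr : y - (q %/ p) *: v \in G i by rewrite -scaleNr; apply: rpredD => //; exact: rpredZ.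
have Er : p *: (y - (q %/ p) *: v) = (q %% p) *: v.
  rewrite scalerBr E scalerA -scalerBl; congr (_ *: _).
  by rewrite {1}(divp_eq q p); ring.
have [r0|r0] := eqVneq (q %% p) 0.
  move: Er; rewrite r0 scale0r => /torsion_free; rewrite (negPf p0) /= subr_eq0.
  by move/eqP.
have dr := has_deg_brZr HL r0 dv; rewrite -Er in dr.
have br0' : bracket e0 (y - (q %/ p) *: v) != 0.
  apply/eqP => b'.
  have /has_deg_ex[M HM] : bracket e0 (p *: (y - (q %/ p) *: v)) != 0.
    by case: dr => dr _; apply: contra_neq dr => ->; rewrite mcoeff0.
  have Z : bracket e0 (p *: (y - (q %/ p) *: v)) = 0.
    by apply: ev_eq0 => l; rewrite -/(br _ _ _) brZr // /br b' /ev evK0 scaler0.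
  by case: HM; rewrite Z mcoeff0 eqxx.
have [M HM] := has_deg_ex br0'.
have := has_deg_uniq (has_deg_brZr HL p0 HM) dr.
have : (N <= M)%N by apply: minN; apply/asboolP; exists (y - (q %/ p) *: v).
have := ltn_modp q p; rewrite p0.
have : (0 < size (q %% p : {poly F})%R)%N by rewrite size_poly_gt0.
by move: (size (_ %% _)) (size p) => a b; clear; lia.
Qed.

Lemma bracket_poly (a b v : L) : (forall n, exists t : {poly F},
  (bracket a b)@_n = t *: v) ->
  exists q : {poly {poly F}}, (forall l, br a b l = q.[l%:P] *: v) /\
    forall l, br b a l = - (q.[- l%:P - 'X] *: v).
Proof.
move=> /choice[t Ht]; have [N HN] := ev_bound (bracket a b).
pose q := \sum_(n <- msupp (bracket a b)) t n *: 'X^n : {poly {poly F}}.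
have qE (z : {poly F}) : q.[z] *: v = \sum_(n <- msupp (bracket a b)) z ^+ n *:
  (bracket a b)@_n.
  rewrite horner_sum scaler_suml; apply: eq_bigr => n _.
  by rewrite hornerZ hornerXn Ht scalerA mulrC.
exists q; split=> l; rewrite qE; last exact: br_skew.
by rewrite brE; apply: eq_bigr => n _; rewrite polyC_exp.
Qed.

Lemma G_weight i v : v \in G i -> v != 0 -> bracket e0 v != 0 ->
  (forall y, y \in G i -> exists p, y = p *: v) ->
  exists al de, forall l, br e0 v l = ('X + (al + de * l)%:P) *: v.
Proof.
move=> Gv v0 bv gen.
have [n|q [Hq _]] := @bracket_poly e0 v v.
  by apply: gen; have := HG.2 0 i e0 v e0G Gv n; rewrite add0r.
have [|l m|al [de H]] := @weight_function _ q.
- by apply: contra_neq bv => q0; apply: ev_eq0 => l;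
  rewrite -/(br _ _ _) Hq q0 horner0 scale0r.
- apply: (scale_inj v0).
  have := br_jacobi HL e0 e0 v l m; rewrite !Hq e0e0 brZl // !brZr // !Hq !scalerA.
  move=> /eqP; rewrite -subr_eq -scalerBl => /eqP ->.
  congr (_ *: _); congr (_ * _); rewrite hornerD hornerX hornerC; congr (_%:P); ring.
- by exists al, de => l; rewrite Hq H.
Qed.

Lemma G_dichotomy i : (forall x, x \in G i -> bracket e0 x = 0) \/
  exists v al de, [/\ v \in G i, v != 0, forall y, y \in G i -> exists p, y = p *: v &
    forall l, br e0 v l = ('X + (al + de * l)%:P) *: v].
Proof.
have [[x [Gx bx]]|H] := pselect (exists x, x \in G i /\ bracket e0 x != 0); last first.
  by left=> x Gx; apply/eqP; apply: contraT => bx; case: H; exists x.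
right; have [v [Gv v0 bv gen]] := G_generator Gx bx.
by have [al [de H]] := G_weight Gv v0 bv gen; exists v, al, de.
Qed.

(* The elements annihilated by e0 form a graded ideal: if br e0 x = 0, the Jacobi
   identity at l = 0 gives d + al' = al - m on br v x m, which must vanish. *)
Lemma trivial_eq0 i x : x \in G i -> (forall l, br e0 x l = 0) -> x = 0.
Proof.
have e00 : e0 != 0.
  apply/eqP => e00; have /e0_free/eqP : (1 : {poly F}) *: e0 = 0 by rewrite e00 scaler0.
  by rewrite oner_eq0.
have [|||H|H] := graded_ideal HL HG HS (Q := fun i x => forall l, br e0 x l = 0).
- by move=> j l; rewrite br0r.
- by move=> j p u v Hu Hv l; rewrite brDr // brZr // Hu Hv scaler0 addr0.
- move=> j k a u Ga Gu Hu m l.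
  have E a' : br e0 (br a' u m) l = br (br e0 a' l) u (l + m).
    by rewrite (br_jacobi HL) Hu br0r // addr0.
  case: (G_dichotomy j) => [/(_ a Ga) b0|[v [al [de [Gv v0 gen Hv]]]]].
    by rewrite E /(br e0 a) b0 /ev evK0 br0l.
  have [p ->] := gen _ Ga; rewrite brZl // brZr // [X in _ *: X](_ : _ = 0) ?scaler0 //.
  case: (G_dichotomy (j + k)) => [b0|[v' [al' [de' [Gv' v'0 gen' Hv']]]]].
    by rewrite /br b0 /ev ?evK0 //; exact: G_br.
  suff -> : br v u m = 0 by rewrite br0r.
  have [q Eq] : exists q, br v u m = q *: v' by apply: gen'; exact: G_br.
  have := br_jacobi HL e0 v u 0 m; rewrite Hu br0r // addr0 Hv brZl // add0r Eq brZr // Hv'.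
  rewrite mulr0 !addr0 comp_polyXr !scalerA => /(scale_inj v'0) /eqP.
  rewrite mulrC -subr_eq0 -mulrBl mulf_eq0 subr_eq0 => /orP[/eqP/polyP/(_ 1%N)|/eqP->];
    last exact: scale0r.
  rewrite coefD coefX !coefC /= addr0 => /eqP; by rewrite oner_eq0.
- by move=> Gx Hx; exact: (H i).
- have /(_ 0) := H 0 e0 e0G; rewrite e0e0 => /eqP/eqP/torsion_free.
  by rewrite (negPf e00) orbF mulr0 addr0 polyX_eq0.
Qed.

(** A zero component receives the generator 0 and the default numbers 0, so that the support is the
    set of i with [e i != 0]. *)
Lemma G_basis : exists (e : int -> L) (al de : int -> F),
  [/\ e 0 = e0 /\ al 0 = 0 /\ de 0 = 2%:R, forall i, e i \in G i,
      forall i y, y \in G i -> exists p, y = p *: e i &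
      forall i l, br e0 (e i) l = ('X + (al i + de i * l)%:P) *: e i].
Proof.
have : forall i, exists u : L * (F * F), [/\ u.1 \in G i,
    forall y, y \in G i -> exists p, y = p *: u.1,
    forall l, br e0 u.1 l = ('X + (u.2.1 + u.2.2 * l)%:P) *: u.1 &
    i = 0 -> u = (e0, (0, 2%:R))].
  move=> i; have [->|i0] := eqVneq i 0.
    exists (e0, (0, 2%:R)); split=> //= l; by rewrite e0e0 add0r.
  case: (G_dichotomy i) => [b0|[v [al [de [Gv v0 gen Hv]]]]]; last first.
    by exists (v, (al, de)); split=> // i0'; rewrite i0' eqxx in i0.
  exists (0, (0, 0)); split=> [|y Gy|l|i0'] /=; first exact: rpred0.
  - exists 0; rewrite scale0r; apply: (trivial_eq0 Gy) => l.
    by rewrite /br b0 // /ev evK0.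
  - by rewrite br0r // scaler0.
  - by rewrite i0' eqxx in i0.
move=> /choice[u Hu]; exists (fun i => (u i).1), (fun i => (u i).2.1), (fun i => (u i).2.2).
split=> [|i|i|i]; try by case: (Hu i).
by case: (Hu 0) => _ _ _ /(_ erefl) ->.
Qed.

End VirasoroGrading.

(** * Recognition of free Lie conformal algebras *)

Section FreeModules.
Variables (F : numFieldType) (I : choiceType) (A : lmodType {poly F}) (b : I -> A).
Local Notation M := {malg {poly F}[I]}.

Definition combination (a : M) : A := \sum_(i <- msupp a) a@_i *: b i.

Lemma combinationw (d : {fset I}) (a : M) : (msupp a `<=` d)%fset ->
  combination a = \sum_(i <- d) a@_i *: b i.
Proof.
move=> le; rewrite /combination (big_fset_incl _ le) // => k _ /mcoeff_outdom ->.
by rewrite scale0r.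
Qed.

Lemma combination_linear : linear combination.
Proof.
move=> p x y; pose d := (msupp x `|` msupp y `|` msupp (p *: x + y))%fset.
rewrite (@combinationw d (p *: x + y)) ?fsubsetUr //.
rewrite (@combinationw d x); last by rewrite /d -fsetUA fsubsetUl.
rewrite (@combinationw d y); last by rewrite /d [(msupp x `|` _)%fset]fsetUC -fsetUA
  fsubsetUl.
rewrite scaler_sumr -big_split /=; apply: eq_bigr => i _.
by rewrite mcoeffD mcoeffZ scalerDl scalerA.
Qed.
HB.instance Definition _ := GRing.isLinear.Build {poly F} M A *:%R combination
  combination_linear.

Lemma combination_gen i : combination (gen F i) = b i.
Proof.
rewrite (combinationw msuppU_le) big_seq_fset1.
by rewrite mcoeffUU scale1r.
Qed.

End FreeModules.

Section FreeConformal.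
Variables (F : numFieldType) (I : choiceType).
Variable t : I -> I -> {malg {malg {poly F}[I]}[nat]}.

Lemma peval_horner (p : {poly F}) (q : {poly {poly F}}) l :
  (peval p q).[l%:P] = (map_poly polyC p).[q.[l%:P]].
Proof.
have E : peval p q = (map_poly (polyC \o polyC) p).[q] by [].
rewrite E; elim/poly_ind: p {E} => [|p c IH]; first by rewrite !rmorph0 !horner0.
by rewrite !rmorphD !rmorphM /= !map_polyX !map_polyC /= !hornerE IH.
Qed.

Lemma peval_lam (p : {poly F}) l : (peval p (- lam)).[l%:P] = p.[- l]%:P.
Proof.
rewrite peval_horner /lam hornerN hornerX -polyCN.
by rewrite horner_map.
Qed.

Lemma peval_dl (p : {poly F}) l : (peval p (dl + lam)).[l%:P] = p \Po ('X + l%:P).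
Proof. by rewrite peval_horner /lam /dl hornerD hornerX hornerC. Qed.

Lemma br_free (a b : free_conformal t) l :
  br a b l = \sum_(i <- msupp a) \sum_(j <- msupp b)
    ((a@_i).[- l]%:P * (b@_j \Po ('X + l%:P))) *: ev l (t i j).
Proof.
rewrite /br /= /ev evK_sum; apply: eq_bigr => i _.
rewrite evK_sum; apply: eq_bigr => j _.
by rewrite -/(ev l _) ev_pact hornerM peval_lam peval_dl.
Qed.

Variables (L : conformal F) (b : I -> L).
Hypothesis HL : lie_conformal L.
Hypothesis span_b : forall x, exists a, x = combination b a.
Hypothesis free_b : forall a, combination b a = 0 -> a = 0.
Hypothesis table_b : forall i j l, br (b i) (b j) l = combination b (ev l (t i j)).

Lemma isomorphic_free : isomorphic L (free_conformal t).
Proof.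
pose g := combination b.
have ginj : injective g.
  move=> x y E; apply/eqP; rewrite -subr_eq0; apply/eqP; apply: free_b.
  by rewrite linearB /= -/g E subrr.
have /choice[f fK] : forall x, exists a, x = g a by [].
have gK : cancel g f by move=> x; apply: ginj; rewrite -fK.
have lf : linear f.
  by move=> p x y; apply: ginj; rewrite -fK /g [RHS]combination_linear -/g -!fK.
pose fl : {linear L -> free_conformal t} :=
  HB.pack f (GRing.isLinear.Build {poly F} L (free_conformal t) *:%R f lf).
exists fl; split; first by exists g => x //=; rewrite -fK.
move=> x y n; apply: ginj; rewrite /= -/g -fK.
have gS (J : Type) (r : seq J) (h : J -> free_conformal t) :
    g (\sum_(j <- r) h j) = \sum_(j <- r) g (h j).
  exact: (linear_sum (combination b)).
have gZ p (u : free_conformal t) : g (p *: u) = p *: g u by exact: (linearZ_LR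
  (combination b)).
have H l : br x y l = g (br (fl x) (fl y) l).
  rewrite br_free {1}(fK x) {1}(fK y) [in LHS]/g [in LHS]/combination br_suml // gS.
  apply: eq_bigr => i _; rewrite br_sumr // gS; apply: eq_bigr => j _.
  by rewrite brZl // brZr // table_b scalerA gZ.
have [N HN] := ev_bound (bracket x y); have [M HM] := ev_bound (bracket (fl x) (fl y)).
apply/eqP; rewrite -subr_eq0; apply/eqP.
have [le|lt] := leqP (maxn N M) n.
  rewrite geq_max in le; case/andP: le => /HN -> /HM ->.
  by rewrite /g linear0 subrr.
apply: (@vpoly0 _ _ (maxn N M) (fun n => (bracket x y)@_n - g (bracket (fl x) (fl
  y))@_n)) => // l.
under eq_bigr => i _ do rewrite scalerBr -linearZ.
rewrite sumrB -linear_sum -(evE (N := maxn N M)); last by move=> k;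
  rewrite geq_max => /andP[/HN].
rewrite -(evE (N := maxn N M)); last by move=> k; rewrite geq_max => /andP[_ /HM].
by rewrite -!/(br _ _ _) H subrr.
Qed.

End FreeConformal.

Lemma ev_psubst_pscale (F : numFieldType) (A : lmodType {poly F}) l
    (p q : {poly {poly F}}) (a : A) :
  ev l (psubst p (pscale q a)) = q.[p.[l%:P]] *: a.
Proof.
pose d := [fset n | n in iota 0 (size q)]%fset.
have le : (msupp (pscale q a) `<=` d)%fset.
  apply/fsubsetP => n; rewrite -mcoeff_neq0 coef_pscale => nf;
    rewrite inE /= mem_iota /= add0n.
  by rewrite ltnNge; apply: contraNN nf => /(nth_default 0) ->; rewrite scale0r.
rewrite ev_psubst (big_fset_incl _ le) => [|n _ /mcoeff_outdom ->]; last by rewrite scaler0.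
have -> : \sum_(n <- d) p.[l%:P] ^+ n *: (pscale q a)@_n =
    \sum_(n <- iota 0 (size q)) p.[l%:P] ^+ n *: (pscale q a)@_n.
  by apply: perm_big; rewrite uniq_perm ?iota_uniq ?fset_uniq // => n; rewrite inE.
rewrite -[X in iota _ X]subn0 -/(index_iota _ _) big_mkord [q.[_]]horner_coef scaler_suml.
by apply: eq_bigr => n _; rewrite coef_pscale scalerA mulrC.
Qed.

Section Identification.
Variables (F : numFieldType) (L : conformal F) (G : int -> submodClosed L).
Hypothesis HL : lie_conformal L.
Hypothesis HG : graded G.
Hypothesis tf : forall (p : {poly F}) (x : L), p *: x = 0 -> (p == 0) || (x == 0).
Variables (e : int -> L) (q : int -> int -> {poly {poly F}}).
Hypothesis eG : forall i, e i \in G i.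
Hypothesis Ge : forall i y, y \in G i -> exists p, y = p *: e i.
Hypothesis bre : forall i j l, br (e i) (e j) l = (q i j).[l%:P] *: e (i + j).
Variables (I : choiceType) (h : I -> int) (c : I -> F).
Hypothesis h_inj : injective h.
Hypothesis c0 : forall i, c i != 0.
Hypothesis eh : forall j, e j != 0 <-> exists i, j = h i.

Let b i := (c i)%:P *: e (h i).

Lemma basis_span x : exists a, x = combination b a.
Proof.
have H j y : y \in G j -> exists a, y = combination b a.
  move=> /Ge[p ->]; have [->|/eh[i ->]] := eqVneq (e j) 0.
    by exists 0; rewrite scaler0 linear0.
  exists ((p * (c i)^-1%:P) *: gen F i).
  by rewrite linearZ /= combination_gen /b scalerA -mulrA -polyCM mulVf // mulr1.
have [s [_ _ ->]] := component_sumE HG x.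
have /choice[a Ha] : forall j, exists a, component HG x j = combination b a.
  by move=> j; apply: (H j); exact: component_in.
by exists (\sum_(j <- s) a j); rewrite linear_sum; apply: eq_bigr => j _.
Qed.

Lemma basis_free a : combination b a = 0 -> a = 0.
Proof.
move=> a0; apply/malgP => k; rewrite mcoeff0.
have [ka|/mcoeff_outdom //] := boolP (k \in msupp a).
have bG i : a@_i *: b i \in G (h i) by do 2!apply: rpredZ; exact: eG.
have : component HG (combination b a) (h k) = 0 by rewrite a0 component0.
rewrite /combination component_sum (big_fsetD1 k ka) /=.
rewrite (component_homog HG _ (bG k)) eqxx big_seq big1 ?addr0 => [|i]; last first.
  rewrite !inE => /andP[ik _]; rewrite (component_homog HG _ (bG i)).
  by rewrite (inj_eq h_inj) eq_sym (negPf ik).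
have ek : e (h k) != 0 by apply/eh; exists k.
rewrite /b scalerA => /tf; rewrite (negPf ek) orbF mulf_eq0 polyC_eq0 (negPf (c0 k)) orbF.
by move/eqP.
Qed.

(** The first alternative serves [CL1], where the sum of the indices -1 and -1 leaves the index
    set. *)
Lemma isomorphic_table (t : I -> I -> {malg {malg {poly F}[I]}[nat]}) :
  (forall i j, (e (h i + h j) = 0 /\ forall l, ev l (t i j) = 0) \/
    exists k (r : F -> {poly F}), [/\ h k = h i + h j,
      forall l, ev l (t i j) = r l *: gen F k &
      forall l y, c i * c j * (q (h i) (h j)).[l%:P].[y] = c k * (r l).[y]]) ->
  isomorphic L (free_conformal t).
Proof.
move=> Ht; apply: (isomorphic_free HL basis_span basis_free) => i j l.
rewrite /b brcl // brcr // bre; case: (Ht i j) => [[-> ->]|[k [r [hk -> E]]]].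
  by rewrite !scaler0 linear0.
rewrite [RHS]linearZ /= combination_gen /b hk !scalerA; congr (_ *: _).
apply/eqP; rewrite -subr_eq0; apply/eqP; apply: poly_fun0 => y _.
by rewrite !hornerE E; ring.
Qed.

End Identification.

(** * Structure functions *)

Section BivariatePolynomials.
Variable F : numFieldType.
Implicit Types f g : F -> F -> F.

Definition isbipoly f := exists p : {poly {poly F}}, forall a b, f a b = p.[b%:P].[a].

Lemma isbipoly_cst c : isbipoly (fun _ _ => c).
Proof. by exists c%:P%:P => a b; rewrite !hornerC. Qed.

Lemma isbipoly_fst : isbipoly (fun a _ => a).
Proof. by exists 'X%:P => a b; rewrite hornerC hornerX. Qed.

Lemma isbipoly_snd : isbipoly (fun _ b => b).
Proof. by exists 'X => a b; rewrite hornerX hornerC. Qed.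

Lemma isbipolyD f g : isbipoly f -> isbipoly g -> isbipoly (fun a b => f a b + g a b).
Proof. by move=> [p Hp] [q Hq]; exists (p + q) => a b; rewrite Hp Hq !hornerD. Qed.

Lemma isbipolyN f : isbipoly f -> isbipoly (fun a b => - f a b).
Proof. by move=> [p Hp]; exists (- p) => a b; rewrite Hp !hornerN. Qed.

Lemma isbipolyM f g : isbipoly f -> isbipoly g -> isbipoly (fun a b => f a b * g a b).
Proof. by move=> [p Hp] [q Hq]; exists (p * q) => a b; rewrite Hp Hq !hornerM. Qed.

Lemma isbipoly_comp1 (p : {poly F}) f : isbipoly f -> isbipoly (fun a b => p.[f a b]).
Proof.
move=> Hf; elim/poly_ind: p => [|p c IH].
  by have [r Hr] := isbipoly_cst 0; exists r => a b; rewrite -Hr horner0.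
have [r Hr] := isbipolyD (isbipolyM IH Hf) (isbipoly_cst c).
by exists r => a b; rewrite -Hr hornerMXaddC.
Qed.

Lemma isbipoly_comp2 (p : {poly {poly F}}) f g : isbipoly f -> isbipoly g ->
  isbipoly (fun a b => p.[(f a b)%:P].[g a b]).
Proof.
move=> Hf Hg; elim/poly_ind: p => [|p c IH].
  by have [r Hr] := isbipoly_cst 0; exists r => a b; rewrite -Hr !horner0.
have [r Hr] := isbipolyD (isbipolyM IH Hf) (isbipoly_comp1 c Hg).
by exists r => a b; rewrite -Hr hornerMXaddC hornerD hornerM hornerC.
Qed.

Lemma horner2 (p : {poly {poly F}}) (z : {poly F}) x : p.[z].[x] = p.[(z.[x])%:P].[x].
Proof.
elim/poly_ind: p => [|p c IH]; first by rewrite !horner0.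
by rewrite !hornerMXaddC !hornerD !hornerM IH hornerC.
Qed.

End BivariatePolynomials.

Lemma horner_int (R : nzRingType) (k : int) (x : R) : (k%:~R : {poly R}).[x] = k%:~R.
Proof. by rewrite -(rmorph_int (@polyC R)) hornerC. Qed.

Lemma horner_nat (R : nzRingType) (k : nat) (x : R) : (k%:R : {poly R}).[x] = k%:R.
Proof. by rewrite -(rmorph_nat (@polyC R)) hornerC. Qed.

Definition symbE :=
  (hornerD, hornerM, hornerN, hornerX, hornerC, horner_int, horner_nat).

Section StructureFunctions.
Variables (F : numFieldType) (L : conformal F) (G : int -> submodClosed L).
Hypothesis HL : lie_conformal L.
Hypothesis HG : graded G.
Hypothesis HS : graded_simple G.
Hypothesis tf : forall (p : {poly F}) (x : L), p *: x = 0 -> (p == 0) || (x == 0).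
Variables (e : int -> L) (al de : int -> F) (q : int -> int -> {poly {poly F}}).
Hypothesis e00 : e 0 != 0.
Hypothesis al0 : al 0 = 0.
Hypothesis de0 : de 0 = 2%:R.
Hypothesis eG : forall i, e i \in G i.
Hypothesis Ge : forall i y, y \in G i -> exists p, y = p *: e i.
Hypothesis br0e : forall i l, br (e 0) (e i) l = ('X + (al i + de i * l)%:P) *: e i.
Hypothesis bre : forall i j l, br (e i) (e j) l = (q i j).[l%:P] *: e (i + j).
Hypothesis bre_skew : forall i j l, br (e j) (e i) l = - ((q i j).[- l%:P - 'X] *: e (i
  + j)).
Hypothesis q0 : forall i j, q i j != 0 -> [/\ e i != 0, e j != 0 & e (i + j) != 0].

(* a + al i and b + al j are the formal variables attached to e i and e j, that is
   l and - l - d. *)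
Definition homog_symbol i j a b := - (q i j).[(a + al i)%:P].[- a - b - al i - al j].
Local Notation P := homog_symbol.
Local Notation phi i j l x := (q i j).[l%:P].[x].
Local Notation w i := (1 - de i).

Lemma e_inj i p r : e i != 0 -> p *: e i = r *: e i -> p = r.
Proof.
move=> ei /eqP; rewrite -subr_eq0 -scalerBl => /eqP/tf.
by rewrite (negPf ei) orbF subr_eq0 => /eqP.
Qed.

Lemma q_neq0 i j : nz (P i j) -> q i j != 0.
Proof. by move=> [a [b]]; rewrite /P; apply: contra_neq => ->; rewrite !horner0 oppr0. Qed.

Lemma phi0 j l x : e j != 0 -> phi 0 j l x = x + al j + de j * l.
Proof.
move=> ej; have := br0e j l; rewrite bre add0r => /(e_inj ej) ->.
by rewrite hornerD hornerX hornerC addrA.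
Qed.

Lemma phi_skew i j l x : phi i j l x = - phi j i (- l - x) x.
Proof.
have Z i' j' : q i' j' = 0 -> phi i' j' l x = - phi j' i' (- l - x) x.
  move=> qij; rewrite qij !horner0.
  have [->|/q0[ej ei eji]] := eqVneq (q j' i') 0; first by rewrite !horner0 oppr0.
  have Z m : (q j' i').[m%:P] = 0.
    have := bre_skew i' j' m; rewrite bre qij horner0 scale0r oppr0 => /tf.
    by rewrite (negPf eji) orbF => /eqP.
  by rewrite Z horner0 oppr0.
have [/Z//|/q0[ei ej eij]] := eqVneq (q i j) 0.
have := bre_skew j i l; rewrite bre -scaleNr [j + i]addrC => /(e_inj eij) ->.
by rewrite hornerN [in LHS]horner2 !hornerE.
Qed.

Lemma phi_jacobi i j k l m x :
  phi j k m (x + l) * phi i (j + k) l x =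
  phi i j l (- l - m) * phi (i + j) k (l + m) x + phi i k l (x + m) * phi j (i + k) m x.
Proof.
have [z|nz0] := eqVneq (e (i + j + k)) 0.
  have Z a b : a + b = i + j + k -> q a b = 0.
    by move=> ab; apply/eqP; apply: contraT => /q0[_ _]; rewrite ab z eqxx.
  rewrite (Z i (j + k)) ?(Z (i + j) k) ?(Z j (i + k)) ?horner0 ?mulr0 ?addr0 //; ring.
have := br_jacobi HL (e i) (e j) (e k) l m.
rewrite !bre brZl // !brZr // !bre !scalerA (_ : j + (i + k) = i + j + k); last by ring.
rewrite addrA -scalerDl => /(e_inj nz0)/(congr1 (fun p : {poly F} => p.[x])).
by rewrite !hornerE !horner_comp !hornerE opprD.
Qed.

Lemma nz_poly (p : {poly {poly F}}) : p != 0 -> exists l x, p.[l%:P].[x] != 0.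
Proof.
move=> p0; apply: contrapT => H; case/eqP: p0; apply: bipoly0 => a b.
by apply/eqP; apply: contraT => pab; case: H; exists b, a.
Qed.

(** At l = 0, L_0 acts on the generators by d + al and is a derivation of the bracket; a nonzero
    bracket can be cancelled. *)
Lemma al_add i j : q i j != 0 -> al (i + j) = al i + al j.
Proof.
move=> qij; have [ei ej eij] := q0 qij; have [m [x pmx]] := nz_poly qij.
have := phi_jacobi 0 i j 0 m x; rewrite !phi0 // !add0r addr0 => E.
by apply: (mulfI pmx); apply: (eq_comb E); ring.
Qed.

Lemma symbol0 j a b : e j != 0 -> P 0 j a b = b + w j * a.
Proof. by move=> ej; rewrite /P phi0 // al0; ring. Qed.

Lemma symbol_anti i j a b : P i j a b = - P j i b a.
Proof.
rewrite /P phi_skew !opprK; congr (_.[_%:P].[_]); ring.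
Qed.

Lemma symbol_jacobi i j l a b c :
  P j l b c * P i (j + l) a (b + c) =
  P i j a b * P (i + j) l (a + b) c + P i l a c * P j (i + l) b (a + c).
Proof.
pose la := a + al i; pose m := b + al j; pose x := - a - b - c - al i - al j - al l.
have sub i' j' a' b' (y : F) : - a' - b' - al i' - al j' = y -> P i' j' a' b' = - phi
  i' j' (a' + al i') y.
  by rewrite /P => ->.
(* The arguments of the outer symbols match only if al is additive, which is known when the inner
   symbol is nonzero; otherwise both products are 0. *)
have mul i' j' a' b' y (r s : F) : - a' - b' - al i' - al j' = y ->
    (q i' j' != 0 -> r = s) -> P i' j' a' b' * r = - phi i' j' (a' + al i') y * s.
  move=> /sub ->; have [->|qij /(_ isT) ->] := eqVneq (q i' j') 0; last by [].
  by rewrite !horner0 oppr0 !mul0r.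
have E := phi_jacobi i j l la m x.
rewrite (mul j l b c (x + la) _ (- phi i (j + l) la x)); first last.
- by move=> /al_add E'; rewrite (sub _ _ _ _ x) // E' /x; ring.
- by rewrite /x /la; ring.
rewrite (mul i j a b (- la - m) _ (- phi (i + j) l (la + m) x)); first last.
- move=> /al_add E'; rewrite (sub _ _ _ _ x); last by rewrite E' /x; ring.
  by congr (- _.[_%:P].[_]); rewrite E' /la /m; ring.
- by rewrite /la /m; ring.
rewrite (mul i l a c (x + m) _ (- phi j (i + l) m x)); first last.
- by move=> /al_add E'; rewrite (sub _ _ _ _ x) // E' /x; ring.
- by rewrite /x /m; ring.
by apply: (eq_comb E); rewrite /la /m; ring.
Qed.

Lemma symbol_support i j : nz (P i j) -> [/\ e i != 0, e j != 0 & e (i + j) != 0].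
Proof. by move/q_neq0/q0. Qed.

Lemma symbol_deg i j : nz (P i j) ->
  exists2 k : nat, hform k (P i j) & w (i + j) = w i + w j + k%:R.
Proof.
move=> nzP; have [ei ej eij] := symbol_support nzP.
have [p Hp] : isbipoly (P i j).
  apply: isbipolyN; apply: isbipoly_comp2.
    by apply: isbipolyD; [exact: isbipoly_fst | exact: isbipoly_cst].
  apply: isbipolyD; last exact: isbipoly_cst.
  apply: isbipolyD; last exact: isbipoly_cst.
  by apply: isbipolyD; apply: isbipolyN; [exact: isbipoly_fst | exact: isbipoly_snd].
apply: (cov_hform Hp _ nzP) => a b c.
have := symbol_jacobi 0 i j a b c; rewrite !add0r !symbol0 // => E.
by apply: (eq_comb E); ring.
Qed.

Lemma nz_symbol i j : q i j != 0 -> nz (P i j).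
Proof.
move=> /nz_poly[l [x plx]]; exists (l - al i), (- l - x - al j).
rewrite (_ : P i j _ _ = - (q i j).[l%:P].[x]) ?oppr_eq0 // /P.
by congr (- _.[_%:P].[_]); ring.
Qed.

Lemma symbol_simple (T : int -> Prop) : (exists2 i, e i != 0 & T i) ->
  (forall i j, T i -> nz (P i j) -> T (i + j)) -> forall i, e i != 0 -> T i.
Proof.
move=> [i0 ei0 Ti0] HT i ei.
have [|||H|H] := graded_ideal HL HG HS (Q := fun i x => T i \/ x = 0).
- by right.
- by move=> k p x y [Tk|->] [Tk'|->]; [left|left|left|right; rewrite scaler0 addr0].
- move=> j k a x /Ge[p ->] /Ge[r ->] [Tk|->] l; last by right; rewrite br0r.
  have [qkj|qkj] := eqVneq (q k j) 0; last by left; rewrite addrC; apply: HT => //;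
    exact: nz_symbol.
  by right; rewrite brZl // brZr // bre_skew qkj horner0 scale0r oppr0 !scaler0.
- by case/eqP: ei0; apply: (H i0); [exact: eG | left].
- by case: (H i (e i) (eG i)) => // /eqP; rewrite (negPf ei).
Qed.

(** Vanishing at all (a, - a) means divisibility by d + al_m. If all brackets into degree m were so
    divisible, imposing divisibility in degree m alone would define a proper nonzero graded
    ideal. *)
Lemma symbol_perfect m : e m != 0 ->
  exists j l a, j + l = m /\ P j l a (- a) != 0.
Proof.
move=> em; apply: contrapT => H.
have div (j l : int) (t : F) : j + l = m -> exists p,
  br (e j) (e l) t = (('X + (al m)%:P) * p) *: e m.
  move=> jl; rewrite bre jl; have [->|qjl] := eqVneq (q j l) 0.
    by exists 0; rewrite horner0 mulr0.
  have : root (q j l).[t%:P] (- al m).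
    apply/eqP; have := al_add qjl; rewrite jl => E; apply: contrapT => /eqP nzr; case: H.
    exists j, l, (t - al j); split=> //.
    rewrite (_ : P j l _ _ = - (q j l).[t%:P].[- al m]) ?oppr_eq0 // /P.
    by congr (- _.[_%:P].[_]); rewrite ?E; ring.
  by move=> /factor_theorem[p ->]; exists p; rewrite polyCN opprK mulrC.
have [|||H'|H'] := graded_ideal HL HG HS (Q := fun i x => i = m -> exists p,
  x = (('X + (al m)%:P) * p) *: e m).
- by move=> i _; exists 0; rewrite mulr0 scale0r.
- move=> i p x y Hx Hy im; have [r ->] := Hx im; have [s ->] := Hy im.
  by exists (p * r + s); rewrite scalerA -scalerDl; congr (_ *: _); ring.
- move=> i j a x /Ge[r ->] /Ge[s ->] _ t ij; have [p E] := div i j t ij.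
  by rewrite brZl // brZr // E !scalerA; exists ((s \Po ('X + t%:P)) * r.[- t]%:P * p);
    congr (_ *: _); ring.
- have /tf : ('X + (al m)%:P) *: e m = 0.
    by apply: (H' m); [apply: rpredZ; exact: eG | exists 1; rewrite mulr1].
  by rewrite (negPf em) orbF -size_poly_eq0 size_XaddC.
- have [p] := H' m (e m) (eG m) erefl; rewrite -[X in X = _]scale1r => /(e_inj em).
  move=> /(congr1 (fun p : {poly F} => p.[- al m])); rewrite !hornerE addNr mul0r => /eqP.
  by rewrite oner_eq0.
Qed.

Lemma structure_classification :
  [\/ forall i, e i != 0 -> i = 0,
      exists x mu, cartan_type (fun i => e i != 0) P x mu |
      exists g th mu, line_type (fun i => e i != 0) P g th mu].
Proof.
apply: (@symbol_classification F (fun i => e i != 0) (fun i => 1 - de i) P).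
- exact: e00.
- by rewrite de0; ring.
- exact: symbol_support.
- exact: symbol_deg.
- exact: symbol0.
- exact: symbol_anti.
- exact: symbol_jacobi.
- exact: symbol_simple.
- by move=> m em _; exact: symbol_perfect.
Qed.

(** * Identification with the algebras of the list *)

Lemma phiE i j l x : phi i j l x = - P i j (l - al i) (- x - l - al j).
Proof. by rewrite /P opprK; congr (_.[_%:P].[_]); ring. Qed.

Local Notation iso_table := (isomorphic_table HL HG tf eG Ge bre).

Lemma isomorphic_Vir : (forall i, e i != 0 -> i = 0) -> isomorphic L (Vir F).
Proof.
move=> e1; apply: (@iso_table unit (fun=> 0) (fun=> 1)) => [[] []//|_|j|[] []].
- exact: oner_neq0.
- by split=> [/e1->|[_ ->]]; [exists tt | exact: e00].
right; exists tt, (fun l => (dl + 2%:R * lam).[l%:P]); split=> // [l|l y].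
  by rewrite ev_pscale.
by rewrite phi0 // al0 de0 /dl /lam !symbE; ring.
Qed.

Section Cartan.
Variables (x : int) (mu : int -> F).
Hypothesis Hx : cartan_type (fun i => e i != 0) P x mu.

Lemma cartan_al (n : int) : -1 <= n -> al (n * x) = - n%:~R * al (- x).
Proof.
case: Hx => x0 _ Nx _ _.
have H (k : nat) : al (k%:Z * x) = - k%:R * al (- x).
  elim: k => [|k IH]; first by rewrite mul0r al0; ring.
  have := al_add (q_neq0 (Nx k)); rewrite (_ : - x + k.+1%:Z * x = k%:Z * x);
    last by rewrite intS; ring.
  by rewrite IH => E; apply: (eq_lin1 (-1) E); rewrite -natr1; ring.
case: n => [n _|[_|//]]; first exact: H.
by rewrite NegzE mulN1r; ring.
Qed.

Lemma isomorphic_CL1 : isomorphic L (CL1 (- al (- x))).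
Proof.
have [x0 SE _ [mu0 mu1] Hmu] := Hx.
pose h (u : CL1_index) := val u * x.
have hS (k : int) : -1 <= k -> exists u : CL1_index, val u = k by move=> Hk;
  exists (exist _ k Hk).
have hE j : e j != 0 <-> exists u, j = h u.
  split=> [/SE[n ->]|[u ->]].
    by have [|u Hu] := hS (n%:Z - 1); [lia | exists u; rewrite /h Hu].
  apply/SE; have := valP u; rewrite /h; case: (val u) => n Hn.
    by exists n.+1; congr (_ * _); lia.
  by exists 0; congr (_ * _); lia.
apply: (@iso_table CL1_index h (fun u => mu (val u))) => [u v|u|//|u v]; rewrite ?mu0 //.
  by move/(mulIf x0)/val_inj.
have Hu := valP u; have Hv := valP v; move: Hu Hv; rewrite /h.
set i := val u; set j := val v => Hi Hj.
have [lt|ge] := ltP (i + j) (-1).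
  left; rewrite /CL1_gen insubF; last by rewrite leNgt lt.
  split=> [|l]; last by rewrite ev_pscale scaler0.
  apply/eqP; apply: contraT; rewrite -mulrDl => /SE[n] /(mulIf x0); lia.
have [k Hk] := hS _ ge.
right; exists k, (fun l => (((i + 1)%:~R * dl + (i + j + 2)%:~R * lam + cst (- al (-
  x)) * (j - i)%:~R) : {poly {poly F}}).[l%:P]).
split=> [|l|l y]; first by rewrite Hk mulrDl.
  by rewrite ev_pscale /CL1_gen -Hk valK.
rewrite phiE Hk /dl /lam /cst !symbE.
have E := Hmu i j (l - al (i * x)) (- y - l - al (j * x)) Hi Hj.
by apply: (eq_lin1 (-1) E); rewrite !cartan_al //; ring.
Qed.

End Cartan.

Section Line.
Variables (g : int) (th : F) (mu : int -> F).
Hypothesis Hg : line_type (fun i => e i != 0) P g th mu.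
Local Notation al1 := (al g).
Local Notation h := (fun n : int => n * g).

Lemma line_al (n : int) : al (n * g) = n%:~R * al1.
Proof.
have [_ _ Ng _ _] := Hg.
have S (k : int) : al ((k + 1) * g) = al (k * g) + al1.
  by have := al_add (q_neq0 (Ng k)); rewrite addrC [RHS]addrC -{2}[g]mul1r -mulrDl addrC.
case: n => n; last rewrite NegzE.
  elim: n => [|n IH]; first by rewrite !mul0r al0.
  by rewrite intS addrC S IH intrD mulrDl mul1r.
elim: n.+1 => [|k IH]; first by rewrite oppr0 !mul0r al0.
have := S (- k.+1%:Z); rewrite (_ : - k.+1%:Z + 1 = - k%:Z); last by lia.
by rewrite IH => E; apply: (eq_lin1 (-1) E); rewrite -addn1 PoszD; ring.
Qed.

Lemma line_index j : e j != 0 <-> exists n, j = h n.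
Proof. by case: Hg. Qed.

Lemma line_inj : injective h.
Proof. by case: Hg => g0 *; move=> m n /(mulIf g0). Qed.

Let T (n : int) (a : F) := if n%:~R * th == 2%:R then a else 1.

Lemma line_phi (i j : int) l y :
  mu i * mu j * phi (i * g) (j * g) l y * T (i + j) (- (y + (i + j)%:~R * al1)) =
  - mu (i + j) * T i (l - i%:~R * al1) * T j (- (y + l + j%:~R * al1)) *
    ((j%:~R * th - 1) * (l - i%:~R * al1) + (i%:~R * th - 1) * (y + l + j%:~R * al1)).
Proof.
case: Hg => _ _ _ _ /(_ i j (l - al (i * g)) (- y - l - al (j * g))).
rewrite -/(T _ _) -/(T _ _) -/(T _ _) phiE !line_al.
rewrite (_ : _ + (- y - l - _) = - (y + (i + j)%:~R * al1)); last by ring.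
rewrite [X in T j X](_ : _ = - (y + l + j%:~R * al1)); last by ring.
by move=> E; apply: (eq_lin1 (-1) E); ring.
Qed.

Lemma isomorphic_V : th = 0 -> isomorphic L (V (- al1)).
Proof.
move=> th0; have [_ _ _ [mu0 _] _] := Hg.
apply: (@iso_table int h mu line_inj mu0 line_index) => i j.
right; exists (i + j), (fun l => (dl + 2%:R * lam + cst (- al1) * (i - j)%:~R).[l%:P]).
split=> [|l|l y]; [by rewrite mulrDl | by rewrite ev_pscale |].
have E := line_phi i j l y; rewrite /T th0 !mulr0 eq_sym pnatr_eq0 /= in E.
by rewrite /dl /lam /cst !symbE; apply: (eq_lin1 1 E); ring.
Qed.

Hypothesis th0 : th != 0.
(** With b th = -1, multiplication by b turns n th - 1 into - (n + b). The shifts by [al1] leave the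
    constant term b al1 (j - i), which is s (i - j). *)
Let b := - th^-1.
Let s := - b * al1.

Lemma line_b0 : b != 0.
Proof. by rewrite oppr_eq0 invr_eq0. Qed.

Lemma line_bth : b * th = -1.
Proof. by rewrite mulNr mulVf. Qed.

Lemma line_exc (n : int) : (n%:~R * th == 2%:R) = (n%:~R == - (2%:R * b)).
Proof.
rewrite -(inj_eq (mulIf th0) n%:~R) mulNr -mulrA line_bth mulrN1 opprK.
by [].
Qed.

(* [[L_i, L_j]] in CL2 *)
Let R (i j : int) l y := (i%:~R + b) * y + ((i + j)%:~R + 2%:R * b) * l + s * (i - j)%:~R.

Lemma line_phi_b (i j : int) l y :
  b * mu i * (b * mu j) * phi (i * g) (j * g) l y * T (i + j) (- (y + (i + j)%:~R * al1)) =
  b * mu (i + j) * T i (l - i%:~R * al1) * T j (- (y + l + j%:~R * al1)) * R i j l y.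
Proof.
have E := line_phi i j l y; have B := line_bth.
set ti := T i _ in E *; set tj := T j _ in E *; set tij := T (i + j) _ in E *.
apply: (eq_lin2 (b ^+ 2) (- b * mu (i + j) * ti * tj *
  (j%:~R * (l - i%:~R * al1) + i%:~R * (y + l + j%:~R * al1))) E B).
by rewrite /R /s; ring.
Qed.

Lemma isomorphic_CL2 : ~ (exists k : int, 2%:R * b = k%:~R) -> isomorphic L (CL2 b s).
Proof.
move=> nk; have [_ _ _ [mu0 _] _] := Hg.
have T1 n a : T n a = 1.
  rewrite /T line_exc; case: eqP => // E; case: nk; exists (- n).
  by rewrite intrN E opprK.
apply: (@iso_table int h (fun n => b * mu n) line_inj _ line_index) => [i|i j].
  by rewrite mulf_neq0 ?line_b0.
right; exists (i + j), (fun l => ((i%:~R + cst b) * dl + ((i + j)%:~R + 2%:R * cst b) *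
  lam +
          cst s * (i - j)%:~R).[l%:P]).
split=> [|l|l y]; [by rewrite mulrDl | by rewrite ev_pscale |].
have := line_phi_b i j l y; rewrite !T1 !mulr1 => ->.
by rewrite /R /dl /lam /cst !symbE; ring.
Qed.

Section Exceptional.
Variable k : int.
Hypothesis bk : 2%:R * b = k%:~R.
Local Notation m := (- k).

Lemma exceptional_neq0 : m != 0.
Proof.
rewrite oppr_eq0; apply: contraTneq (line_b0) => k0; rewrite negbK.
by have /eqP := bk; rewrite k0 mulf_eq0 pnatr_eq0.
Qed.

Lemma line_T (n : int) a : T n a = if n == m then a else 1.
Proof. by rewrite /T line_exc bk -intrN eqr_int. Qed.

(* At the exceptional index m = -2b the weight is 0 instead of 1, and the symbols
   of CL2 are divided by d + 2s, up to sign, when m is the target, and multiplied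
   by its analogue in the variable of the argument when m is a source. *)
Let c (n : int) := if n == m then - (b * mu n) else b * mu n.

Let A (i : int) l := if i == m then l - 2%:R * s else 1.
Let B (j : int) l y := if j == m then y + l + 2%:R * s else 1.

Lemma line_scaled_phi (i j : int) l y :
  c i * c j * phi (i * g) (j * g) l y * B (i + j) 0 y =
  c (i + j) * (if i == m then - A i l else 1) * B j l y * R i j l y.
Proof.
have E := line_phi_b i j l y; rewrite !line_T in E.
have M : m%:~R * al1 = 2%:R * s.
  by rewrite intrN -bk /s; ring.
have {}E : b * mu i * (b * mu j) * phi (i * g) (j * g) l y * (if i + j == m then - (y +
  2%:R * s) else 1) =
    b * mu (i + j) * A i l * (if j == m then - (y + l + 2%:R * s) else 1) * R i j l y.
  rewrite /A; move: E; case: (eqVneq (i + j) m) => [->|_]; case: (eqVneq i m) => [->|_];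
  case: (eqVneq j m) => [->|_]; by rewrite ?M.
rewrite /c /A /B; move: E; rewrite /A; case: (i + j == m); case: (i == m);
  case: (j == m) => E;
  by [apply: (eq_lin1 1 E); ring | apply: (eq_lin1 (-1) E); ring].
Qed.

Lemma cancel_shift (p r : {poly F}) z : (forall y,
  p.[y] * (y + z) = r.[y] * (y + z)) -> p = r.
Proof.
move=> H; have z0 : 'X + z%:P != 0 :> {poly F} by rewrite -size_poly_eq0 size_XaddC.
apply: (mulIf z0); apply/eqP; rewrite -subr_eq0; apply/eqP; apply: poly_fun0 => y _.
by rewrite !hornerE H subrr.
Qed.

Lemma exceptional_right (i : int) l y :
  c i * c m * phi (i * g) (m * g) l y = c (i + m) *
    (if i == 0 then b * (y + l + 2%:R * s) else
     if i == m then - b * (- l + 2%:R * s) * (y + l + 2%:R * s) * (y + 2%:R * l) else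
     (y + l + 2%:R * s) * ((i%:~R + b) * y + i%:~R * l + s * (i - m)%:~R)).
Proof.
have m0 := exceptional_neq0.
have E := line_scaled_phi i m l; rewrite /A /B eqxx in E.
have M : m%:~R = - (2%:R * b) by rewrite intrN bk.
have [i0|i0] := eqVneq i 0; last first.
  have {}E := E y; rewrite (_ : i + m == m = false) ?mulr1 in E; last first.
    by rewrite -[X in _ == X]add0r (inj_eq (addIr m)); exact: negPf.
  rewrite E /R; have [im|im] := eqVneq i m.
    by rewrite im !(intrD, intrN) -bk; ring.
  by rewrite !(intrD, intrN) -bk; ring.
(* For i = 0 the index m is both a source and the target. The common factor y + 2s may vanish at the
   given y, so it is cancelled between polynomials in y. *)
subst i; rewrite add0r eqxx [0 == m]eq_sym (negPf m0) in E *.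
pose p := (c 0 * c m)%:P * (q (0 * g) (m * g)).[l%:P].
pose r := (c m * b)%:P * ('X + (l + 2%:R * s)%:P).
have : p = r.
  apply: (@cancel_shift _ _ (2%:R * s)) => z; have Ez := E z.
  rewrite /p /r !(hornerM, hornerC, hornerD, hornerX); apply: (eq_lin1 1 Ez).
  by rewrite /R !(intrD, intrN) -bk; ring.
by move=> /(congr1 (fun p : {poly F} => p.[y])); rewrite /p /r !(hornerM, hornerC,
  hornerD, hornerX) => ->; ring.
Qed.

(** If i + j = - 2b then i + b = (i - j) / 2 and the coefficient of l in [R i j] vanishes, so that
    [R i j] is (i - j) / 2 times the factor y + 2s to be cancelled. *)
Lemma exceptional_target (i j : int) l y : i != m -> j != m -> i + j = m ->
  c i * c j * phi (i * g) (j * g) l y = c m * ((i - j)%:~R / 2%:R).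
Proof.
move=> im jm ij.
have E := line_scaled_phi i j l; rewrite /A /B (negPf im) (negPf jm) ij eqxx in E.
pose p := (c i * c j)%:P * (q (i * g) (j * g)).[l%:P].
have : p = (c m * ((i - j)%:~R / 2%:R))%:P.
  apply: (@cancel_shift _ _ (2%:R * s)) => z; have Ez := E z.
  rewrite /p !(hornerM, hornerC, hornerD, hornerX); apply: (eq_lin1 1 Ez).
  have M : i%:~R + j%:~R = - (2%:R * b) :> F by rewrite -intrD ij intrN bk.
  have bE : b = - (i%:~R + j%:~R) / 2%:R.
    by rewrite M opprK mulrC mulrA mulVf ?mul1r // pnatr_eq0.
  rewrite /R !intrD M [in X in X * z]bE intrN; by field.
by move=> /(congr1 (fun p : {poly F} => p.[y])); rewrite /p !(hornerM, hornerC,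
  hornerD, hornerX).
Qed.

Lemma isomorphic_SCL2 : isomorphic L (SCL2 b s m).
Proof.
have [_ _ _ [mu0 _] _] := Hg.
have c_neq0 i : c i != 0.
  by rewrite /c; case: ifP => _; rewrite ?oppr_eq0 mulf_neq0 ?line_b0.
apply: (@iso_table int h c line_inj c_neq0 line_index) => i j.
right; exists (i + j).
pose Q (i : int) : {poly {poly F}} := if i == 0 then cst b * (dl + lam + 2%:R * cst s)
  else if i == m then - cst b * (- lam + 2%:R * cst s) * (dl + lam + 2%:R * cst s) *
    (dl + 2%:R * lam)
  else (dl + lam + 2%:R * cst s) * ((i%:~R + cst b) * dl + i%:~R * lam + cst s * (i -
    m)%:~R).
have QE n : SCL2_right b s m n = pscale (Q n) (gen F (n + m)).
  rewrite /SCL2_right /Q; case: eqP => [->|_]; first by rewrite add0r.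
  case: eqP => [->|//]; by rewrite (_ : m + m = 2 * m) //; ring.
have QP n l y : c n * c m * phi (n * g) (m * g) l y = c (n + m) * (Q n).[l%:P].[y].
  rewrite exceptional_right /Q; congr (_ * _).
  by case: (n == 0); last case: (n == m); rewrite /dl /lam /cst !symbE; ring.
rewrite /SCL2_table; have [->|jm] := eqVneq j m.
  exists (fun l => (Q i).[l%:P]); split=> [|l|l y];
    [by rewrite mulrDl | by rewrite QE ev_pscale | exact: QP].
have [->|im] := eqVneq i m.
  exists (fun l => - (Q j).[- l%:P - 'X]); split=> [|l|l y]; first by rewrite mulrDl.
    rewrite QE /ev evKN -/(ev _ _) ev_psubst_pscale scaleNr [m + j]addrC.
    by rewrite /lam /dl hornerD !hornerN hornerX hornerC.
  have := QP j (- l - y) y; rewrite [j + m]addrC => E.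
  rewrite phi_skew hornerN [in RHS]horner2 hornerD !hornerN hornerX hornerC.
  by apply: (eq_lin1 (-1) E); ring.
have [ij|ij] := eqVneq (i + j) m.
  exists (fun l => (cst ((i - j)%:~R / 2%:R)).[l%:P]); split=> [|l|l y];
    first by rewrite mulrDl.
    by rewrite ev_pscale ij.
  by rewrite ij exceptional_target // /cst !symbE.
exists (fun l => ((i%:~R + cst b) * dl + ((i + j)%:~R + 2%:R * cst b) * lam +
          cst s * (i - j)%:~R).[l%:P]).
split=> [|l|l y]; [by rewrite mulrDl | by rewrite ev_pscale |].
have := line_scaled_phi i j l y.
rewrite /B (negPf im) (negPf jm) (negPf ij) !mulr1 => ->.
by rewrite /R /dl /lam /cst !symbE; ring.
Qed.

End Exceptional.

End Line.
End StructureFunctions.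

(** * The classification in characteristic zero *)

Lemma br_morphism (F : numFieldType) (A B : conformal F) (f : {linear A -> B}) :
  bracket_morphism f -> forall a b l, br (f a) (f b) l = f (br a b l).
Proof.
move=> Hf a b l; have [N HN] := ev_bound (bracket a b).
rewrite /br (evE _ HN) (evE (N := N)) => [|n /HN E]; last by rewrite -Hf E linear0.
by rewrite linear_sum; apply: eq_bigr => i _; rewrite linearZ Hf.
Qed.

Lemma br_free_gen (F : numFieldType) (I : choiceType) t (i j : I) l :
  br (gen F i : free_conformal t) (gen F j) l = ev l (t i j).
Proof.
rewrite br_free /gen !msuppU oner_eq0 !big_seq_fset1 !mcoeffUU.
by rewrite hornerC comp_polyC polyC1 mul1r scale1r.
Qed.

Section GradedSimple.
Variables (F : numFieldType) (L : conformal F) (G : int -> submodClosed L).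
Hypothesis HL : lie_conformal L.
Hypothesis HG : graded G.
Hypothesis HS : graded_simple G.
Hypothesis Hrank : forall i, exists n : nat, has_rank (submod (G i)) n /\ (n <= 1)%N.
Hypothesis HVir : isomorphic_sub (Vir F) (G 0).

Lemma Virasoro_generator : exists e0, [/\ e0 \in G 0,
    forall x, x \in G 0 -> exists p, x = p *: e0,
    forall p, p *: e0 = 0 -> p = 0 &
    forall l, br e0 e0 l = ('X + (2%:R * l)%:P) *: e0].
Proof.
have [f [finj fG fb]] := HVir; exists (f (gen F tt)).
have genE (x : Vir F) : x = x@_tt *: (gen F tt : Vir F).
  by apply/malgP => -[]; rewrite mcoeffZ mcoeffUU mulr1.
split=> [|y /fG[x <-]|p|l]; first by apply/fG; exists (gen F tt).
- by exists x@_tt; rewrite {1}(genE x) linearZ.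
- rewrite -linearZ -(linear0 f) => /finj /(congr1 (fun x : {malg {poly F}[unit]} => x@_tt)).
  by rewrite mcoeffZ mcoeffUU mulr1 mcoeff0.
- rewrite br_morphism // -linearZ; congr (f _).
  by rewrite br_free_gen ev_pscale /dl /lam !symbE rmorphM rmorph_nat.
Qed.

Lemma graded_simple_classification :
  isomorphic L (Vir F)
  \/ (exists s : F, isomorphic L (V s))
  \/ (exists s : F, isomorphic L (CL1 s))
  \/ (exists b s : F,
        ~ (exists k : int, 2%:R * b = k%:~R) /\ isomorphic L (CL2 b s))
  \/ (exists (b s : F) (k : int),
        [/\ 2%:R * b = k%:~R, k != 0 & isomorphic L (SCL2 b s (- k))]).
Proof.
have [e0 [e0G G0e free0 e0e0]] := Virasoro_generator.
have tf := torsion_free HL HG HS e0G free0.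
have [e [al [de [[ee [al0 de0]] eG Ge br0]]]] :=
  G_basis HL HG HS Hrank e0G G0e free0 e0e0.
have e00 : e 0 != 0.
  apply/eqP => e00; have /free0/eqP : (1 : {poly F}) *: e0 = 0 by rewrite -ee e00 scaler0.
  by rewrite oner_eq0.
rewrite -ee in br0.
(* When one of the three generators is 0 the polynomial is chosen to be 0, so that a nonzero [q i j]
   certifies that i, j and i + j lie in the support. *)
have /choice[q' Hq'] : forall ij : int * int, exists q : {poly {poly F}}, let: (i,
  j) := ij in
    [/\ forall l, br (e i) (e j) l = q.[l%:P] *: e (i + j),
        forall l, br (e j) (e i) l = - (q.[- l%:P - 'X] *: e (i + j)) &
        q != 0 -> [/\ e i != 0, e j != 0 & e (i + j) != 0]].
  move=> [i j]; have [n|q [H1 H2]] := @bracket_poly _ _ HL (e i) (e j) (e (i + j)).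
    by apply: Ge; exact: HG.2.
  have [ei|ei] := eqVneq (e i) 0.
    by exists 0; split=> [l|l|]; rewrite ?ei ?br0l ?br0r ?horner0 ?scale0r ?oppr0 ?eqxx.
  have [ej|ej] := eqVneq (e j) 0.
    by exists 0; split=> [l|l|]; rewrite ?ej ?br0l ?br0r ?horner0 ?scale0r ?oppr0 ?eqxx.
  have [eij|eij] := eqVneq (e (i + j)) 0.
    by exists 0; split=> [l|l|]; rewrite ?H1 ?H2 ?eij ?scaler0 ?oppr0 ?eqxx.
  by exists q.
pose q i j := q' (i, j).
have Hq i j := Hq' (i, j).
have bre i j l : br (e i) (e j) l = (q i j).[l%:P] *: e (i + j) by case: (Hq i j).
have bre_skew i j l : br (e j) (e i) l = - ((q i j).[- l%:P - 'X] *: e (i + j)) by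
  case: (Hq i j).
have q0 i j : q i j != 0 -> [/\ e i != 0, e j != 0 & e (i + j) != 0] by case: (Hq i j).
case: (structure_classification HL HG HS tf e00 al0 de0 eG Ge br0 bre bre_skew q0).
- by move=> e1; left; exact: (isomorphic_Vir HL HG tf e00 al0 de0 eG Ge br0 bre).
- move=> [x [mu Hx]]; right; right; left.
  by exists (- al (- x)); exact: (isomorphic_CL1 HL HG tf e00 al0 eG Ge br0 bre q0 Hx).
move=> [g [th [mu Hg]]]; have [th0|th0] := eqVneq th 0.
  by right; left; exists (- al g); exact: (isomorphic_V HL HG tf e00 al0 eG Ge br0 bre
    q0 Hg).
have [[k bk]|nk] := pselect (exists k : int, 2%:R * (- th^-1) = k%:~R :> F); last first.
  do 3!right; left; exists (- th^-1), (- (- th^-1) * al g); split=> //.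
  exact: (isomorphic_CL2 HL HG tf e00 al0 eG Ge br0 bre q0 Hg th0).
do 4!right; exists (- th^-1), (- (- th^-1) * al g), k; split=> //.
  by have := exceptional_neq0 th0 bk; rewrite oppr_eq0.
exact: (isomorphic_SCL2 HL HG tf e00 al0 eG Ge br0 bre bre_skew q0 Hg th0).
Qed.

End GradedSimple.

Theorem theorem1p1 (R : realType) (L : conformal R[i])
    (G : int -> submodClosed L)
    (HL : lie_conformal L)
    (Hgraded : graded G)
    (Hsimple : graded_simple G)
    (C1 : forall i : int,
       exists n : nat, has_rank (submod (G i)) n /\ (n <= 1)%N)
    (C2 : isomorphic_sub (Vir R[i]) (G 0)) :
  isomorphic L (Vir R[i])
  \/ (exists s : R[i], isomorphic L (V s))
  \/ (exists s : R[i], isomorphic L (CL1 s))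
  \/ (exists b s : R[i],
        ~ (exists k : int, 2%:R * b = k%:~R) /\ isomorphic L (CL2 b s))
  \/ (exists (b s : R[i]) (k : int),
        [/\ 2%:R * b = k%:~R, k != 0 & isomorphic L (SCL2 b s (- k))]).
Proof. exact: (graded_simple_classification HL Hgraded Hsimple C1 C2). Qed.
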